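(* Let $f\in L_2(\Omega)$ be given and assume that there are $C_{\mathrm{PF}}>0$ and $c_{\mathrm{is}}>0$ such that \[ \|v\|\le C_{\mathrm{PF}}\|Av\|\quad\forall v\in H_0(A),\qquad \sup_{w\in H(A^* ),\ \|w\|_{A^*}=1}(A^*w,v)\ge c_{\mathrm{is}}\|v\|\quad\forall v\in L_2(\Omega). \] Consider the general ultraweak formulation: find $u\in L_2(\Omega)$, $w\in L_2(\Omega;U)$, $\phi\in H_0(A,\mathcal S)$, and $\psi\in H(A^*,\mathcal S)$ such that \[ (\mathcal C^{-1}w,\delta w)-(u,A^*\delta w)_{\mathcal T}-\langle\phi,\delta w\rangle_{\mathcal S}=0\quad\forall\delta w\in\widetilde H(A^*,\mathcal T), \] \[ -(w,A\delta u)_{\mathcal T}-\langle\psi,\delta u\rangle_{\mathcal S}=-(f,\delta u)\quad\forall\delta u\in\widetilde H(A,\mathcal T). \] This problem is well posed (it has exactly one solution, depending continuously on $f$). Its solution $(u,w,\phi,\psi)$ satisfies \[ \|u\|+\|w\|+\|\phi\|_{A,\mathcal S}+\|\psi\|_{A^*,\mathcal S}\le C\|f\| \] with a constant $C$ that is independent of $f$ and $\mathcal T$. Furthermore, $u\in H_0(A)$, $w=\mathcal C Au\in H(A^* )$, $\phi=\gamma_{A,\mathcal S}(u)$, $\psi=\gamma_{A^*,\mathcal S}(w)$, and $u$ solves $A^*\mathcal C Au=f$.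
   Context: Setting. $\Omega\subset\mathbb R^d$ ($d\in\mathbb N$) is a bounded Lipschitz domain and $U\in\{\mathbb R,\mathbb R^d,\mathbb R^{d\times d}\}$ or $U=\mathbb S:=\{w\in\mathbb R^{d\times d}: w=w^\top\}$. $A$ is a linear differential operator with constant coefficients taking scalar functions to $U$-valued functions, and $A^*$ is its formal adjoint (taking $U$-valued functions to scalar functions); both are applied in the distributional sense. $(\cdot,\cdot)$ and $\|\cdot\|$ are the $L_2(\Omega)$ inner product and norm (for scalar or $U$-valued functions). Set $H(A)=\{v\in L_2(\Omega): Av\in L_2(\Omega;U)\}$ with $\|v\|_A^2=\|v\|^2+\|Av\|^2$, and $H(A^* )=\{w\in L_2(\Omega;U): A^*w\in L_2(\Omega)\}$ with $\|w\|_{A^*}^2=\|w\|^2+\|A^*w\|^2$. The trace operator $\gamma_{A,\Gamma}:H(A)\to H(A^* )^*$ is $\langle\gamma_{A,\Gamma}(v),w\rangle_\Gamma:=(Av,w)-(v,A^*w)$, and $H_0(A):=\{v\in H(A):\gamma_{A,\Gamma}(v)=0\}$. $\mathcal C\in L_\infty(\Omega;U\times U)$ is a symmetric, (uniformly) positive definite tensor field, acting pointwise as a linear map $U\to U$, with pointwise inverse $\mathcal C^{-1}$. $\mathcal T=\{T\}$ is a regular mesh of polyhedral elements covering $\Omega$, with skeleton $\mathcal S=\bigcup\{\partial T: T\in\mathcal T\}$. $(\cdot,\cdot)_{\mathcal T}$ is the sum over $T\in\mathcal T$ of the $L_2(T)$ inner products, differential operators inside it being taken elementwise, and $\|\cdot\|_{\mathcal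 T}^2=(\cdot,\cdot)_{\mathcal T}$. Set $H(A,\mathcal T)=\{v\in L_2(\Omega): A(v|_T)\in L_2(T;U)\ \forall T\in\mathcal T\}$ with $\|v\|_{A,\mathcal T}^2=\|v\|^2+\|Av\|_{\mathcal T}^2$ and $H(A^*,\mathcal T)=\{w\in L_2(\Omega;U): A^*(w|_T)\in L_2(T)\ \forall T\in\mathcal T\}$ with $\|w\|_{A^*,\mathcal T}^2=\|w\|^2+\|A^*w\|_{\mathcal T}^2$. $\widetilde H(A,\mathcal T)$ and $\widetilde H(A^*,\mathcal T)$ are given closed subspaces with $H_0(A)\subset\widetilde H(A,\mathcal T)\subset H(A,\mathcal T)$ and $H(A^* )\subset\widetilde H(A^*,\mathcal T)\subset H(A^*,\mathcal T)$. Trace operators: $\gamma_{A,\mathcal S}:H(A)\to\widetilde H(A^*,\mathcal T)^*$, $\langle\gamma_{A,\mathcal S}(v),w\rangle_{\mathcal S}:=(Av,w)-(v,A^*w)_{\mathcal T}$, and $\gamma_{A^*,\mathcal S}:H(A^* )\to\widetilde H(A,\mathcal T)^*$, $\langle\gamma_{A^*,\mathcal S}(w),v\rangle_{\mathcal S}:=(A^*w,v)-(w,Av)_{\mathcal T}$. Trace spaces: $H(A,\mathcal S):=\gamma_{A,\mathcal S}(H(A))$, $H_0(A,\mathcal S):=\gamma_{A,\mathcal S}(H_0(A))$, $H(A^*,\mathcal S):=\gamma_{A^*,\mathcal S}(H(A^* ))$ with norms $\|\phi\|_{A,\mathcal S}:=\inf\{\|v\|_A: v\in H(A),\ \gamma_{A,\mathcal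 S}(v)=\phi\}$ and $\|\psi\|_{A^*,\mathcal S}:=\inf\{\|w\|_{A^*}: w\in H(A^* ),\ \gamma_{A^*,\mathcal S}(w)=\psi\}$. For trace-space elements, $\langle\phi,w\rangle_{\mathcal S}:=\langle\gamma_{A,\mathcal S}(v),w\rangle_{\mathcal S}$ for any $v\in H(A)$ with $\gamma_{A,\mathcal S}(v)=\phi$ ($w\in\widetilde H(A^*,\mathcal T)$), and $\langle\psi,v\rangle_{\mathcal S}:=\langle\gamma_{A^*,\mathcal S}(w),v\rangle_{\mathcal S}$ for any $w\in H(A^* )$ with $\gamma_{A^*,\mathcal S}(w)=\psi$ ($v\in\widetilde H(A,\mathcal T)$). *)

(* Defs.v *)
From HB Require Import structures.
From mathcomp Require Import all_boot all_order all_algebra.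
From mathcomp Require Import all_classical all_reals all_analysis.

Set Implicit Arguments.
Unset Strict Implicit.
Unset Printing Implicit Defensive.
Import Order.TTheory GRing.Theory Num.Theory.
Import numFieldNormedType.Exports.
Local Open Scope classical_set_scope.
Local Open Scope ring_scope.

Definition measure_rV_display (R : realType) (n : nat) : measure_display.
Proof. exact: default_measure_display. Qed.

(* Product sigma-algebra of the coordinate maps, as the library does for
   n.-tuple; on R^n it is the Borel sigma-algebra. *)
Section measurable_rV.
Context (R : realType) (n : nat).

Definition rV_coord (i : 'I_n) (x : 'rV[R]_n) : R := x ord0 i.

Let rV_set0 : g_sigma_preimage rV_coord set0.
Proof. exact: sigma_algebra0. Qed.

Let rV_setC B : g_sigma_preimage rV_coord B -> g_sigma_preimage rV_coord (~` B).
Proof. exact: sigma_algebraC. Qed.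

Let rV_bigcup (F : (set 'rV[R]_n)^nat) : (forall i, g_sigma_preimage rV_coord (F i)) ->
  g_sigma_preimage rV_coord (\bigcup_i (F i)).
Proof. exact: sigma_algebra_bigcup. Qed.

HB.instance Definition _ := @isMeasurable.Build (measure_rV_display R n)
  'rV[R]_n (g_sigma_preimage rV_coord) rV_set0 rV_setC rV_bigcup.

Lemma measurable_rV_coord (i : 'I_n) : measurable_fun [set: 'rV[R]_n] (rV_coord i).
Proof.
move=> _ Y mY; rewrite setTI; apply: sub_sigma_algebra => /=.
rewrite -bigcup_seq/=; exists i => /=; first by rewrite mem_index_enum.
by exists Y => //; rewrite setTI.
Qed.

Lemma measurable_fun_rVP d' (T1 : measurableType d') (f : T1 -> 'rV[R]_n) :
  (forall i, measurable_fun [set: T1] (fun x => f x ord0 i)) ->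
  measurable_fun [set: T1] f.
Proof.
move=> mf.
have H : g_sigma_preimage (fun i => rV_coord i \o f) `<=` measurable.
  apply: smallest_sub; first exact: sigma_algebra_measurable.
  move=> B; rewrite -bigcup_seq => -[i _ [C mC <-]].
  exact: mf.
rewrite g_sigma_preimage_comp in H.
by move=> _ A mA; apply: H; exists A.
Qed.

End measurable_rV.

Section lebesgue_measure_rV.
Context (R : realType).

Definition rV_cons n (p : measurableTypeR R * 'rV[R]_n) : 'rV[R]_n.+1 :=
  \row_(i < n.+1) oapp (fun j => p.2 ord0 j) p.1 (unlift ord0 i).
Arguments rV_cons : clear implicits.

Lemma measurable_rV_cons n : measurable_fun setT (rV_cons n).
Proof.
apply: measurable_fun_rVP => i.
case: (unliftP ord0 i) => [j|] ->.
- under eq_fun do rewrite /rV_cons mxE liftK /=.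
  apply: (@measurableT_comp _ _ _ _ _ _ (@rV_coord R n j)) => //=.
  exact: measurable_rV_coord.
- rewrite (_ : (fun x => _) = fst) ?measurable_fst//.
  by apply/funext => x; rewrite /rV_cons mxE unlift_none.
Qed.

Definition rV_uncons n (x : 'rV[R]_n.+1) : measurableTypeR R * 'rV[R]_n :=
  (x ord0 ord0, \row_j x ord0 (lift ord0 j)).

Lemma rV_consK n : cancel (rV_cons n) (@rV_uncons n).
Proof.
move=> [a y]; rewrite /rV_uncons /rV_cons !mxE unlift_none /=; congr pair.
by apply/rowP => j; rewrite !mxE liftK.
Qed.

Lemma measurable_rV_uncons n : measurable_fun setT (@rV_uncons n).
Proof.
apply/measurable_fun_pairP; split => /=.
  exact: (@measurable_rV_coord R n.+1 ord0).
apply: measurable_fun_rVP => j /=; under eq_fun do rewrite mxE.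
exact: (@measurable_rV_coord R n.+1 (lift ord0 j)).
Qed.

Section product_step.
Context (n : nat) (m : {sigma_finite_measure set 'rV[R]_n -> \bar R}).

Definition lebesgue_rV_step : set 'rV[R]_n.+1 -> \bar R :=
  pushforward (lebesgue_measure \x m)%E (@rV_cons n).

Let mu : {measure set 'rV[R]_n.+1 -> \bar R} :=
  @measure_function_pushforward__canonical__measure_function_Measure _ _ _ _ _
    (lebesgue_measure \x m)%E _ (@measurable_rV_cons n).

HB.instance Definition _ := isMeasure.Build _ _ _ lebesgue_rV_step
  (@measure0 _ _ _ mu) (@measure_ge0 _ _ _ mu)
  (@measure_semi_sigma_additive _ _ _ mu).

Let lebesgue_rV_step_sigma_finite : sigma_finite setT lebesgue_rV_step.
Proof.
have /sigma_finiteP[F [TF ndF Foo]] := sigma_finiteT (@lebesgue_measure R).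
have /sigma_finiteP[G [TG ndG Goo]] := sigma_finiteT m.
pose H k := F k `*` G k.
have UH : setT = \bigcup_k H k.
  rewrite -setXTT TF TG predeqE => -[x y]; split.
    move=> [/= [k _ Fx] [l _ Gy]]; exists (maxn k l) => //; split.
    - by move: x Fx; exact/subsetPset/ndF/leq_maxl.
    - by move: y Gy; exact/subsetPset/ndG/leq_maxr.
  by move=> [k _ []/= ? ?]; split; exists k.
exists (fun k => @rV_uncons n @^-1` H k).
  by rewrite -preimage_bigcup -UH preimage_setT.
move=> k; have [mF Fk] := Foo k; have [mG Gk] := Goo k.
have mH : measurable (H k) by exact: measurableX.
split.
  by rewrite -[X in measurable X]setTI; apply: measurable_rV_uncons.
rewrite /lebesgue_rV_step /pushforward -comp_preimage.
rewrite (_ : _ \o _ = id); last exact/funext/rV_consK.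
by rewrite preimage_id product_measure1E// lte_mul_pinfty// ge0_fin_numE.
Qed.

HB.instance Definition _ := Measure_isSigmaFinite.Build _ _ _
  lebesgue_rV_step lebesgue_rV_step_sigma_finite.

End product_step.

(* Lebesgue measure on R^n, by R^(n+1) = R x R^n. *)
Fixpoint lebesgue_rV n : {sigma_finite_measure set 'rV[R]_n -> \bar R} :=
  if n is k.+1 then lebesgue_rV_step (lebesgue_rV k) else \d_ (0 : 'rV[R]_0).
End lebesgue_measure_rV.

Definition mxdot (R : realType) (m n : nat) (M N : 'M[R]_(m, n)) : R :=
  \sum_(i < m) \sum_(j < n) M i j * N i j.

Definition mxnorm2 (R : realType) (m n : nat) (M : 'M[R]_(m, n)) : R :=
  Num.sqrt (mxdot M M).

Section domains_and_meshes.
Context (R : realType) (d : nat).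
Implicit Types (Omega K P : set 'rV[R]_d) (x y e : 'rV[R]_d).

Definition bdry K := closure K `\` K°.

(* Near every boundary point, the set is the strict epigraph, in some unit
   direction e, of a Lipschitz function of the coordinates orthogonal to e
   (invariance of g along e). *)
Definition lipschitz_boundary Omega := forall x0, bdry Omega x0 ->
  exists (e : 'rV[R]_d) (g : 'rV[R]_d -> R) (L : R),
    [/\ mxdot e e = 1,
        forall x t, g (x + t *: e) = g x,
        forall x y, `|g x - g y| <= L * mxnorm2 (x - y) &
        \forall x \near x0, Omega x <-> g x < mxdot x e].

Definition bounded_lipschitz_domain Omega :=
  [/\ Omega !=set0, open Omega, connected Omega, bounded_set Omega &
      lipschitz_boundary Omega].

Definition convex_polytope P := bounded_set P /\
  exists s : seq ('rV[R]_d * R),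
    (forall h, h \in s -> h.1 != 0) /\
    P = [set x | forall h, h \in s -> mxdot h.1 x <= h.2].

(* Not necessarily convex; the element itself is the open set. *)
Definition polyhedral_element K :=
  [/\ K !=set0, open K, connected K, K = (closure K)° &
      exists (n : nat) (P : 'I_n -> set 'rV[R]_d),
        (forall i, convex_polytope (P i)) /\
        closure K = \bigcup_(i in [set: 'I_n]) P i].

(* The relatively open face (vertex, open edge, ..., open facet, interior) of a
   closed polyhedron P containing x: the connected component of x in the set of
   points of P around which P looks like it does around x. *)
Definition same_germ P x y := \forall z \near (0 : 'rV[R]_d), P (x + z) <-> P (y + z).

Definition open_face P x : set 'rV[R]_d :=
  connected_component [set y | P y /\ same_germ P x y] x.

(* Face-to-face mesh: where two distinct closed elements meet, they meet along
   common faces; for convex elements this says that their intersection is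
   empty or a common face. *)
Definition regular_mesh Omega (I : finType) (T : I -> set 'rV[R]_d) :=
  [/\ forall i, polyhedral_element (T i) /\ T i `<=` Omega,
      trivIset setT T,
      closure Omega = \bigcup_(i in [set: I]) closure (T i) &
      forall i j, i != j -> forall x, closure (T i) x -> closure (T j) x ->
        open_face (closure (T i)) x = open_face (closure (T j)) x].

End domains_and_meshes.

Inductive value_kind := Scalars | Vectors | Matrices | SymMatrices.

Definition value_rows (d : nat) (k : value_kind) : nat :=
  if k is Scalars then 1%N else d.

Definition value_cols (d : nat) (k : value_kind) : nat :=
  match k with Scalars | Vectors => 1%N | Matrices | SymMatrices => d end.

(* U = R, R^d, R^(d x d) or S, as a subspace of a space of matrices carrying the
   Frobenius inner product mxdot. *)
Definition value_space (R : realType) (d : nat) (k : value_kind) :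
    set 'M[R]_(value_rows d k, value_cols d k) :=
  match k with
  | SymMatrices => [set M : 'M[R]_d | M^T = M]
  | _ => setT
  end.
Arguments value_space : clear implicits.

(* The coefficients A a of an operator v |-> sum_a d^a v *: A a, where a ranges
   over the multi-indices with all entries at most k. *)
Definition diffop (R : realType) (d k m n : nat) :=
  {ffun 'I_d -> 'I_k.+1} -> 'M[R]_(m, n).

Section differential_operators.
Context (R : realType) (d : nat).

Definition partial (i : 'I_d) (f : 'rV[R]_d -> R) : 'rV[R]_d -> R :=
  fun x => 'D_(delta_mx ord0 i) f x.

Definition multi_partial (k : nat) (a : {ffun 'I_d -> 'I_k.+1})
    (f : 'rV[R]_d -> R) : 'rV[R]_d -> R :=
  foldr (fun i g => iter (a i) (partial i) g) f (enum 'I_d).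

Definition smooth (f : 'rV[R]_d -> R) := forall s : seq 'I_d,
  continuous (foldr partial f s) /\
  forall i x, derivable (foldr partial f s) x (delta_mx ord0 i).

Definition test_fun (omega : set 'rV[R]_d) (f : 'rV[R]_d -> R) := smooth f /\
  exists K, [/\ compact K, K `<=` omega & forall x, ~ K x -> f x = 0].

Definition test_field (m n : nat) (omega : set 'rV[R]_d) (U : set 'M[R]_(m, n))
    (F : 'rV[R]_d -> 'M[R]_(m, n)) :=
  (forall i j, test_fun omega (fun x => F x i j)) /\ forall x, U (F x).

Context (k m n : nat) (A : diffop R d k m n).

Definition diffop_apply (f : 'rV[R]_d -> R) : 'rV[R]_d -> 'M[R]_(m, n) :=
  fun x => \sum_(a : {ffun 'I_d -> 'I_k.+1}) multi_partial a f x *: A a.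

Definition diffop_adj_apply (F : 'rV[R]_d -> 'M[R]_(m, n)) : 'rV[R]_d -> R :=
  fun x => \sum_(a : {ffun 'I_d -> 'I_k.+1})
    (-1) ^+ (\sum_(l < d) a l)%N *
    \sum_(i < m) \sum_(j < n) A a i j * multi_partial a (fun y => F y i j) x.

End differential_operators.

(* Elements of L2 are represented by functions on R^d that are only looked at on
   the set omega; equality in L2(omega) is equality a.e. in omega. *)
Section L2_spaces.
Context (R : realType) (d : nat).
Local Notation leb := (lebesgue_rV R d).

Definition L2 (omega : set 'rV[R]_d) : set ('rV[R]_d -> R) :=
  [set v : 'rV[R]_d -> R | measurable_fun omega v /\
           leb.-integrable omega (fun x => (v x ^+ 2)%:E)].

Definition ip (omega : set 'rV[R]_d) (v v' : 'rV[R]_d -> R) : R :=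
  \int[leb]_(x in omega) (v x * v' x).

Definition nrm (omega : set 'rV[R]_d) (v : 'rV[R]_d -> R) : R :=
  Num.sqrt (ip omega v v).

Context (m n : nat).
Implicit Types (w : 'rV[R]_d -> 'M[R]_(m, n)).

Definition L2U (omega : set 'rV[R]_d) (U : set 'M[R]_(m, n)) :
    set ('rV[R]_d -> 'M[R]_(m, n)) :=
  [set w : 'rV[R]_d -> 'M[R]_(m, n) |
    [/\ forall i j, measurable_fun omega (fun x => w x i j),
               leb.-integrable omega (fun x => (mxdot (w x) (w x))%:E) &
               {ae leb, forall x, omega x -> U (w x)}]].

Definition ipU (omega : set 'rV[R]_d) w w' : R :=
  \int[leb]_(x in omega) mxdot (w x) (w' x).

Definition nrmU (omega : set 'rV[R]_d) w : R := Num.sqrt (ipU omega w w).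

End L2_spaces.

Section operator_spaces.
Context (R : realType) (d k m n : nat).
Context (U : set 'M[R]_(m, n)) (A : diffop R d k m n).
Implicit Types (omega : set 'rV[R]_d).
Implicit Types (v h : 'rV[R]_d -> R) (w g : 'rV[R]_d -> 'M[R]_(m, n)).

Definition weak_op omega v g := L2U omega U g /\
  forall F, test_field omega U F -> ip omega v (diffop_adj_apply A F) = ipU omega g F.

Definition weak_adj omega w h := L2 omega h /\
  forall f, test_fun omega f -> ipU omega w (diffop_apply A f) = ip omega h f.

(* The distribution A(v|omega), resp. A^*(w|omega), when it is in L2(omega). *)
Definition opA omega v : 'rV[R]_d -> 'M[R]_(m, n) :=
  xget (fun=> 0) [set g | weak_op omega v g].

Definition opAs omega w : 'rV[R]_d -> R :=
  xget (fun=> 0) [set h | weak_adj omega w h].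

Definition HA omega : set ('rV[R]_d -> R) :=
  [set v | L2 omega v /\ exists g, weak_op omega v g].

Definition HAs omega : set ('rV[R]_d -> 'M[R]_(m, n)) :=
  [set w | L2U omega U w /\ exists h, weak_adj omega w h].

Definition nrmA omega v : R :=
  Num.sqrt (nrm omega v ^+ 2 + nrmU omega (opA omega v) ^+ 2).

Definition nrmAs omega w : R :=
  Num.sqrt (nrmU omega w ^+ 2 + nrm omega (opAs omega w) ^+ 2).

Context (Omega : set 'rV[R]_d).

(* Trace functionals are functions on the (set coerced to a) type of the space
   they act on, so that equality of functionals is Leibniz equality. *)
Definition trace_Gamma v : HAs Omega -> R :=
  fun w : HAs Omega => ipU Omega (opA Omega v) (val w) - ip Omega v (opAs Omega (val w)).

Definition H0A : set ('rV[R]_d -> R) :=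
  [set v | HA Omega v /\ trace_Gamma v = (fun=> 0)].

Context (I : finType) (T : I -> set 'rV[R]_d).

Definition HA_mesh : set ('rV[R]_d -> R) :=
  [set v | L2 Omega v /\ forall i, exists g, weak_op (T i) v g].

Definition HAs_mesh : set ('rV[R]_d -> 'M[R]_(m, n)) :=
  [set w | L2U Omega U w /\ forall i, exists h, weak_adj (T i) w h].

Definition ipA_mesh w v : R := \sum_(i : I) ipU (T i) w (opA (T i) v).

Definition ipAs_mesh v w : R := \sum_(i : I) ip (T i) v (opAs (T i) w).

Definition nrmA_mesh v : R :=
  Num.sqrt (nrm Omega v ^+ 2 + \sum_(i : I) nrmU (T i) (opA (T i) v) ^+ 2).

Definition nrmAs_mesh w : R :=
  Num.sqrt (nrmU Omega w ^+ 2 + \sum_(i : I) nrm (T i) (opAs (T i) w) ^+ 2).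

Context (Ht : set ('rV[R]_d -> R)) (Hts : set ('rV[R]_d -> 'M[R]_(m, n))).

Definition trace_A v : Hts -> R :=
  fun w : Hts => ipU Omega (opA Omega v) (val w) - ipAs_mesh v (val w).

Definition trace_As w : Ht -> R :=
  fun v : Ht => ip Omega (opAs Omega w) (val v) - ipA_mesh w (val v).

Definition H0A_skel : set (Hts -> R) := trace_A @` H0A.

Definition HAs_skel : set (Ht -> R) := trace_As @` HAs Omega.

Definition nrmA_skel (phi : Hts -> R) : R :=
  inf [set nrmA Omega v | v in [set v | HA Omega v /\ trace_A v = phi]].

Definition nrmAs_skel (psi : Ht -> R) : R :=
  inf [set nrmAs Omega w | w in [set w | HAs Omega w /\ trace_As w = psi]].

(* Values of C x outside U are irrelevant: C x stands for a map U -> U. *)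
Definition spd_tensor_field (C : 'rV[R]_d -> {linear 'M[R]_(m, n) -> 'M[R]_(m, n)}) :=
  [/\ forall M i j, measurable_fun Omega (fun x => C x M i j),
      exists c1 : R, {ae lebesgue_rV R d, forall x, Omega x ->
        forall M, U M -> U (C x M) /\ mxnorm2 (C x M) <= c1 * mxnorm2 M},
      {ae lebesgue_rV R d, forall x, Omega x ->
        forall M N, U M -> U N -> mxdot (C x M) N = mxdot M (C x N)} &
      exists2 c0 : R, 0 < c0 & {ae lebesgue_rV R d, forall x, Omega x ->
        forall M, U M -> c0 * mxdot M M <= mxdot (C x M) M}].

Definition tensor_inv (C : 'rV[R]_d -> {linear 'M[R]_(m, n) -> 'M[R]_(m, n)}) x
    (N : 'M[R]_(m, n)) : 'M[R]_(m, n) := xget 0 [set M | U M /\ C x M = N].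

Definition ultraweak_solution
    (C : 'rV[R]_d -> {linear 'M[R]_(m, n) -> 'M[R]_(m, n)}) f u w phi psi :=
  [/\ L2 Omega u, L2U Omega U w, H0A_skel phi, HAs_skel psi &
      (forall dw : Hts,
         ipU Omega (fun x => tensor_inv C x (w x)) (val dw)
         - ipAs_mesh u (val dw) - phi dw = 0) /\
      (forall du : Ht, - ipA_mesh w (val du) - psi du = - ip Omega f (val du))].

End operator_spaces.

(* Closedness in the seminorm N also makes S stable under equality a.e. *)
Definition closed_subspace_of (R : realType) (X : Type) (V : lmodType R)
    (N : (X -> V) -> R) (H S : set (X -> V)) :=
  [/\ S `<=` H, S (fun=> 0),
      forall (a : R) u v, S u -> S v -> S (fun x => a *: u x + v x) &
      forall u, H u ->
        (forall eps : R, 0 < eps -> exists2 v, S v & N (fun x => u x - v x) < eps) ->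
        S u].

(* Main.v *)
(* On conforming test functions the skeleton functionals vanish: [phi] kills
   H(A^* ) because its representative lies in H_0(A), and [psi] kills H_0(A).
   Testing only with these (they contain the smooth compactly supported
   functions, which determine A u and A^* w) shows that u is in H_0(A),
   w = C A u and A^* w = f; the remaining test functions then force
   phi = tr(u) and psi = tr(w).  Conversely every such strong solution solves
   the ultraweak problem, because the mesh skeleton is a null set.  So nothing
   depends on the mesh: existence is the Riesz representation of (f, v) for the
   form (C A u, A v) on H_0(A), which is coercive by the Poincare inequality,
   and the bound follows by testing with v = u. *)

Require Import Defs.
From mathcomp Require Import all_boot all_order all_algebra.
From mathcomp Require Import all_classical all_reals all_analysis.
From mathcomp Require Import measurable_realfun.
From mathcomp Require Import ring lra.

Set Implicit Arguments.
Unset Strict Implicit.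
Unset Printing Implicit Defensive.

Import Order.TTheory GRing.Theory Num.Theory.
Import numFieldNormedType.Exports.

Local Open Scope classical_set_scope.
Local Open Scope ring_scope.

(** * Riesz representation *)

(** Members of L2 stay functions on R^d; nothing is divided by equality a.e. Every space is
    therefore only seminormed, and the Riesz representation is proved for a positive semidefinite
    form on a set closed under [a u + v], with completeness stated for a bare distance. Two
    obstacles shape the rest. The field C^-1 w is a pointwise choice whose measurability is not
    known beforehand; a second use of the Riesz representation, for the form (C g, h) on L2 fields,
    yields a measurable g with C g = w a.e., and integrals are shown to ignore null sets even when
    the integrand is not measurable. Secondly, A v and the adjoint applied to w are chosen
    representatives, so the local and the global ones can be compared only a.e. That comparison
    rests on the fundamental lemma of the calculus of variations, for which smooth compactly
    supported functions are built from exp(-1/t) and boxes generate the sigma-algebra. *)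

Section completeness.
Context (R : realType) (V : Type).
Implicit Types (dist : V -> V -> R) (u : nat -> V) (S : set V).

Definition cauchy_for dist u := forall e : R, 0 < e ->
  exists N, forall n m, (N <= n)%N -> (N <= m)%N -> dist (u n) (u m) < e.

Definition converges_for dist u x := forall e : R, 0 < e ->
  exists N, forall n, (N <= n)%N -> dist (u n) x < e.

Definition complete_for dist S := forall u, (forall n, S (u n)) ->
  cauchy_for dist u -> exists2 x, S x & converges_for dist u x.

End completeness.

(** For d > 0 it suffices to evaluate at the minimizer t = - c / d. For d = 0 and c != 0 the value
    at t = - (a + 1) / (2 c) would be -1. *)
Lemma discriminant_le (R : realFieldType) (a c d : R) : 0 <= d ->
  (forall t, 0 <= a + 2 * t * c + t ^+ 2 * d) -> c ^+ 2 <= a * d.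
Proof.
rewrite le_eqVlt => /orP[/eqP <- H|d0 H].
- have [->|c0] := eqVneq c 0; first by rewrite expr0n mulr0.
  have := H (- (a + 1) / (2 * c)).
  rewrite (_ : _ + _ + _ = -1) ?ler0N1 //; field; exact: c0.
- have := H (- c / d).
  rewrite (_ : _ + _ + _ = (a * d - c ^+ 2) / d); last by field; rewrite gt_eqF.
  by rewrite pmulr_lge0 ?invr_gt0// subr_ge0.
Qed.

(* The operation [lin a u v] stands for [a u + v]; no law is required of it. *)
Section semi_inner_product.
Context (R : realType) (V : Type) (lin : R -> V -> V -> V) (S : set V).
Context (b : V -> V -> R).
Hypothesis S_lin : forall a u v, S u -> S v -> S (lin a u v).
Hypothesis b_sym : forall u v, S u -> S v -> b u v = b v u.
Hypothesis b_lin : forall a u v w, S u -> S v -> S w ->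
  b (lin a u v) w = a * b u w + b v w.
Hypothesis b_ge0 : forall u, S u -> 0 <= b u u.

Definition snorm u : R := Num.sqrt (b u u).

Lemma snorm_ge0 u : 0 <= snorm u. Proof. exact: sqrtr_ge0. Qed.

Lemma snorm_sqr u : S u -> snorm u ^+ 2 = b u u.
Proof. by move=> Su; rewrite sqr_sqrtr ?b_ge0. Qed.

Lemma b_lin_lin a u v : S u -> S v ->
  b (lin a u v) (lin a u v) = a ^+ 2 * b u u + 2 * a * b u v + b v v.
Proof.
move=> Su Sv; have SL := S_lin a Su Sv.
rewrite b_lin// (b_sym Su SL) (b_sym Sv SL) !b_lin//.
by rewrite (b_sym Sv Su); ring.
Qed.

(** The discriminant inequality for the nonnegative quadratic [t |-> b (t u + v) (t u + v)]. *)
Lemma cauchy_schwarz u v : S u -> S v -> `|b u v| <= snorm u * snorm v.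
Proof.
move=> Su Sv.
rewrite -ler_sqr ?nnegrE ?mulr_ge0 ?snorm_ge0 ?normr_ge0//.
rewrite exprMn !snorm_sqr// real_normK ?num_real// mulrC.
apply: discriminant_le; first exact: b_ge0.
move=> t; have := b_ge0 (S_lin t Su Sv); rewrite b_lin_lin//.
by congr (_ <= _); ring.
Qed.

(* [J] is bounded below on [S]; the parallelogram law makes a minimizing sequence
   Cauchy, and [l v - b x v] is the derivative of [J] at the limit [x]. *)
Lemma riesz_representation (l : V -> R) (K : R) z : S z ->
  (forall a u v, S u -> S v -> l (lin a u v) = a * l u + l v) ->
  (forall v, S v -> `|l v| <= K * snorm v) ->
  complete_for (fun u v => snorm (lin (-1) u v)) S ->
  exists2 x, S x & forall v, S v -> b x v = l v.
Proof.
move=> Sz l_lin l_bd S_compl.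
pose J v := b v v - 2 * l v.
have JK v : S v -> - K ^+ 2 <= J v.
  move=> Sv; rewrite /J -snorm_sqr//.
  have := l_bd _ Sv; rewrite ler_norml => /andP[_ h].
  have := sqr_ge0 (K - snorm v); nra.
have hJ : has_inf (J @` S).
  by split; [exists (J z), z | exists (- K ^+ 2) => _ [v Sv <-]; exact: JK].
set m := inf (J @` S).
have mJ v : S v -> m <= J v.
  by move=> Sv; apply: (ge_inf (proj2 hJ)); exists v.
have /choice[u Hu] : forall n, exists v, S v /\ J v < m + n.+1%:R^-1.
  move=> n.
  have n0 : 0 < n.+1%:R^-1 :> R by rewrite invr_gt0.
  have [_ [v Sv <-] Jv] := inf_adherent n0 hJ.
  by exists v.
have Su n : S (u n) by case: (Hu n).
have Ju n : J (u n) < m + n.+1%:R^-1 by case: (Hu n).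
have inv_lt e : 0 < e -> exists N, forall n, (N <= n)%N -> n.+1%:R^-1 < e :> R.
  move=> e0; exists (Num.trunc e^-1).+1 => n Nn.
  rewrite invf_plt ?posrE//; apply: lt_trans (truncnS_gt _) _.
  by rewrite ltr_nat ltnS.
have [x Sx xu] : exists2 x, S x & converges_for (fun u v => snorm (lin (-1) u v)) u x.
  apply: S_compl => // e e0.
  (* The parallelogram law bounds the squared distance of u_i and u_j by 2 J(u_i) + 2 J(u_j) - 4 m <
     2 / (i+1) + 2 / (j+1), which is below e^2 once both reciprocals are below e^2 / 4. *)
  have [N HN] := inv_lt (e ^+ 2 / 4) (ltac:(by rewrite divr_gt0 ?exprn_gt0)).
  exists N => i j Ni Nj.
  rewrite -ltr_sqr ?nnegrE ?snorm_ge0 ?(ltW e0)// snorm_sqr; last exact: S_lin.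
  rewrite b_lin_lin//.
  pose w := lin 1 (u i) (u j).
  have Sw : S w by exact: S_lin.
  (* The midpoint of u_i and u_j: - w/2 + w, a scaling written with [lin] alone. *)
  pose h := lin (- 2^-1) w w.
  have Sh : S h by exact: S_lin.
  have := mJ _ Sh; rewrite /J b_lin_lin// l_lin// b_lin_lin// l_lin//.
  have := Ju i; have := Ju j; rewrite /J.
  have := HN _ Ni; have := HN _ Nj.
  move: (b (u i) (u i)) (b (u j) (u j)) (b (u i) (u j)) => bi bj bij.
  by move: (l (u i)) (l (u j)) (i.+1%:R^-1) (j.+1%:R^-1) => li lj ni nj; lra.
exists x => // v Sv; apply/eqP; rewrite -subr_eq0 -normr_le0.
apply/ler_addgt0Pl => e e0; rewrite addr0.
have v1 : 0 < snorm v + 1 by rewrite ltr_wpDl ?snorm_ge0.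
have [N1 H1] := xu (e / 2 / (snorm v + 1)) (ltac:(by rewrite !divr_gt0)).
have [N2 H2] := inv_lt ((e / 2 / (snorm v + 1)) ^+ 2)
  (ltac:(by rewrite exprn_gt0 ?divr_gt0)).
pose n := maxn N1 N2.
have {H1} A1 := H1 n (leq_maxl _ _); have {H2} A2 := H2 n (leq_maxr _ _).
(* The error is split into b(x - u_n, v), small by Cauchy-Schwarz and convergence, and l v - b(u_n,
   v), small because u_n is nearly minimal. *)
rewrite (_ : b x v - l v = - b (lin (-1) (u n) x) v * -1 - (l v - b (u n) v)); last first.
  by rewrite b_lin//; ring.
apply: le_trans (ler_normB _ _) _.
have -> : e = e / 2 + e / 2 by lra.
apply: lerD.
  rewrite mulrN1 opprK; apply: le_trans (cauchy_schwarz _ _) _ => //; first exact: S_lin.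
  apply: (@le_trans _ _ (e / 2 / (snorm v + 1) * (snorm v + 1))); last first.
    by rewrite divfK// gt_eqF.
  by apply: ler_pM; rewrite ?snorm_ge0// ?ltW// ltrDl.
(* J(u_n - t v) >= m > J(u_n) - 1/(n+1) for every t is a nonnegative quadratic in t, whose
   discriminant gives the bound. *)
have D : (l v - b (u n) v) ^+ 2 <= n.+1%:R^-1 * b v v.
  apply: discriminant_le; first exact: b_ge0.
  move=> t; have := mJ _ (S_lin (- t) Sv (Su n)).
  rewrite /J b_lin_lin// l_lin// (b_sym Sv (Su n)).
  have := Ju n; rewrite /J.
  move: (b v v) (b (u n) (u n)) (b (u n) v) (l v) (l (u n)) (n.+1%:R^-1).
  by move=> x1 x2 x3 x4 x5 x6; nra.
rewrite -ler_sqr ?nnegrE ?divr_ge0 ?(ltW e0)// real_normK ?num_real//.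
apply: (le_trans D); rewrite -snorm_sqr//.
apply: (@le_trans _ _ ((e / 2 / (snorm v + 1)) ^+ 2 * (snorm v + 1) ^+ 2)); last first.
  by rewrite -exprMn divfK// gt_eqF.
apply: ler_pM; rewrite ?sqr_ge0 ?invr_ge0 ?(ltW A2)//.
by rewrite ler_sqr ?nnegrE ?snorm_ge0 ?(ltW v1)// ltW// ltrDl.
Qed.

End semi_inner_product.

(** * The spaces L2 *)

Section null_sets.
Context d (T : measurableType d) (R : realType).
Context (mu : {measure set T -> \bar R}) (D : set T).
Local Open Scope ereal_scope.
Import HBNNSimple.

(** The integral of a nonnegative function is a supremum over the simple functions below it. A
    simple function below f, set to 0 on the exceptional null set, lies below g and keeps its
    integral. Measurability is avoided because [tensor_inv] is a pointwise choice. *)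
Lemma ge0_ae_le_integral_nonmeasurable (f g : T -> \bar R) :
  (forall x, D x -> 0 <= f x) -> (forall x, D x -> 0 <= g x) ->
  ae_eq mu D f g -> \int[mu]_(x in D) f x <= \int[mu]_(x in D) g x.
Proof.
move=> f0 g0 [N [mN N0 fgN]].
rewrite !ge0_integralE//; apply: ge_ereal_sup => _ [h hf <-].
have mCN := measurableC mN.
apply: ereal_sup_ubound; exists (proj_nnsfun h mCN).
  move=> x /=; rewrite mindicE; have [xN|xN] := boolP (x \in ~` N).
    rewrite mulr1; apply: (le_trans (hf x)); rewrite /patch.
    case: ifPn => // xD; suff -> : f x = g x by [].
    apply: contrapT => fgx; move: xN; rewrite inE; apply; apply: fgN => /=.
    by move=> /(_ (set_mem xD)).
  by rewrite mulr0 erestrict_ge0.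
have E (k : {nnsfun T >-> R}) : sintegral mu k = \int[mu]_x (k x)%:E.
  by rewrite integral_nnsfun// patch_setT.
rewrite !E; apply: ae_eq_integral => //.
- exact/measurable_EFinP.
- exact/measurable_EFinP.
- exists N; split => // x /= /not_implyP[_].
  by apply: contra_notP => Nx; rewrite /= mindicE mem_set ?mulr1.
Qed.

Lemma ae_eq_integral_nonmeasurable (f g : T -> \bar R) :
  ae_eq mu D f g -> \int[mu]_(x in D) f x = \int[mu]_(x in D) g x.
Proof.
have ge0 f' g' : (forall x, D x -> 0 <= f' x) -> (forall x, D x -> 0 <= g' x) ->
    ae_eq mu D f' g' -> \int[mu]_(x in D) f' x = \int[mu]_(x in D) g' x.
  move=> f0 g0 fg; apply/eqP; rewrite eq_le.
  by rewrite !ge0_ae_le_integral_nonmeasurable//; exact: ae_eq_sym.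
move=> /ae_eq_funeposneg[fgp fgn].
by rewrite integralE [RHS]integralE; congr (_ - _); apply: ge0.
Qed.

End null_sets.

Lemma ae_eq_Rintegral d (T : measurableType d) (R : realType)
    (mu : {measure set T -> \bar R}) (D : set T) (f g : T -> R) :
  ae_eq mu D f g -> \int[mu]_(x in D) f x = \int[mu]_(x in D) g x.
Proof.
move=> fg; congr fine; apply: ae_eq_integral_nonmeasurable.
by apply: filterS fg => x h Dx /=; rewrite h.
Qed.

Lemma Rintegral_eq0 d (T : measurableType d) (R : realType)
    (mu : {measure set T -> \bar R}) (D : set T) (f : T -> R) : measurable D ->
  mu.-integrable D (EFin \o f) -> (forall x, D x -> 0 <= f x) ->
  \int[mu]_(x in D) f x = 0 -> ae_eq mu D f (cst 0).
Proof.
move=> mD fi f0 I0; have mf := measurable_int _ fi.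
have : ae_eq mu D (EFin \o f) (cst 0%E).
  apply/ae_eq_integral_abs => //.
  rewrite (@eq_integral _ _ _ _ _ (EFin \o f)); last first.
    by move=> x /set_mem Dx /=; rewrite ger0_norm// f0.
  by rewrite -[LHS]fineK ?integrable_fin_num//; congr EFin.
by apply: filterS => x h Dx; have /= [] := h Dx.
Qed.

Section L2_scalar.
Context (R : realType) (d : nat) (omega : set 'rV[R]_d).
Hypothesis mo : measurable omega.
Local Notation leb := (lebesgue_rV R d).
Implicit Types u v w : 'rV[R]_d -> R.

Lemma L2_integrable u v : L2 omega u -> L2 omega v ->
  leb.-integrable omega (fun x => (u x * v x)%:E).
Proof.
move=> [mu ui] [mv vi]; apply: (le_integrable mo) (integrableD mo ui vi).
  by apply/measurable_EFinP; exact: measurable_funM.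
move=> x _ /=; rewrite lee_fin [leRHS]ger0_norm ?addr_ge0 ?sqr_ge0// ler_norml.
by have := sqr_ge0 (u x - v x); have := sqr_ge0 (u x + v x);
  rewrite sqrrD sqrrB; have := sqr_ge0 (u x); have := sqr_ge0 (v x); nra.
Qed.

Lemma L2_lin a u v : L2 omega u -> L2 omega v -> L2 omega (fun x => a * u x + v x).
Proof.
move=> Lu Lv; split.
  apply: measurable_funD; last by case: Lv.
  by apply: measurable_funM => //; case: Lu.
have -> : (fun x => ((a * u x + v x) ^+ 2)%:E) =
  (fun x => ((a ^+ 2)%:E * (u x * u x)%:E + ((2 * a)%:E * (u x * v x)%:E
    + (v x * v x)%:E))%E).
  by apply/funext => x; rewrite -!EFinM -!EFinD; congr EFin; ring.
by do ![apply: integrableD => //]; do ?[apply: integrableZl => //]; exact: L2_integrable.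
Qed.

Lemma L2_0 : L2 omega (fun=> 0).
Proof.
split; first exact: measurable_cst.
by rewrite (_ : (fun _ => _) = cst 0%E) ?integrable0//; apply/funext => x; rewrite expr0n.
Qed.

Lemma L2_sub u v : L2 omega u -> L2 omega v -> L2 omega (fun x => u x - v x).
Proof.
move=> Lu Lv; have := L2_lin (-1) Lv Lu.
by congr (L2 _ _); apply/funext => x; ring.
Qed.

Lemma L2_scale a u : L2 omega u -> L2 omega (fun x => a * u x).
Proof.
move=> Lu; have := L2_lin a Lu L2_0.
by congr (L2 _ _); apply/funext => x; rewrite addr0.
Qed.

Lemma L2_sum (J : finType) (F : J -> 'rV[R]_d -> R) :
  (forall j, L2 omega (F j)) -> L2 omega (fun x => \sum_j F j x).
Proof.
move=> LF; rewrite (_ : (fun x => _) = \sum_j F j); last first.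
  by apply/funext => x; rewrite fct_sumE.
elim/big_ind: _ => //; first exact: L2_0.
move=> u v Lu Lv; have := L2_lin 1 Lu Lv.
by congr (L2 _ _); apply/funext => x; rewrite mul1r.
Qed.

Lemma ip_sym u v : ip omega u v = ip omega v u.
Proof. by apply: eq_Rintegral => x _; rewrite mulrC. Qed.

Lemma ip_lin a u v w : L2 omega u -> L2 omega v -> L2 omega w ->
  ip omega (fun x => a * u x + v x) w = a * ip omega u w + ip omega v w.
Proof.
move=> Lu Lv Lw.
rewrite /ip -RintegralZl//; last exact: L2_integrable.
rewrite -RintegralD//; last 2 first.
- by apply: (integrableZl mo a (L2_integrable _ _)).
- exact: L2_integrable.
by apply: eq_Rintegral => x _; ring.
Qed.

Lemma ip_ge0 u : 0 <= ip omega u u.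
Proof. by apply: Rintegral_ge0 => x _; rewrite -expr2 sqr_ge0. Qed.

Lemma ip_ae u v u' v' : ae_eq leb omega u u' -> ae_eq leb omega v v' ->
  ip omega u v = ip omega u' v'.
Proof.
move=> uu vv; apply: ae_eq_Rintegral => //.
by apply: filterS2 uu vv => x hu hv ox; rewrite hu// hv.
Qed.

Lemma ip0l v : ip omega (fun=> 0) v = 0.
Proof.
rewrite /ip; under eq_Rintegral do rewrite mul0r.
by rewrite Rintegral_cst// mul0r.
Qed.

Lemma nrm_ge0 u : 0 <= nrm omega u. Proof. exact: sqrtr_ge0. Qed.

Lemma nrm_sqr u : nrm omega u ^+ 2 = ip omega u u.
Proof. by rewrite sqr_sqrtr// ip_ge0. Qed.

Lemma ip_le_nrm u v : L2 omega u -> L2 omega v ->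
  `|ip omega u v| <= nrm omega u * nrm omega v.
Proof.
apply: (@cauchy_schwarz R _ (fun a u v x => a * u x + v x) (L2 omega) (ip omega)).
- exact: L2_lin.
- by move=> *; exact: ip_sym.
- exact: ip_lin.
- by move=> *; exact: ip_ge0.
Qed.

Lemma nrm_ae u v : ae_eq leb omega u v -> nrm omega u = nrm omega v.
Proof. by move=> uv; rewrite /nrm (ip_ae uv uv). Qed.

Lemma nrm_eq0 u : L2 omega u -> nrm omega u = 0 -> ae_eq leb omega u (fun=> 0).
Proof.
move=> Lu /eqP; rewrite -(@eqrXn2 _ 2) ?nrm_ge0// nrm_sqr expr0n/= => /eqP.
move=> /(Rintegral_eq0 mo); move/(_ (L2_integrable Lu Lu)).
have h x : omega x -> 0 <= u x * u x by rewrite -expr2 sqr_ge0.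
move=> /(_ h); apply: filterS => x /[apply]/eqP.
by rewrite mulf_eq0 orbb => /eqP.
Qed.

Lemma nrmB_ae u v : L2 omega u -> L2 omega v ->
  nrm omega (fun x => u x - v x) = 0 -> ae_eq leb omega u v.
Proof.
move=> Lu Lv /(nrm_eq0 (L2_sub Lu Lv)); apply: filterS => x /[apply]/eqP.
by rewrite subr_eq0 => /eqP.
Qed.

End L2_scalar.

(** The increments are bounded by a multiple of 2^-k, so the telescoping series converges
    absolutely. *)
Lemma cvg_of_geometric_increments (R : realType) (v : nat -> R) (B : R) :
  (forall k, 4 ^+ k * (v k.+1 - v k) ^+ 2 <= B) -> cvgn v.
Proof.
move=> vB; have B0 : 0 <= B by apply: le_trans (vB 0%N); rewrite expr0 mul1r sqr_ge0.
(* B + 1 stands in for the square root of B, since B <= (B + 1)^2. *)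
have step k : `|v k.+1 - v k| <= (B + 1) * 2^-1 ^+ k.
  rewrite -ler_sqr ?nnegrE ?mulr_ge0 ?exprn_ge0 ?invr_ge0 ?addr_ge0//.
  rewrite real_normK ?num_real// exprMn exprAC -(ler_pM2l (_ : 0 < 4 ^+ k)) ?exprn_gt0//.
  apply: (le_trans (vB k)).
  rewrite mulrCA -exprMn (_ : 4 * _ = 1) ?expr1n ?mulr1; last by field.
  by nra.
have -> : v = fun n => v 0%N + series (telescope v) n.
  by apply/funext => n; exact: eq_sum_telescope.
apply: is_cvgD; first exact: is_cvg_cst.
apply: normed_cvg; apply: (@series_le_cvg _ _ (geometric (B + 1) 2^-1)).
- by move=> n; exact: normr_ge0.
- by move=> n; rewrite /geometric /= mulr_ge0 ?exprn_ge0 ?invr_ge0 ?addr_ge0.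
- exact: step.
- by apply: is_cvg_geometric_series; rewrite ger0_norm ?invr_ge0// invf_lt1// ltr1n.
Qed.

(** * Completeness of L2 (Riesz-Fischer) *)

Section L2_completeness.
Context (R : realType) (d : nat) (omega : set 'rV[R]_d).
Hypothesis mo : measurable omega.
Local Notation leb := (lebesgue_rV R d).
Implicit Types u v w : 'rV[R]_d -> R.

Lemma integral_sqr u : L2 omega u ->
  (\int[leb]_(x in omega) (u x ^+ 2)%:E)%E = (nrm omega u ^+ 2)%:E.
Proof.
move=> Lu; rewrite nrm_sqr /ip /Rintegral fineK; last first.
  by apply: integrable_fin_num => //; exact: L2_integrable.
by apply: eq_integral => x _; rewrite expr2.
Qed.

(** The weighted sum G of 4^k (v_(k+1) - v_k)^2 has integral at most the sum of 4^k 16^-k, hence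
    less than 2. So G is finite a.e., and wherever it is finite the increments decay
    geometrically. *)
Lemma L2_fast_cauchy_ae_cvg (v : nat -> 'rV[R]_d -> R) :
  (forall k, L2 omega (v k)) ->
  (forall k, nrm omega (fun x => v k.+1 x - v k x) <= 4^-1 ^+ k) ->
  exists2 f : 'rV[R]_d -> R, measurable_fun omega f &
    {ae leb, forall x, omega x -> v^~ x @ \oo --> f x}.
Proof.
move=> Lv v_fast.
pose F k x : \bar R := (4 ^+ k * (v k.+1 x - v k x) ^+ 2)%:E.
have LD k : L2 omega (fun x => v k.+1 x - v k x) by exact: L2_sub.
have F0 k x : omega x -> (0 <= F k x)%E.
  by move=> _; rewrite /F lee_fin mulr_ge0 ?sqr_ge0 ?exprn_ge0.
have mF k : measurable_fun omega (F k).
  apply/measurable_EFinP; apply: measurable_funM => //.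
  by apply: measurable_funX; case: (LD k).
pose G x : \bar R := (\sum_(k <oo) F k x)%E.
have mG : measurable_fun omega G by apply: ge0_emeasurable_sum => // k x ox _; exact: F0.
have G0 x : omega x -> (0 <= G x)%E by move=> ox; apply: nneseries_ge0 => k _ _; exact: F0.
have IG : (\int[leb]_(x in omega) G x <= 2%:E)%E.
  rewrite integral_nneseries//; apply: lime_le.
    by apply: is_cvg_nneseries => k _ _; apply: integral_ge0 => x ox; exact: F0.
  apply: nearW => n.
  apply: (@le_trans _ _ (\sum_(0 <= k < n) (4^-1 ^+ k)%:E)%E).
    apply: lee_sum => k _; under eq_integral do rewrite /F EFinM.
    rewrite ge0_integralZl_EFin ?exprn_ge0//; last 2 first.
    - by move=> x ox; rewrite lee_fin sqr_ge0.
    - by apply/measurable_EFinP/measurable_funX; case: (LD k).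
    rewrite integral_sqr// -EFinM lee_fin.
    apply: (@le_trans _ _ (4 ^+ k * (4^-1 ^+ k) ^+ 2)).
      by rewrite ler_pM2l ?exprn_gt0// ler_sqr ?nnegrE ?nrm_ge0 ?exprn_ge0 ?invr_ge0.
    by rewrite expr2 mulrA -exprMn divff// expr1n mul1r.
  rewrite sumEFin lee_fin.
  have : (\sum_(0 <= k < n) 4^-1 ^+ k) * (1 - 4^-1) = 1 - 4^-1 ^+ n :> R.
    elim: n => [|n IH]; first by rewrite big_geq// expr0 mul0r subrr.
    by rewrite big_nat_recr//= mulrDl IH exprS; field.
  have : 0 <= 4^-1 ^+ n :> R by rewrite exprn_ge0// invr_ge0.
  by move: (4^-1 ^+ n) (\sum_(0 <= _ < _) _) => a s; lra.
have iG : leb.-integrable omega G.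
  apply/integrableP; split => //.
  rewrite (@eq_integral _ _ _ _ _ G); last by move=> x /set_mem ox; rewrite gee0_abs ?G0.
  by apply: le_lt_trans IG _; rewrite ltry.
pose E := omega `&` [set x | (G x < +oo)%E].
have mE : measurable E by exact: emeasurable_fun_infty_o.
have cvgE x : E x -> cvgn (v ^~ x).
  move=> [ox Gx]; apply: (@cvg_of_geometric_increments _ _ (fine (G x))) => k.
  rewrite -lee_fin fineK ?ge0_fin_numE ?G0//.
  apply: (le_trans _ (nneseries_lim_ge k.+1 _)) => /=; last first.
    by move=> n _ _; exact: F0.
  by rewrite big_nat_recr//= leeDr// sume_ge0// => i _; exact: F0.
(* The value 0 off the measurable set E makes the limit a pointwise limit of measurable functions
   everywhere on omega. *)
exists (fun x => if x \in E then limn (v ^~ x) else 0).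
  apply: (@measurable_fun_cvg _ _ _ _ (fun k => v k \_ E)).
    move=> k; apply/measurable_restrict => //.
    by apply: measurable_funS (proj1 (Lv k)) => //; exact: subIsetl.
  move=> x ox; rewrite /patch; case: ifPn => xE; last exact: cvg_cst.
  exact/cvgE/set_mem.
have := integrable_ae mo iG; apply: filterS => x /[swap] ox /(_ ox).
rewrite ge0_fin_numE ?G0// => Gx; rewrite mem_set; last by split.
exact: cvgE.
Qed.

(** A rapidly Cauchy subsequence has an a.e. limit f. For fixed n, Fatou's lemma along that
    subsequence turns the Cauchy bound on u_n - u_phi(k) into the same bound on u_n - f, which gives
    both f in L2 and convergence of the whole sequence. *)
Lemma L2_complete :
  complete_for (fun u v => nrm omega (fun x => u x - v x)) (L2 omega).
Proof.
move=> u Lu cu.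
have /choice[M HM] : forall k, exists N, forall n m, (N <= n)%N -> (N <= m)%N ->
    nrm omega (fun x => u n x - u m x) < 4^-1 ^+ k.
  by move=> k; apply: cu; rewrite exprn_gt0// invr_gt0.
(* The running maximum puts both phi(k) and phi(k+1) beyond M k; the summand k forces phi(k) >= k,
   so the subsequence passes every index. *)
pose phi k := (k + \max_(i < k.+1) M i)%N.
have phiM k : (M k <= phi k)%N.
  by apply: leq_trans (leq_addl _ _); exact: (leq_bigmax (Ordinal (ltnSn k))).
have phiS k : (M k <= phi k.+1)%N.
  apply: leq_trans (leq_addl _ _).
  exact: (leq_bigmax (Ordinal (ltnW (ltnSn k.+1)))).
have [f mf uf] : exists2 f : 'rV[R]_d -> R, measurable_fun omega f &
    {ae leb, forall x, omega x -> u (phi k) x @[k --> \oo] --> f x}.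
  apply: (L2_fast_cauchy_ae_cvg (v := fun k => u (phi k))) => // k.
  by rewrite ltW// HM.
have fatou_bound n e : 0 < e ->
    (exists K, forall k, (K <= k)%N -> nrm omega (fun x => u n x - u (phi k) x) < e) ->
    L2 omega (fun x => u n x - f x) /\ nrm omega (fun x => u n x - f x) <= e.
  move=> e0 [K HK].
  pose g k x : \bar R := ((u n x - u (phi (k + K)%N) x) ^+ 2)%:E.
  have mun : measurable_fun omega (u n) by case: (Lu n).
  have mg k : measurable_fun omega (g k).
    apply/measurable_EFinP/measurable_funX/measurable_funB => //.
    by case: (Lu (phi (k + K)%N)).
  have g0 k x : omega x -> (0 <= g k x)%E by move=> _; rewrite /g lee_fin sqr_ge0.
  have md : measurable_fun omega (fun x => u n x - f x) by exact: measurable_funB.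
  have : (\int[leb]_(x in omega) ((u n x - f x) ^+ 2)%:E <= (e ^+ 2)%:E)%E.
    (* The integrand agrees a.e. with the lower limit of the g k; the shift by K in their definition
       makes the bound e available for every index. *)
    rewrite (@ae_eq_integral_nonmeasurable _ _ _ leb omega _
               (fun x => limn_einf (g ^~ x))); last first.
      apply: filterS uf => x ux ox; apply/esym.
      apply: (cvg_limn_einf_sup _).1; apply: cvg_EFin; first exact: nearW.
      apply: (cvg_comp _ (fun y : R => y ^+ 2)); last first.
        exact: (@exprn_continuous _ 2).
      apply: cvgB; first exact: cvg_cst.
      by rewrite (cvg_shiftn K (fun k => u (phi k) x)); exact: ux.
    apply: (le_trans (fatou leb mo mg g0)).
    rewrite limn_einf_lim; apply: lime_le; first exact: is_cvg_einfs.
    apply: nearW => k; apply: ereal_inf_le; exists (\int[leb]_(x in omega) g k x)%E.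
      by exists k => /=.
    rewrite integral_sqr; last exact: L2_sub.
    by rewrite lee_fin ler_sqr ?nnegrE ?nrm_ge0 ?(ltW e0)// ltW// HK// leq_addl.
  move=> I.
  have L : L2 omega (fun x => u n x - f x).
    split=> //; apply/integrableP; split.
      by apply/measurable_EFinP/measurable_funX.
    under eq_integral do rewrite gee0_abs ?lee_fin ?sqr_ge0//.
    by apply: (le_lt_trans I); rewrite ltry.
  split=> //; move: I; rewrite integral_sqr// lee_fin ler_sqr// nnegrE ?nrm_ge0//.
  exact: ltW.
have fb e : 0 < e -> exists N, forall n, (N <= n)%N ->
    L2 omega (fun x => u n x - f x) /\ nrm omega (fun x => u n x - f x) <= e.
  move=> e0; have [N HN] := cu _ e0; exists N => n Nn; apply: fatou_bound => //.
  by exists N => k Nk; apply: HN => //; exact: leq_trans Nk (leq_addr _ _).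
have [n0 Hn0] := fb 1 ltr01; have [L0 _] := Hn0 _ (leqnn n0).
exists f.
  by have := L2_sub mo (Lu n0) L0; congr (L2 _ _); apply/funext => x; ring.
move=> e e0; have [N HN] := fb _ (divr_gt0 e0 (ltr0n R 2)).
by exists N => n /HN[_ h]; apply: (le_lt_trans h); lra.
Qed.

End L2_completeness.

(** * Lebesgue measure on R^n *)

Section boxes.
Context (R : realType) (n : nat).
Implicit Types (a b x : 'rV[R]_n).

Definition obox a b : set 'rV[R]_n :=
  [set x | forall i, a ord0 i < x ord0 i < b ord0 i].

Definition cbox a b : set 'rV[R]_n :=
  [set x | forall i, a ord0 i <= x ord0 i <= b ord0 i].

Lemma obox_sub_cbox a b : obox a b `<=` cbox a b.
Proof. by move=> x h i; have /andP[/ltW-> /ltW->] := h i. Qed.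

Lemma measurable_obox a b : measurable (obox a b).
Proof.
rewrite (_ : obox a b = \bigcap_(i in setT)
  (@rV_coord R n i @^-1` `]a ord0 i, b ord0 i[%classic)).
  apply: fin_bigcap_measurable => // i _; rewrite -[X in measurable X]setTI.
  exact: measurable_rV_coord.
apply/seteqP; split => x /= h i; first by move=> _ /=; rewrite in_itv/=.
by have := h i I; rewrite /= in_itv/=.
Qed.

Lemma measurable_cbox a b : measurable (cbox a b).
Proof.
rewrite (_ : cbox a b = \bigcap_(i in setT)
  (@rV_coord R n i @^-1` `[a ord0 i, b ord0 i]%classic)).
  apply: fin_bigcap_measurable => // i _; rewrite -[X in measurable X]setTI.
  exact: measurable_rV_coord.
apply/seteqP; split => x /= h i; first by move=> _ /=; rewrite in_itv/=.
by have := h i I; rewrite /= in_itv/=.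
Qed.

Lemma compact_cbox a b : compact (cbox a b).
Proof.
have := @rV_compact _ n (fun i => `[a ord0 i, b ord0 i]%classic)
  (fun i => @segment_compact _ _ _).
by congr compact; apply/seteqP; split => x /= h i; have := h i; rewrite in_itv.
Qed.

Lemma oboxI a b a' b' : obox a b `&` obox a' b' =
  obox (\row_i Num.max (a ord0 i) (a' ord0 i)) (\row_i Num.min (b ord0 i) (b' ord0 i)).
Proof.
apply/seteqP; split=> [x [h h'] i|x h]; last split => i; have := h i; rewrite !mxE.
- by have /andP[??] := h' i => /andP[??]; rewrite gt_max lt_min; apply/andP; split; apply/andP.
- by rewrite gt_max lt_min => /andP[/andP[-> _] /andP[-> _]].
- by rewrite gt_max lt_min => /andP[/andP[_ ->] /andP[_ ->]].
Qed.

(** Rational corners make the union countable. Requiring the closed box inside O keeps bumps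
    supported in it among the test functions on O. *)
Lemma open_bigcup_obox (O : set 'rV[R]_n) : open O ->
  O = \bigcup_(q in [set q : 'rV[rat]_n * 'rV[rat]_n |
      cbox (map_mx ratr q.1) (map_mx ratr q.2) `<=` O])
    obox (map_mx ratr q.1) (map_mx ratr q.2).
Proof.
move=> oO; apply/seteqP; split => [x Ox|x [q /= qO /obox_sub_cbox/qO]]; last by [].
have /nbhs_ballP[e /= e0 xeO] : nbhs x O by exact: open_nbhs_nbhs.
have /choice[p Hp] i : exists p : rat, x ord0 i - e < ratr p < x ord0 i.
  by have [|p] := @rat_in_itvoo R (x ord0 i - e) (x ord0 i); [rewrite gtrBl|exists p].
have /choice[q Hq] i : exists q : rat, x ord0 i < ratr q < x ord0 i + e.
  by have [|q] := @rat_in_itvoo R (x ord0 i) (x ord0 i + e); [rewrite ltrDl|exists q].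
exists (\row_i p i, \row_i q i) => /=; last first.
  by move=> i; rewrite !mxE; have /andP[_ ->] := Hp i; have /andP[-> _] := Hq i.
move=> y hy; apply: xeO; split => // i j; rewrite !ord1.
have := hy j; rewrite !mxE /ball/= => /andP[h1 h2].
have /andP[h3 _] := Hp j; have /andP[_ h4] := Hq j.
by rewrite ltr_norml; apply/andP; split; lra.
Qed.

Lemma open_measurable_rV (O : set 'rV[R]_n) : open O -> measurable O.
Proof.
move=> oO; rewrite (open_bigcup_obox oO) bigcup_mkcond.
apply: countable_bigcupT_measurable => // q.
by case: ifP => // _; exact: measurable_obox.
Qed.

Lemma closed_measurable_rV (O : set 'rV[R]_n) : closed O -> measurable O.
Proof.
by move=> /closed_openC/open_measurable_rV/measurableC; rewrite setCK.
Qed.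

Lemma continuous_measurable_rV (f : 'rV[R]_n -> R) : continuous f ->
  measurable_fun setT f.
Proof.
move=> cf; apply: (measurability _ (RGenOInfty.measurableE R)) => _ [_ [a ->] <-].
rewrite setTI; apply: open_measurable_rV.
by move/continuousP : cf; apply; rewrite set_itvoy; exact: open_gt.
Qed.

(** Open boxes are closed under intersection, so generating the sigma-algebra by them permits a
    Dynkin argument. The half space x_i > c is exhausted by boxes whose lower corner is c in
    coordinate i and -k elsewhere. *)
Lemma measurable_rV_obox : @measurable _ 'rV[R]_n = <<s range (uncurry obox) >>.
Proof.
apply/seteqP; split; last first.
  by apply: smallest_sub; [exact: sigma_algebra_measurable|
    move=> _ [[a b] _ <-]; exact: measurable_obox].
apply: smallest_sub; first exact: smallest_sigma_algebra.
move=> B; rewrite -bigcup_seq => -[i _ [Y mY <-]].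
suff : measurable_fun (setT : set (g_sigma_algebraType (range (uncurry obox))))
  (@rV_coord R n i) by move=> /(_ measurableT _ mY).
apply: (measurability _ (RGenOInfty.measurableE R)) => _ [_ [c ->] <-].
pose lo k : 'rV[R]_n := \row_j (if j == i then c else - k%:R).
have -> : setT `&` @rV_coord R n i @^-1` `]c, +oo[%classic =
    \bigcup_k obox (lo k) (const_mx k%:R).
  rewrite setTI; apply/seteqP; split => [x|x [k _ /(_ i)]]; rewrite /= in_itv/= andbT; last first.
    by rewrite !mxE eqxx => /andP[].
  move=> xi; exists (Num.trunc `|x|).+1 => // j; rewrite !mxE.
  have : `|x ord0 j| < (Num.trunc `|x|).+1%:R.
    apply: le_lt_trans (truncnS_gt _).
    by rewrite [leRHS]mx_normrE; apply: (le_bigmax _ (fun i => `|x i.1 i.2|) (ord0, j)).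
  by rewrite ltr_norml => /andP[? ->]; rewrite andbT; case: eqP => [->|].
apply: bigcupT_measurable => k; apply: sub_sigma_algebra.
by exists (lo k, const_mx k%:R).
Qed.

End boxes.

Section lebesgue_rV_facts.
Context (R : realType).
Notation leb := (lebesgue_rV R).
Notation leb1 := (@lebesgue_measure R).

Lemma rV_cons0 n (t : R) (y : 'rV[R]_n) : rV_cons (t, y) ord0 ord0 = t.
Proof. by rewrite mxE unlift_none. Qed.

Lemma rV_consS n (t : R) (y : 'rV[R]_n) j : rV_cons (t, y) ord0 (lift ord0 j) = y ord0 j.
Proof. by rewrite mxE liftK. Qed.

Lemma lebesgue_rVS n A :
  leb n.+1 A = (leb1 \x leb n)%E (@rV_cons R n @^-1` A).
Proof. by []. Qed.

Lemma measurable_preimage_rV_cons n A : measurable A ->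
  measurable (@rV_cons R n @^-1` A).
Proof. by move=> mA; rewrite -[X in measurable X]setTI; exact: measurable_rV_cons. Qed.

Lemma lebesgue_rV_cbox_lty n (a b : 'rV[R]_n) : (leb n (cbox a b) < +oo)%E.
Proof.
elim: n => [|n IH] in a b *.
  by rewrite /= diracE; case: (_ \in _); rewrite ltry.
pose tl (c : 'rV[R]_n.+1) : 'rV[R]_n := \row_j c ord0 (lift ord0 j).
rewrite lebesgue_rVS.
have -> : @rV_cons R n @^-1` cbox a b =
    (`[a ord0 ord0, b ord0 ord0]%classic : set (measurableTypeR R)) `*`
    cbox (tl a) (tl b).
  apply/seteqP; split => -[t y] /=.
    move=> h; split => /=; first by have := h ord0; rewrite rV_cons0 in_itv.
    by move=> j; have := h (lift ord0 j); rewrite rV_consS !mxE.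
  move=> [/=]; rewrite in_itv/= => ht hy i.
  by case: (unliftP ord0 i) => [j ->|->];
    [have := hy j; rewrite rV_consS !mxE|rewrite rV_cons0].
rewrite product_measure1E//; last exact: measurable_cbox.
apply: lte_mul_pinfty; [exact: measure_ge0| |exact: IH].
by rewrite ge0_fin_numE//= lebesgue_measure_itv/=; case: ifP; rewrite -?EFinB ltry.
Qed.

Lemma compact_sub_cbox n (K : set 'rV[R]_n) : compact K ->
  exists a b, K `<=` cbox a b.
Proof.
move=> /compact_bounded[M [_ HM]].
exists (const_mx (- (M + 1))), (const_mx (M + 1)) => x Kx i.
rewrite !mxE -ler_norml; apply: le_trans (HM (M + 1) _ x Kx); last by rewrite ltrDl.
by rewrite [leRHS]mx_normrE; apply: (le_bigmax _ (fun i => `|x i.1 i.2|) (ord0, i)).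
Qed.

Lemma compact_lebesgue_lty n (K : set 'rV[R]_n) : compact K ->
  (leb n K < +oo)%E.
Proof.
move=> cK; have [a [b Kab]] := compact_sub_cbox cK.
apply: le_lt_trans (lebesgue_rV_cbox_lty a b).
apply: le_measure => //; rewrite inE; last exact: measurable_cbox.
by apply: closed_measurable_rV; apply: compact_closed cK.
Qed.

Lemma continuous_compact_support_integrable n (f : 'rV[R]_n -> R) (K : set 'rV[R]_n) :
  continuous f -> compact K -> (forall x, ~ K x -> f x = 0) ->
  (leb n).-integrable setT (EFin \o f).
Proof.
move=> cf cK fK.
have mK : measurable K by apply: closed_measurable_rV; apply: compact_closed cK.
have mf := continuous_measurable_rV cf.
have -> : EFin \o f = (EFin \o f) \_ K.
  apply/funext => x; rewrite /patch; case: ifPn => // /negP xK /=.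
  by rewrite fK// => Kx; apply: xK; rewrite inE.
apply/(integrable_mkcond _ mK).
apply: measurable_bounded_integrable => //; first exact: compact_lebesgue_lty.
  exact: measurable_funTS.
have : compact (f @` K) by apply: continuous_compact => //; exact: continuous_subspaceT.
by move=> /compact_bounded[M [Mr HM]]; exists M; split=> // r Mr' x Kx; apply: HM => //; exists x.
Qed.

(** * Fubini for the splitting of R^(n+1) into R and R^n *)

Section fubini.
Context n (f : 'rV[R]_n.+1 -> \bar R).
Hypothesis fi : (leb n.+1).-integrable setT f.

Let mf : measurable_fun setT f. Proof. exact: measurable_int fi. Qed.

Let mfc : measurable_fun setT (f \o @rV_cons R n).
Proof. by apply: measurableT_comp mf _; exact: measurable_rV_cons. Qed.

Let fci : (leb1 \x leb n)%E.-integrable setT (f \o @rV_cons R n).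
Proof.
apply/integrableP; split => //.
have /integrableP[_] := fi.
rewrite (ge0_integral_pushforward (@measurable_rV_cons R n) (leb1 \x leb n)%E)//.
by apply: measurableT_comp.
Qed.

Let integral_cons :
  (\int[leb n.+1]_x f x = \int[(leb1 \x leb n)%E]_z f (rV_cons z))%E.
Proof.
exact: (integral_pushforward (@measurable_rV_cons R n) mf fci measurableT).
Qed.

Lemma integral_rVS :
  (\int[leb n.+1]_x f x = \int[leb1]_t \int[leb n]_y f (rV_cons (t, y)))%E.
Proof. by rewrite integral_cons -(integral12_prod_meas1 fci). Qed.

Lemma integral_rVS_sym :
  (\int[leb n.+1]_x f x = \int[leb n]_y \int[leb1]_t f (rV_cons (t, y)))%E.
Proof. by rewrite integral_cons -(integral21_prod_meas1 fci). Qed.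

End fubini.

Lemma mxdot_cons n (h : 'rV[R]_n.+1) t (y : 'rV[R]_n) :
  mxdot h (rV_cons (t, y)) =
  h ord0 ord0 * t + mxdot (\row_j h ord0 (lift ord0 j)) y.
Proof.
rewrite /mxdot !big_ord1 big_ord_recl rV_cons0; congr (_ + _).
by apply: eq_bigr => j _; rewrite rV_consS mxE.
Qed.

Lemma measurable_mxdot n (h : 'rV[R]_n) : measurable_fun setT (mxdot h).
Proof.
rewrite /mxdot; under eq_fun do rewrite big_ord1.
apply: measurable_sum => j; apply: measurable_funM => //.
exact: measurable_rV_coord.
Qed.

Lemma measurable_hyperplane n (h : 'rV[R]_n) (c : R) :
  measurable [set x | mxdot h x = c].
Proof.
have := @measurable_mxdot n h measurableT [set c] (measurable_set1 c).
by rewrite setTI.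
Qed.

(** If the first entry of the normal vanishes, every slice at fixed first coordinate is a hyperplane
    of R^n, null by induction. Otherwise every line in the first direction meets the hyperplane in a
    single point, and the order of integration is swapped. *)
Lemma lebesgue_hyperplane n (h : 'rV[R]_n) (c : R) : h != 0 ->
  leb n [set x | mxdot h x = c] = 0.
Proof.
elim: n => [|n IH] in h c *; first by rewrite thinmx0 eqxx.
move=> h0; set H := [set x | _].
have mH : measurable H by exact: measurable_hyperplane.
pose h' := \row_j h ord0 (lift ord0 j).
have hE t y : H (rV_cons (t, y)) = (h ord0 ord0 * t + mxdot h' y = c).
  by rewrite /H /= mxdot_cons.
rewrite lebesgue_rVS; set P := _ @^-1` _.
have mP : measurable P by exact: measurable_preimage_rV_cons.
have [h00|h00] := eqVneq (h ord0 ord0) 0.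
  have h'0 : h' != 0.
    apply: contra h0 => /eqP h'0; apply/eqP/rowP => i; rewrite mxE.
    case: (unliftP ord0 i) => [j ->|->//].
    by move/rowP : h'0 => /(_ j); rewrite !mxE.
  rewrite /product_measure1 (@eq_integral _ _ _ _ _ (cst 0%E)) ?integral0// => t _ /=.
  rewrite -[RHS](IH h' c h'0); congr (leb n _); apply/seteqP; split => y.
    by rewrite /xsection /= inE /P /= hE h00 mul0r add0r.
  by rewrite /xsection /= inE /P /= hE h00 mul0r add0r.
transitivity (\int[(leb1 \x leb n)%E]_z (\1_P z)%:E)%E.
  by rewrite integral_indic// setIT.
rewrite (@fubini_tonelli2 _ _ _ _ _ _ _ (EFin \o \1_P)) /=; last 2 first.
- by apply/measurable_EFinP; exact: measurable_indic.
- by move=> z; rewrite lee_fin.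
rewrite (@eq_integral _ _ _ _ _ (cst 0%E)) ?integral0// => y _ /=.
rewrite /fubini_G /= -(lebesgue_measure_set1 ((c - mxdot h' y) / h ord0 ord0)).
rewrite -[X in _ = leb1 X]setIT -integral_indic//.
apply: eq_integral => t _; congr (_%:E); rewrite !indicE; congr (nat_of_bool _)%:R.
apply/idP/idP; rewrite !inE /P /= hE.
  by move=> <-; rewrite addrK mulrC mulKf.
by move=> ->; rewrite mulrC divfK// subrK.
Qed.

End lebesgue_rV_facts.

(** * Partial derivatives and test functions *)

Section directional_derivatives.
Context (R : realType).

(** When p is affine and carries the direction v to w, the two difference quotients are the same
    function of s. This serves lines, slices and coordinate functions alike. *)
Lemma derive_affine (V W E : normedModType R) (f : W -> E) (p : V -> W) x v w :
  (forall s, p (s *: v + x) = s *: w + p x) ->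
  (derivable (f \o p) x v <-> derivable f (p x) w) /\
  'D_v (f \o p) x = 'D_w f (p x).
Proof.
move=> pE; rewrite /derivable /derive.
set F := (X in X @ _); set G := (X in _ <-> cvg (X @ _)).
by have -> : F = G by apply/funext => s; rewrite /F /G /= pE.
Qed.

Lemma derive1_affine (W : normedModType R) (f : W -> R) x w t :
  derivable f (x + t *: w) w ->
  is_derive t 1 (fun s : R => f (x + s *: w)) ('D_w f (x + t *: w)).
Proof.
move=> df; have [|d1 d2] := @derive_affine R W R f (fun s : R => x + s *: w) t 1 w.
  by move=> s; rewrite [s *: _]mulr1 scalerDl addrCA.
by split; [apply/d1|].
Qed.

Lemma derive_outside_support (V : normedModType R) (f : V -> R) (K : set V) v :
  closed K -> (forall x, ~ K x -> f x = 0) -> forall x, ~ K x -> 'D_v f x = 0.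
Proof.
move=> cK fK x Kx; rewrite (@near_eq_derive _ _ _ f (cst 0)); first exact: derive_cst.
have : nbhs x (~` K) by apply: open_nbhs_nbhs; split => //; exact: closed_openC.
by apply: filterS => y /fK.
Qed.

Lemma integral_derive_eq0 (f g : R -> R) (a b : R) :
  (forall x : R, is_derive x 1 f (g x)) -> continuous g ->
  (forall x, ~~ (a <= x <= b) -> f x = 0) ->
  (\int[lebesgue_measure]_x (g x)%:E = 0)%E.
Proof.
move=> df cg f0.
(* The margin 1 makes f vanish at both ends, and the maximum keeps l < m even if b < a. *)
pose m := Num.max a b + 1; pose l := a - 1.
have am : a <= Num.max a b by rewrite le_max lexx.
have bm : b <= Num.max a b by rewrite le_max lexx orbT.
have lm : l < m by rewrite /l /m; lra.
have cf : continuous f.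
  by move=> x; apply: differentiable_continuous; apply/derivable1_diffP; case: (df x).
have fl : f l = 0 by apply: f0; rewrite /l; apply/negP; lra.
have fm : f m = 0 by apply: f0; rewrite /m; apply/negP; lra.
have <- : (\int[lebesgue_measure]_(x in `[l, m]) (g x)%:E = 0)%E.
  rewrite (@continuous_FTC2 _ g f) ?fl ?fm ?sube0//.
  - exact: continuous_subspaceT.
  - split => [x _||]; [by case: (df x)|apply: cvg_at_right_filter; exact: cf|].
    by apply: cvg_at_left_filter; exact: cf.
  - by move=> x _; rewrite derive1E; case: (df x).
rewrite [RHS]integral_mkcond; apply: eq_integral => x _.
rewrite /patch; case: ifPn => // /negP xlm; have [_ <-] := df x; congr EFin.
apply: (@derive_outside_support _ f `[a, b]%classic) => //.
- exact: interval_closed.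
- by move=> y /= yab; apply: f0; apply/negP => h; apply: yab; rewrite in_itv.
- by move=> /=; rewrite in_itv/= => /andP[? ?]; apply: xlm; rewrite inE /= in_itv/=;
    apply/andP; split; rewrite /l /m; lra.
Qed.

Lemma continuous_rV (V : topologicalType) n (p : V -> 'rV[R]_n) :
  (forall i, continuous (fun x => p x ord0 i)) -> continuous p.
Proof.
move=> cp x; apply/cvg_ballP => e e0.
have : \forall y \near x, forall i, ball (p x ord0 i) e (p y ord0 i).
  apply: filter_forall => i; have /cvg_ballP := cp i x; exact.
by apply: filterS => y h; split=> // i j; rewrite ord1.
Qed.

Lemma continuous_rV_cons_l n (y : 'rV[R]_n) : continuous (fun t : R => rV_cons (t, y)).
Proof.
apply: continuous_rV => i; case: (unliftP ord0 i) => [j ->|->].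
  have -> : (fun t : R => rV_cons (t, y) ord0 (lift ord0 j)) = cst (y ord0 j).
    by apply/funext => t; rewrite rV_consS.
  exact: cst_continuous.
have -> : (fun t : R => rV_cons (t, y) ord0 ord0) = id.
  by apply/funext => t; rewrite rV_cons0.
by move=> t.
Qed.

Lemma continuous_rV_cons_r n (t : R) : continuous (fun y : 'rV[R]_n => rV_cons (t, y)).
Proof.
apply: continuous_rV => i; case: (unliftP ord0 i) => [j ->|->].
  have -> : (fun y : 'rV[R]_n => rV_cons (t, y) ord0 (lift ord0 j)) = fun y => y ord0 j.
    by apply/funext => y; rewrite rV_consS.
  exact: coord_continuous.
have -> : (fun y : 'rV[R]_n => rV_cons (t, y) ord0 ord0) = cst t.
  by apply/funext => y; rewrite rV_cons0.
exact: cst_continuous.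
Qed.

Lemma shift_deltaE n (s : R) (l i : 'I_n) (x : 'rV[R]_n) :
  (s *: delta_mx ord0 l + x) ord0 i = s * (i == l)%:R + x ord0 i.
Proof. by rewrite !mxE eqxx. Qed.

Lemma rV_cons_shift0 n (y : 'rV[R]_n) s t :
  rV_cons (s *: 1 + t, y) = s *: delta_mx ord0 ord0 + rV_cons (t, y).
Proof.
apply/rowP => i; rewrite shift_deltaE; case: (unliftP ord0 i) => [j ->|->].
  by rewrite !rV_consS mulr0 add0r.
by rewrite !rV_cons0.
Qed.

Lemma rV_cons_shiftS n t s (y : 'rV[R]_n) j :
  rV_cons (t, s *: delta_mx ord0 j + y) =
  s *: delta_mx ord0 (lift ord0 j) + rV_cons (t, y).
Proof.
apply/rowP => i; rewrite shift_deltaE; case: (unliftP ord0 i) => [l ->|->].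
  by rewrite !rV_consS shift_deltaE (inj_eq lift_inj).
by rewrite !rV_cons0 mulr0 add0r.
Qed.

(* Fubini reduces to the fundamental theorem of calculus along one line. *)
Lemma integral_partial_eq0 n (i : 'I_n) (f : 'rV[R]_n -> R) (a b : 'rV[R]_n) :
  (forall x, derivable f x (delta_mx ord0 i)) -> continuous (partial i f) ->
  (forall x, ~ cbox a b x -> f x = 0) ->
  (\int[lebesgue_rV R n]_x (partial i f x)%:E = 0)%E.
Proof.
elim: n => [|n IH] in i f a b *; first by case: i.
move=> df cf f0.
have fi : (lebesgue_rV R n.+1).-integrable setT (EFin \o partial i f).
  apply: (continuous_compact_support_integrable cf (@compact_cbox _ _ a b)) => x xab.
  apply: (derive_outside_support _ _ f0 xab).
  by apply: compact_closed; [exact: norm_hausdorff|exact: compact_cbox].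
case: (unliftP ord0 i) => [j ij|i0].
- rewrite (integral_rVS fi) (@eq_integral _ _ _ _ _ (cst 0%E)) ?integral0// => t _ /=.
  pose tl (c : 'rV[R]_n.+1) : 'rV[R]_n := \row_j c ord0 (lift ord0 j).
  have E y : partial i f (rV_cons (t, y)) = partial j (fun y => f (rV_cons (t, y))) y.
    rewrite /partial ij; apply/esym.
    apply: (@derive_affine _ _ _ f (fun y => rV_cons (t, y)) y _ _ _).2 => s.
    exact: rV_cons_shiftS.
  under eq_integral do rewrite E.
  apply: (IH _ _ (tl a) (tl b)).
  + move=> y; apply/(@derive_affine _ _ _ f (fun y => rV_cons (t, y)) y _ (delta_mx ord0 i) _).1.
      by move=> s; rewrite ij rV_cons_shiftS.
    exact: df.
  + have <- : (fun y => partial i f (rV_cons (t, y))) =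
        partial j (fun y => f (rV_cons (t, y))) by exact/funext.
    by move=> y; apply: continuous_comp; [exact: continuous_rV_cons_r|exact: cf].
  + move=> y ny; apply: f0 => h; apply: ny => l.
    by have := h (lift ord0 l); rewrite rV_consS !mxE.
- rewrite (integral_rVS_sym fi) (@eq_integral _ _ _ _ _ (cst 0%E)) ?integral0// => y _ /=.
  apply: (@integral_derive_eq0 (fun t => f (rV_cons (t, y))) _ (a ord0 ord0) (b ord0 ord0)).
  + move=> t.
    have [|d1 d2] := @derive_affine _ _ _ f (fun t : R => rV_cons (t, y)) t 1 (delta_mx ord0 i).
      by move=> s; rewrite i0 rV_cons_shift0.
    by split; [apply/d1; exact: df|].
  + by move=> t; apply: continuous_comp; [exact: continuous_rV_cons_l|exact: cf].
  + move=> t nt; apply: f0 => h; move/negP : nt; apply.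
    by have := h ord0; rewrite rV_cons0.
Qed.

End directional_derivatives.

(** * Smooth functions of one variable built from exp(-1/t) *)

Section flat_functions.
Context (R : realType).
Implicit Types (p : {poly R}) (t : R).

(** The polynomial factor in 1/t makes the family stable under differentiation, so that smoothness
    needs only one derivative formula. *)
Definition flat p t : R := if 0 < t then p.[t^-1] * expR (- t^-1) else 0.

Lemma flat_le0 p t : t <= 0 -> flat p t = 0.
Proof. by rewrite /flat ltNge => ->. Qed.

Lemma flat_gt0 p t : 0 < t -> flat p t = p.[t^-1] * expR (- t^-1).
Proof. by rewrite /flat => ->. Qed.

(** Since exp(s) >= s^i / i!, each monomial satisfies s^i exp(-s) <= i!; the constant is the sum of
    |p_i| i!. *)
Lemma horner_expR_bounded p : exists C, forall s, 0 < s -> `|p.[s] * expR (- s)| <= C.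
Proof.
exists (\sum_(i < size p) `|p`_i| * i`!%:R) => s s0.
rewrite horner_coef mulr_suml; apply: le_trans (ler_norm_sum _ _ _) _.
apply: ler_sum => i _; rewrite -mulrA normrM ler_wpM2l// ger0_norm; last first.
  by rewrite mulr_ge0 ?expR_ge0// exprn_ge0// ltW.
rewrite expRN ler_pdivrMr ?expR_gt0// -ler_pdivrMl ?ltr0n ?fact_gt0// mulrC.
case: (nat_of_ord i) => [|k]; first by rewrite expr0 fact0 invr1 mulr1 -expR0 ler_expR ltW.
by apply: le_trans (expR_ge1Dxn k (ltW s0)); rewrite lerDr.
Qed.

(** Boundedness of p(s) s^2 exp(-s) at s = 1/t. The quadratic bound is what makes the derivative at
    0 exist and vanish. *)
Lemma flat_le_sqr p : exists2 C, 0 <= C & forall t, `|flat p t| <= C * t ^+ 2.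
Proof.
have [C HC] := horner_expR_bounded (p * 'X^2).
have C0 : 0 <= C by apply: le_trans (HC 1 ltr01).
exists C => // t; rewrite /flat; case: ifPn => t0; last first.
  by rewrite normr0 mulr_ge0// sqr_ge0.
have := HC t^-1; rewrite invr_gt0 => /(_ t0).
rewrite hornerM hornerXn mulrAC normrM [X in _ * X <= _]ger0_norm; last first.
  by rewrite exprn_ge0// invr_ge0 ltW.
by rewrite exprVn ler_pdivrMr ?exprn_gt0.
Qed.

(** The chain rule: differentiating p(1/t) exp(-1/t) yields (p - p')(1/t) t^-2 exp(-1/t). *)
Definition flat_deriv p : {poly R} := (p - p^`()) * 'X^2.

Lemma is_derive_flat p t : is_derive t 1 (flat p) (flat (flat_deriv p) t).
Proof.
have [t0|t0|->] := ltgtP t 0.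
- rewrite flat_le0 ?ltW//.
  apply: (@near_eq_is_derive _ _ _ (cst 0)).
  have : \forall s \near t, s < 0 by exact: lt_nbhsl.
  by apply: filterS => s s0; rewrite flat_le0 ?ltW.
- rewrite flat_gt0//.
  have E : \forall s \near t, p.[s^-1] * expR (- s^-1) = flat p s.
    have : \forall s \near t, 0 < s by exact: lt_nbhsr.
    by apply: filterS => s s0; rewrite flat_gt0.
  have tn0 : t != 0 by rewrite gt_eqF.
  have dV : is_derive t (1 : R) (fun s : R => s^-1) (- t ^- 2 *: (1 : R)).
    exact: (@is_deriveV R id t 1 1 tn0).
  have dN : is_derive t (1 : R) (fun s : R => - s^-1) (- (- t ^- 2 *: (1 : R))).
    exact: (@is_deriveN _ _ _ (fun s : R => s^-1) t 1 _ dV).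
  have d1 := @is_derive1_comp R (horner p) (fun s : R => s^-1) t _ _ (is_derive_poly p t^-1) dV.
  have d2 := @is_derive1_comp R expR (fun s : R => - s^-1) t _ _ (is_derive_expR (- t^-1)) dN.
  apply: (near_eq_is_derive E); apply: (is_derive_eq (is_deriveM d1 d2)).
  by rewrite /flat_deriv !hornerE /GRing.scale/=; field.
- rewrite flat_le0//.
  (* The Caratheodory slope at 0; as 0 has inverse 0 its value there is 0, and continuity follows
     from the bound C |z|. *)
  apply/is_derive1_caratheodory; exists (fun z => flat p z / z); split.
  + move=> z; rewrite (@flat_le0 _ 0)// !subr0.
    have [->|z0] := eqVneq z 0; last by rewrite divfK.
    by rewrite mulr0 flat_le0.
  + have [C C0 HC] := flat_le_sqr p.
    apply/cvgrPdist_lt => e e0 /=; rewrite invr0 mulr0.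
    have : \forall z \near (0 : R), `|z| < e / (C + 1).
      have : 0 < e / (C + 1) by rewrite divr_gt0// ltr_wpDl.
      by move=> h; exact: (@nbhs0_lt R R).
    apply: filterS => z hz; rewrite sub0r normrN normrM normfV.
    have [->|z0] := eqVneq z 0; first by rewrite normr0 invr0 mulr0.
    rewrite ltr_pdivrMr ?normr_gt0//; apply: le_lt_trans (HC z) _.
    rewrite -[z ^+ 2]real_normK ?num_real// expr2 mulrA ltr_pM2r ?normr_gt0//.
    move: hz; rewrite ltr_pdivlMr ?ltr_wpDl// => hz.
    by apply: le_lt_trans hz; rewrite mulrC ler_wpM2l// lerDl.
  + by rewrite invr0 mulr0.
Qed.

End flat_functions.

(** * Smooth functions of several variables and bumps *)

Section smooth_functions.
Context (R : realType) (n : nat).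
Implicit Types (f g : 'rV[R]_n -> R).
Local Notation e i := (delta_mx ord0 i : 'rV[R]_n).

(** Induction on the list of directions keeps every iterated partial derivative in P. *)
Lemma smooth_coinduction (P : set ('rV[R]_n -> R)) :
  (forall f, P f -> [/\ continuous f, (forall i x, derivable f x (e i)) &
     forall i, P (partial i f)]) ->
  forall f, P f -> smooth f.
Proof.
move=> HP f Pf s; have : P (foldr (@partial R n) f s).
  by elim: s => //= i s /HP[_ _]; exact.
by case/HP => cf df _; split.
Qed.

Lemma smooth_continuous f : smooth f -> continuous f.
Proof. by move=> /(_ [::])[]. Qed.

Lemma smooth_derivable f i x : smooth f -> derivable f x (e i).
Proof. by move=> /(_ [::])[_]; exact. Qed.

Lemma smooth_foldr f s : smooth f -> smooth (foldr (@partial R n) f s).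
Proof. by move=> sf s'; rewrite -foldr_cat; exact: sf. Qed.

Lemma smooth_partial f i : smooth f -> smooth (partial i f).
Proof. exact: (@smooth_foldr f [:: i]). Qed.

(** A derivative of a product is a sum of products, so no single closure property is stable under
    differentiation by itself; the whole algebra generated by P is. *)
Inductive algebra_closure (P : set ('rV[R]_n -> R)) : set ('rV[R]_n -> R) :=
| Closure_gen f of P f : algebra_closure P f
| Closure_cst c : algebra_closure P (fun=> c)
| Closure_add f g of algebra_closure P f & algebra_closure P g :
    algebra_closure P (fun x => f x + g x)
| Closure_mul f g of algebra_closure P f & algebra_closure P g :
    algebra_closure P (fun x => f x * g x).

Lemma partial_cst c (i : 'I_n) : partial i (fun=> c : R) = fun=> 0.
Proof. by apply/funext => x; exact: derive_cst. Qed.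

Lemma partial_add f g i : (forall x, derivable f x (e i)) -> (forall x, derivable g x (e i)) ->
  partial i (fun x => f x + g x) = fun x => partial i f x + partial i g x.
Proof. by move=> df dg; apply/funext => x; exact: deriveD. Qed.

Lemma partial_mul f g i : (forall x, derivable f x (e i)) -> (forall x, derivable g x (e i)) ->
  partial i (fun x => f x * g x) = fun x => f x * partial i g x + g x * partial i f x.
Proof. by move=> df dg; apply/funext => x; exact: deriveM. Qed.

Lemma algebra_closure_smooth (P : set ('rV[R]_n -> R)) :
  (forall f, P f -> [/\ continuous f, (forall i x, derivable f x (e i)) &
     forall i, algebra_closure P (partial i f)]) ->
  forall f, algebra_closure P f -> smooth f.
Proof.
move=> HP; apply: smooth_coinduction => f; elim => {f}.
- by move=> f /HP.
- move=> c; split=> [|i x|i]; first exact: cst_continuous.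
    exact: derivable_cst.
  by rewrite partial_cst; exact: Closure_cst.
- move=> f g Pf [cf df pf] Pg [cg dg pg]; split=> [x|i x|i].
  + exact: (cvgD (cf x) (cg x)).
  + exact: derivableD.
  + by rewrite partial_add//; exact: Closure_add.
- move=> f g Pf [cf df pf] Pg [cg dg pg]; split=> [x|i x|i].
  + exact: (cvgM (cf x) (cg x)).
  + exact: derivableM.
  + by rewrite partial_mul//; apply: Closure_add; exact: Closure_mul.
Qed.

Lemma smooth_closure f : algebra_closure (@smooth R n) f -> smooth f.
Proof.
apply: algebra_closure_smooth => g sg; split; first exact: smooth_continuous.
  by move=> i x; exact: smooth_derivable.
by move=> i; apply/Closure_gen/smooth_partial.
Qed.

Lemma smooth_cst c : smooth (fun _ : 'rV[R]_n => c).
Proof. exact/smooth_closure/Closure_cst. Qed.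

Lemma smooth_add f g : smooth f -> smooth g -> smooth (fun x => f x + g x).
Proof. by move=> sf sg; apply/smooth_closure/Closure_add; exact: Closure_gen. Qed.

Lemma smooth_mul f g : smooth f -> smooth g -> smooth (fun x => f x * g x).
Proof. by move=> sf sg; apply/smooth_closure/Closure_mul; exact: Closure_gen. Qed.

Lemma smooth_scale c f : smooth f -> smooth (fun x => c * f x).
Proof. by apply: smooth_mul; exact: smooth_cst. Qed.

Lemma smooth_opp f : smooth f -> smooth (fun x => - f x).
Proof. by move=> /(smooth_scale (-1)); under eq_fun do rewrite mulN1r. Qed.

Lemma smooth_exp f k : smooth f -> smooth (fun x => f x ^+ k).
Proof.
move=> sf; elim: k => [|k IH]; first exact: smooth_cst.
by under eq_fun do rewrite exprS; exact: smooth_mul.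
Qed.

Lemma smooth_prod (J : Type) (r : seq J) (F : J -> 'rV[R]_n -> R) :
  (forall j, smooth (F j)) -> smooth (fun x => \prod_(j <- r) F j x).
Proof.
move=> sF; elim: r => [|j r IH].
  by under eq_fun do rewrite big_nil; exact: smooth_cst.
by under eq_fun do rewrite big_cons; exact: smooth_mul.
Qed.

Definition flat_coord (p : {poly R}) (i : 'I_n) (s c : R) : 'rV[R]_n -> R :=
  fun x => flat p (s * x ord0 i + c).

Lemma is_derive_flat_affine (p : {poly R}) (s c t : R) :
  is_derive t 1 (fun t : R => flat p (s * t + c)) (flat (flat_deriv p) (s * t + c) * s).
Proof.
apply: (@is_derive1_comp R (flat p) (fun t : R => s * t + c)).
  exact: is_derive_flat.
apply: is_derive_eq; rewrite addr0 /GRing.scale/= mulr1//.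
Qed.

(** For fixed i, s and c, the partial derivatives of these functions are again of this kind up to
    the constant factor s (or 0), with p replaced by [flat_deriv p]. *)
Lemma smooth_flat_coord p i s c : smooth (flat_coord p i s c).
Proof.
pose P : set ('rV[R]_n -> R) := [set f | exists q, f = flat_coord q i s c].
apply: (@algebra_closure_smooth P); last by apply: Closure_gen; exists p.
move=> _ [q ->].
have D j x : is_derive x (e j) (flat_coord q i s c)
    (flat_coord (flat_deriv q) i s c x * (s * (i == j)%:R)).
  have [|d1 d2] := @derive_affine _ _ _ _ (fun t : R => flat q (s * t + c))
    (fun x : 'rV[R]_n => x ord0 i) x (e j) (i == j)%:R.
    by move=> r; rewrite shift_deltaE.
  have [ij|ij] := eqVneq i j; last first.
    move: d1 d2; rewrite (negbTE ij) derive0 !mulr0 => d1 d2.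
    by split=> //; apply/d1; exact: derivable0.
  subst j; move: d1 d2; rewrite eqxx mulr1 => d1 d2.
  have [h1 h2] := is_derive_flat_affine q s c (x ord0 i).
  by split; [apply/d1|rewrite -h2 -d2].
split.
- move=> x; apply: (@continuous_comp _ _ _ (fun x : 'rV[R]_n => x ord0 i)
    (fun t : R => flat q (s * t + c))); first exact: coord_continuous.
  apply: differentiable_continuous; apply/derivable1_diffP.
  by have [] := is_derive_flat_affine q s c (x ord0 i).
- by move=> j x; case: (D j x).
- move=> j; rewrite (_ : partial j _ = fun x => flat_coord (flat_deriv q) i s c x * (s * (i == j)%:R)).
    by apply: Closure_mul; [apply: Closure_gen; exists (flat_deriv q)|exact: Closure_cst].
  by apply/funext => x; case: (D j x).
Qed.

Lemma partial_outside_support f (K : set 'rV[R]_n) i : compact K ->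
  (forall x, ~ K x -> f x = 0) -> forall x, ~ K x -> partial i f x = 0.
Proof.
move=> cK fK x; apply: derive_outside_support fK _.
by apply: compact_closed cK; exact: norm_hausdorff.
Qed.

Lemma foldr_partial_outside_support f (K : set 'rV[R]_n) s : compact K ->
  (forall x, ~ K x -> f x = 0) ->
  forall x, ~ K x -> foldr (@partial R n) f s x = 0.
Proof.
by move=> cK fK; elim: s => //= i s IH; exact: partial_outside_support.
Qed.

Section test_functions.
Context (omega : set 'rV[R]_n).

Lemma test_fun_foldr f s : test_fun omega f -> test_fun omega (foldr (@partial R n) f s).
Proof.
move=> [sf [K [cK Ko fK]]]; split; first exact: smooth_foldr.
by exists K; split => //; exact: foldr_partial_outside_support.
Qed.

Lemma test_fun_lin c f g : test_fun omega f -> test_fun omega g ->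
  test_fun omega (fun x => c * f x + g x).
Proof.
move=> [sf [K [cK Ko fK]]] [sg [L [cL Lo gL]]]; split.
  by apply: smooth_add => //; exact: smooth_scale.
exists (K `|` L); split; first exact: compactU.
  by rewrite subUset.
by move=> x /not_orP[Kx Lx]; rewrite fK// gL// mulr0 addr0.
Qed.

Lemma test_fun_0 : test_fun omega (fun=> 0).
Proof.
by split; [exact: smooth_cst|exists set0; split => //; exact: compact0].
Qed.

Lemma test_fun_scale c f : test_fun omega f -> test_fun omega (fun x => c * f x).
Proof.
move=> tf; have := test_fun_lin c tf test_fun_0.
by under eq_fun do rewrite addr0.
Qed.

Lemma test_fun_sum (J : Type) (r : seq J) (F : J -> 'rV[R]_n -> R) :
  (forall j, test_fun omega (F j)) -> test_fun omega (fun x => \sum_(j <- r) F j x).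
Proof.
move=> tF; elim: r => [|j r IH].
  by under eq_fun do rewrite big_nil; exact: test_fun_0.
under eq_fun do rewrite big_cons; have := test_fun_lin 1 (tF j) IH.
by under eq_fun do rewrite mul1r.
Qed.

End test_functions.

Lemma test_fun_sub (omega omega' : set 'rV[R]_n) f : omega `<=` omega' ->
  test_fun omega f -> test_fun omega' f.
Proof.
move=> oo [sf [K [cK Ko fK]]]; split=> //; exists K; split=> //.
exact: subset_trans oo.
Qed.

(** On the open box this is the product of exp(-1/(x_i - a_i)) exp(-1/(b_i - x_i)); the factor s =
    -1 reflects the coordinate for the upper faces. *)
Definition bump_box (a b : 'rV[R]_n) : 'rV[R]_n -> R := fun x =>
  \prod_(i < n) (flat_coord 1 i 1 (- a ord0 i) x * flat_coord 1 i (-1) (b ord0 i) x).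

Lemma smooth_bump_box a b : smooth (bump_box a b).
Proof. by apply: smooth_prod => i; apply: smooth_mul; exact: smooth_flat_coord. Qed.

Lemma flat1_range (t : R) : 0 <= flat 1 t <= 1.
Proof.
rewrite /flat; case: ifPn => t0; last by rewrite lexx ler01.
by rewrite hornerC mul1r expR_ge0 -expR0 ler_expR oppr_le0 invr_ge0 ltW.
Qed.

Lemma bump_box_range a b x : 0 <= bump_box a b x <= 1.
Proof.
apply/andP; split.
  apply: prodr_ge0 => i _; apply: mulr_ge0;
    [case/andP: (flat1_range (1 * x ord0 i + - a ord0 i))
    |case/andP: (flat1_range (-1 * x ord0 i + b ord0 i))] => //.
apply: prodr_ile1 => i _; have /andP[h1 h2] := flat1_range (1 * x ord0 i + - a ord0 i).
have /andP[h3 h4] := flat1_range (-1 * x ord0 i + b ord0 i).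
by rewrite mulr_ge0//= mulr_ile1.
Qed.

Lemma bump_box_gt0 a b x : obox a b x -> 0 < bump_box a b x.
Proof.
move=> h; apply: prodr_gt0 => i _; have /andP[ax xb] := h i.
rewrite /flat_coord !flat_gt0 ?hornerC ?mul1r ?mulr_gt0 ?expR_gt0//.
- by rewrite mulN1r addrC subr_gt0.
- by rewrite subr_gt0.
Qed.

Lemma bump_box_eq0 a b x : ~ obox a b x -> bump_box a b x = 0.
Proof.
move=> /existsNP[i /negP]; rewrite negb_and -!leNgt => h.
rewrite /bump_box (bigD1 i)//= /flat_coord.
case/orP: h => h; first by rewrite flat_le0 ?mul0r// mul1r subr_le0.
by rewrite [X in _ * X * _]flat_le0 ?mulr0 ?mul0r// mulN1r addrC subr_le0.
Qed.

End smooth_functions.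

Lemma integral_support d (T : measurableType d) (R : realType)
    (mu : {measure set T -> \bar R}) (D E : set T) (f : T -> \bar R) : E `<=` D ->
  (forall x, D x -> ~ E x -> f x = 0%E) ->
  (\int[mu]_(x in D) f x = \int[mu]_(x in E) f x)%E.
Proof.
move=> ED f0; rewrite integral_mkcond [RHS]integral_mkcond.
congr integral; apply/funext => x; rewrite /patch.
have [xE|xE] := boolP (x \in E).
  by rewrite ifT// inE; apply: ED; rewrite inE in xE.
case: ifPn => // xD; apply: f0; first by rewrite inE in xD.
by rewrite notin_setE in xE.
Qed.

Lemma Rintegral_support d (T : measurableType d) (R : realType)
    (mu : {measure set T -> \bar R}) (D E : set T) (f : T -> R) : E `<=` D ->
  (forall x, D x -> ~ E x -> f x = 0) ->
  \int[mu]_(x in D) f x = \int[mu]_(x in E) f x.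
Proof.
by move=> ED f0; rewrite /Rintegral (integral_support mu ED)// => x Dx Ex; rewrite f0.
Qed.

(** * Fundamental lemma and integration by parts *)

Section fundamental_lemma.
Context (R : realType) (n : nat).
Local Notation leb := (lebesgue_rV R n).
Implicit Types (omega : set 'rV[R]_n) (u h : 'rV[R]_n -> R).

Lemma L2_subset omega E u : measurable omega -> measurable E -> E `<=` omega ->
  L2 omega u -> L2 E u.
Proof.
move=> mo mE Eo [mu ui]; split; first exact: measurable_funS mu.
exact: integrableS ui.
Qed.

Lemma L2_cst E (c : R) : measurable E -> (leb E < +oo)%E -> L2 E (fun=> c).
Proof.
move=> mE E_lty; split; first exact: measurable_cst.
apply: measurable_bounded_integrable => //.
by exists `|c ^+ 2|; split => [|M cM x _]; [exact: num_real|exact: ltW].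
Qed.

Lemma test_fun_L2 omega f : measurable omega -> test_fun omega f -> L2 omega f.
Proof.
move=> mo [sf [K [cK _ fK]]]; have cf := smooth_continuous sf.
split; first by apply: measurable_funTS; exact: continuous_measurable_rV.
apply: (@integrableS _ _ _ _ setT) => //.
apply: (@continuous_compact_support_integrable _ _ (fun x => f x ^+ 2) K) => //.
  exact: smooth_continuous (smooth_exp 2 sf).
by move=> x Kx; rewrite fK// expr0n.
Qed.

Section box.
Context omega h (a b : 'rV[R]_n).
Hypotheses (mo : measurable omega) (Lh : L2 omega h).
Hypothesis h_test : forall f, test_fun omega f -> ip omega h f = 0.
Hypothesis abo : cbox a b `<=` omega.

Let B := obox a b.
Let Bo : B `<=` omega.
Proof. by apply: subset_trans abo; exact: obox_sub_cbox. Qed.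
Let mB : measurable B. Proof. exact: measurable_obox. Qed.

Lemma integrable_obox : leb.-integrable B (EFin \o h).
Proof.
have B_lty : (leb B < +oo)%E.
  apply: le_lt_trans (lebesgue_rV_cbox_lty a b).
  apply: le_measure; rewrite ?inE//; first exact: measurable_cbox.
  exact: obox_sub_cbox.
have := L2_integrable mB (L2_subset mo mB Bo Lh) (L2_cst 1 mB B_lty).
by congr (_.-integrable _ _); apply/funext => x /=; rewrite mulr1.
Qed.

(* [1 - (1 - f)^k] increases to the indicator of the open box where [f > 0]. *)
Lemma integral_obox_eq0 : (\int[leb]_(x in B) (h x)%:E = 0)%E.
Proof.
pose f k x := 1 - (1 - bump_box a b x) ^+ k.
have f0 k x : ~ B x -> f k x = 0.
  by move=> Bx; rewrite /f bump_box_eq0// subr0 expr1n subrr.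
have sf k : smooth (f k).
  apply: smooth_add; first exact: smooth_cst.
  apply/smooth_opp/smooth_exp/smooth_add; first exact: smooth_cst.
  exact/smooth_opp/smooth_bump_box.
have tf k : test_fun omega (f k).
  split=> //; exists (cbox a b); split=> //; first exact: compact_cbox.
  by move=> x xab; apply: f0 => /obox_sub_cbox.
have f_bd k x : 0 <= f k x <= 1.
  have /andP[b0 b1] := bump_box_range a b x.
  have [c0 c1] : 0 <= 1 - bump_box a b x /\ 1 - bump_box a b x <= 1 by lra.
  have := exprn_ile1 k c0 c1; have := exprn_ge0 k c0; rewrite /f.
  by move: (_ ^+ k) => t; lra.
have If k : (\int[leb]_(x in B) (h x * f k x)%:E = 0)%E.
  have i := L2_integrable mo Lh (test_fun_L2 mo (tf k)).
  have := h_test (tf k); rewrite /ip /Rintegral => I0.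
  have : (\int[leb]_(x in omega) (h x * f k x)%:E = 0)%E.
    by rewrite -[LHS]fineK ?integrable_fin_num// I0.
  rewrite (@integral_support _ _ _ leb omega B)// => x _ Bx.
  by rewrite f0// mulr0.
have /measurable_EFinP mh := measurable_int leb integrable_obox.
have mf k : measurable_fun B (fun x => (h x * f k x)%:E).
  apply/measurable_EFinP; apply: measurable_funM => //; apply: measurable_funTS.
  apply: continuous_measurable_rV; exact: smooth_continuous.
have cvgf : {ae leb, forall x, B x -> (h x * f k x)%:E @[k --> \oo] --> (h x)%:E}.
  apply: aeW => x Bx; apply: cvg_EFin; first exact: nearW.
  rewrite -[X in _ --> X]mulr1; apply: cvgM; first exact: cvg_cst.
  rewrite -[X in _ --> X]subr0; apply: cvgB; first exact: cvg_cst.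
  apply: cvg_expr; have := bump_box_gt0 Bx; have := bump_box_range a b x.
  by rewrite ltr_norml => /andP[? ?] ?; apply/andP; split; lra.
have bdf : {ae leb, forall x k, B x -> (`|(h x * f k x)%:E| <= (`|h x|)%:E)%E}.
  apply: aeW => x k Bx /=; have /andP[c0 c1] := f_bd k x.
  by rewrite lee_fin normrM (ger0_norm c0) ler_piMr.
have mEh := measurable_int leb integrable_obox.
have [_ _ Icvg] := @dominated_convergence _ _ _ leb B mB (fun k x => (h x * f k x)%:E)
  (EFin \o h) (EFin \o (fun x => `|h x|)) mf mEh cvgf
  (integrable_norm integrable_obox) bdf.
rewrite -(cvg_lim _ Icvg)//; under eq_fun do rewrite If.
exact: lim_cst.
Qed.

End box.

(** Inside a box B with closure in omega, the sets S over which h has integral 0 on S and B form a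
    Dynkin system containing the boxes, hence all measurable sets. So h vanishes a.e. on B, and
    countably many rational boxes cover omega. *)
Lemma ae_eq0_of_test_fun omega h : open omega -> L2 omega h ->
  (forall f, test_fun omega f -> ip omega h f = 0) -> ae_eq leb omega h (fun=> 0).
Proof.
move=> oo Lh h_test.
have mo := open_measurable_rV oo.
have box a b : cbox a b `<=` omega -> ae_eq leb (obox a b) h (fun=> 0).
  move=> abo; set B := obox a b.
  have mB : measurable B by exact: measurable_obox.
  have iB := integrable_obox mo Lh abo.
  have iS S : measurable S -> leb.-integrable (S `&` B) (EFin \o h).
    by move=> mS; apply: integrableS iB => //; exact: measurableI.
  have mhS S : measurable S -> measurable_fun (S `&` B) (EFin \o h).
    by move=> /iS /measurable_int.
  have I0 S : measurable S -> (\int[leb]_(x in S `&` B) (h x)%:E = 0)%E.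
    rewrite measurable_rV_obox; move: S.
    apply: dynkin_induction => [||||S mS|F mF tF IF].
    - exact: measurable_rV_obox.
    - move=> _ _ [[a1 b1] _ <-] [[a2 b2] _ <-].
      rewrite /uncurry oboxI; set a3 := (X in obox X _); set b3 := (X in obox _ X).
      by exists (a3, b3).
    - by rewrite setTI; exact: (integral_obox_eq0 mo Lh).
    - move=> _ [[a1 b1] _ <-]; rewrite /uncurry oboxI.
      apply: (integral_obox_eq0 mo Lh) => //; apply: subset_trans abo => x hx i.
      have := hx i; rewrite !mxE ge_max le_min.
      by move=> /andP[/andP[_ ->] /andP[_ ->]].
    - move=> IS; have : (\int[leb]_(x in B) (h x)%:E = 0)%E.
        exact: (integral_obox_eq0 mo Lh).
      rewrite -{1}(setTI B) -(setUv S) setIUl integral_setU//.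
      + by rewrite IS add0e.
      + exact: measurableI.
      + by apply: measurableI => //; exact: measurableC.
      + by rewrite -setIUl setUv setTI; exact: measurable_int iB.
      + apply/disj_set2P; rewrite setIACA setICr set0I//.
    - rewrite setI_bigcupl integral_bigcup.
      + by rewrite eseries0// => k _ _; exact: IF.
      + exact: trivIset_setIr.
      + by move=> k; exact: measurableI.
      + by rewrite -setI_bigcupl; apply: iS; exact: bigcupT_measurable.
  have : ae_eq leb B (EFin \o h) (cst 0%E).
    apply: integral_ae_eq => // E EB mE.
    by rewrite integral0 -(I0 _ mE) setIidl.
  by apply: filterS => x hx Bx; case: (hx Bx).
have := open_bigcup_obox oo.
set Q := [set q | _] => omegaE.
(* Decoding k as a pair of rational corners presents the exceptional set as a countable union of
   null sets. *)
pose N k := if @unpickle ('rV[rat]_n * 'rV[rat]_n)%type k is Some q then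
  [set x | Q q /\ obox (map_mx ratr q.1) (map_mx ratr q.2) x /\ h x <> 0] else set0.
have neg : leb.-negligible (\bigcup_k N k).
  apply: negligible_bigcup => k; rewrite /N; case: unpickle => [q|]; last first.
    exact: negligible_set0.
  have [Qq|nQq] := pselect (Q q); last first.
    by apply: negligibleS (negligible_set0 _) => x [].
  by apply: negligibleS (box _ _ Qq) => x [_ [qx hx]] /(_ qx).
apply: negligibleS neg => x /= /not_implyP[ox hx].
move: ox; rewrite omegaE => -[q Qq xq]; exists (pickle q) => //.
by rewrite /N pickleK.
Qed.

End fundamental_lemma.

(** * Symmetry of mixed derivatives and integration by parts *)

Section integration_by_parts.
Context (R : realType) (n : nat).
Implicit Types (f g : 'rV[R]_n -> R) (x : 'rV[R]_n).
Local Notation e i := (delta_mx ord0 i : 'rV[R]_n).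

Lemma is_derive_line f i x (t : R) : smooth f ->
  is_derive t 1 (fun s : R => f (x + s *: e i)) (partial i f (x + t *: e i)).
Proof. by move=> sf; apply: derive1_affine; exact: smooth_derivable. Qed.

Lemma MVT_everywhere (p q : R -> R) (s : R) : 0 < s ->
  (forall t, is_derive t (1 : R) p (q t)) ->
  exists2 c, 0 < c < s & p s - p 0 = q c * s.
Proof.
move=> s0 dp; have cp : {within `[0, s], continuous p}.
  apply: continuous_subspaceT => t.
  by apply: differentiable_continuous; apply/derivable1_diffP; case: (dp t).
have [c cs E] := MVT s0 (fun t _ => dp t) cp.
by exists c; [rewrite in_itv/= in cs|rewrite E subr0].
Qed.

(** The mean value theorem twice: to the difference of f along two parallel segments in direction i,
    then to the resulting partial derivative in direction j. *)
Lemma second_difference_MVT f i j x s : smooth f -> 0 < s ->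
  exists c1 c2, [/\ 0 < c1 < s, 0 < c2 < s &
    f (x + s *: e i + s *: e j) - f (x + s *: e i) - f (x + s *: e j) + f x =
    partial j (partial i f) (x + c1 *: e i + c2 *: e j) * s * s].
Proof.
move=> sf s0.
have [|c1 c1s E1] := @MVT_everywhere
  (fun r => f (x + s *: e j + r *: e i) - f (x + r *: e i))
  (fun r => partial i f (x + s *: e j + r *: e i) - partial i f (x + r *: e i)) s s0.
  by move=> t; apply: is_deriveB; exact: is_derive_line.
have [|c2 c2s E2] := @MVT_everywhere
  (fun r => partial i f (x + c1 *: e i + r *: e j))
  (fun r => partial j (partial i f) (x + c1 *: e i + r *: e j)) s s0.
  by move=> t; apply: is_derive_line; exact: smooth_partial.
exists c1, c2; split => //; rewrite -E2 scale0r addr0.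
rewrite (addrAC x (c1 *: e i)) -E1 !scale0r !addr0 (addrAC x (s *: e i)).
by ring.
Qed.

(* Both mixed derivatives are values, at nearby points, of the same second
   difference quotient. *)
Lemma partialC f i j : smooth f -> partial i (partial j f) = partial j (partial i f).
Proof.
move=> sf; apply/funext => x; apply/eqP; rewrite -subr_eq0 -normr_le0.
apply/ler_addgt0Pl => r r0; rewrite addr0.
have ct k l : {for x, continuous (partial k (partial l f))}.
  by apply: smooth_continuous; do 2 apply: smooth_partial.
have near_x k l : exists2 s, 0 < s & forall y, `|x - y| < s ->
    `|partial k (partial l f) x - partial k (partial l f) y| < r / 2.
  have /cvgrPdist_lt/(_ (r / 2)) := ct k l; rewrite divr_gt0// => /(_ isT).
  move=> /nbhs_ballP[s /= s0 H]; exists s => // y xy; apply: H.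
  by rewrite -ball_normE.
have [s1 s10 H1] := near_x i j; have [s2 s20 H2] := near_x j i.
have ms0 : 0 < Num.min s1 s2 by rewrite lt_min s10.
(* A third of the radius leaves room for two steps shorter than s. *)
have [s s0 s3] : exists2 s, 0 < s & Num.min s1 s2 = s * 3.
  by exists (Num.min s1 s2 / 3); [rewrite divr_gt0|rewrite divfK].
have close k l (c1 c2 : R) : 0 < c1 < s -> 0 < c2 < s ->
    `|x - (x + c1 *: e k + c2 *: e l)| < Num.min s1 s2.
  move=> /andP[c10 c1s] /andP[c20 c2s].
  rewrite -addrA opprD addNKr normrN; apply: le_lt_trans (ler_normD _ _) _.
  have ne k' : `|e k'| <= 1.
    rewrite [leLHS]mx_normrE; apply: bigmax_le => // -[a b] _ /=; rewrite mxE.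
    by case: (_ && _); rewrite ?normr1 ?normr0.
  rewrite !normrZ (gtr0_norm c10) (gtr0_norm c20).
  have h1 := ler_piMr (ltW c10) (ne k); have h2 := ler_piMr (ltW c20) (ne l).
  by rewrite s3; move: h1 h2; move: (c1 * _) (c2 * _) => d1 d2; lra.
have [c1 [c2 [h1 h2 E1]]] := second_difference_MVT j i x sf s0.
have [c3 [c4 [h3 h4 E2]]] := second_difference_MVT i j x sf s0.
have E : partial i (partial j f) (x + c1 *: e j + c2 *: e i) =
    partial j (partial i f) (x + c3 *: e i + c4 *: e j).
  have sn0 := lt0r_neq0 s0; apply: (mulIf sn0 (mulIf sn0 _)).
  apply: etrans (esym E1) (etrans _ E2).
  rewrite (addrAC x (s *: e j)); congr (_ + _); exact: addrAC.
have m1 : Num.min s1 s2 <= s1 by rewrite ge_min lexx.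
have m2 : Num.min s1 s2 <= s2 by rewrite ge_min lexx orbT.
have := H1 _ (lt_le_trans (close j i _ _ h1 h2) m1).
have := H2 _ (lt_le_trans (close i j _ _ h3 h4) m2).
rewrite E; move: (partial j (partial i f) (x + _ + _)) => z.
move: (partial i (partial j f) x) (partial j (partial i f) x) => p q k2 k1.
have -> : p - q = (p - z) - (q - z) by ring.
apply: le_trans (ler_normB _ _) _; apply: ltW.
by rewrite [ltRHS](splitr r); exact: ltrD.
Qed.

Lemma foldr_partialC f i s : smooth f ->
  foldr (@partial R n) (partial i f) s = partial i (foldr (@partial R n) f s).
Proof.
move=> sf; elim: s => //= j s ->.
by rewrite (partialC _ _ (smooth_foldr s sf)).
Qed.

(** The partial derivative of f g has integral 0, because f g inherits the compact support of f; the
    product rule does the rest. *)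
Lemma ip_partial f g i : test_fun setT f -> smooth g ->
  ip setT (partial i f) g = - ip setT f (partial i g).
Proof.
move=> tf sg; have [sf [K [cK _ fK]]] := tf.
have [a [b Kab]] := compact_sub_cbox cK.
have I p q : smooth p -> smooth q -> (forall x, ~ K x -> p x = 0) ->
    (lebesgue_rV R n).-integrable setT (EFin \o (fun x => p x * q x)).
  move=> sp sq pK; apply: (continuous_compact_support_integrable _ cK).
    exact: smooth_continuous (smooth_mul sp sq).
  by move=> x Kx; rewrite pK// mul0r.
have I0 : \int[lebesgue_rV R n]_x (partial i (fun x => f x * g x) x) = 0.
  rewrite /Rintegral (@integral_partial_eq0 _ _ _ _ a b)//.
  - by move=> x; apply: smooth_derivable; exact: smooth_mul.
  - by apply: smooth_continuous; apply: smooth_partial; exact: smooth_mul.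
  - by move=> x xab; rewrite fK ?mul0r// => /Kab.
apply/eqP; rewrite -subr_eq0 opprK /ip; apply/eqP.
rewrite -RintegralD//; last 2 first.
- exact: (I _ _ (smooth_partial i sf) sg (partial_outside_support i cK fK)).
- exact: (I _ _ sf (smooth_partial i sg) fK).
rewrite -[RHS]I0; apply: eq_Rintegral => x _.
rewrite partial_mul; first by rewrite addrC [g x * _]mulrC.
- by move=> y; exact: smooth_derivable.
- by move=> y; exact: smooth_derivable.
Qed.

Lemma ip_foldr_partial f g s : test_fun setT f -> smooth g ->
  ip setT (foldr (@partial R n) f s) g =
  (-1) ^+ size s * ip setT f (foldr (@partial R n) g s).
Proof.
move=> tf; elim: s g => [|i s IH] g sg /=; first by rewrite mul1r.
rewrite (ip_partial i (test_fun_foldr s tf) sg).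
rewrite (IH _ (smooth_partial i sg)) foldr_partialC//.
by rewrite exprS mulN1r mulNr.
Qed.

Lemma foldr_nseq (T V : Type) (h : T -> V -> V) (v : V) (y : T) k :
  foldr h v (nseq k y) = iter k (h y) v.
Proof. by elim: k => //= k ->. Qed.

(** The multi-index becomes a list of directions, with i repeated a_i times, so that induction on
    lists applies. *)
Lemma multi_partial_foldr k (a : {ffun 'I_n -> 'I_k.+1}) f :
  multi_partial a f =
  foldr (@partial R n) f (flatten [seq nseq (a i) i | i <- enum 'I_n]).
Proof.
rewrite /multi_partial; elim: (enum _) => //= i s ->.
by rewrite foldr_cat foldr_nseq.
Qed.

Lemma ip_multi_partial k (a : {ffun 'I_n -> 'I_k.+1}) f g :
  test_fun setT f -> smooth g ->
  ip setT (multi_partial a f) g =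
  (-1) ^+ (\sum_(l < n) a l)%N * ip setT f (multi_partial a g).
Proof.
move=> tf sg; rewrite !multi_partial_foldr ip_foldr_partial//.
rewrite size_flatten /shape -map_comp sumnE big_map -big_enum.
by under eq_bigr do rewrite /= size_nseq.
Qed.

Lemma test_fun_multi_partial omega k (a : {ffun 'I_n -> 'I_k.+1}) f :
  test_fun omega f -> test_fun omega (multi_partial a f).
Proof. by rewrite multi_partial_foldr; exact: test_fun_foldr. Qed.

Lemma ip_test_fun_setT omega f g : test_fun omega f ->
  ip omega f g = ip setT f g.
Proof.
move=> [_ [K [_ Ko fK]]]; rewrite /ip; apply/esym/Rintegral_support => // x _ xo.
by rewrite fK ?mul0r// => /Ko.
Qed.

End integration_by_parts.

(** * Matrix-valued fields *)

Section mxdot_theory.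
Context (R : realType) (m n : nat).
Implicit Types (M N L : 'M[R]_(m, n)).

Lemma mxdotC M N : mxdot M N = mxdot N M.
Proof. by apply: eq_bigr => i _; apply: eq_bigr => j _; rewrite mulrC. Qed.

Lemma mxdot_linl a M N L : mxdot (a *: M + N) L = a * mxdot M L + mxdot N L.
Proof.
rewrite /mxdot mulr_sumr -big_split; apply: eq_bigr => i _.
rewrite mulr_sumr -big_split; apply: eq_bigr => j _.
by rewrite !mxE mulrDl mulrA.
Qed.

Lemma mxdot_linr a M N L : mxdot L (a *: M + N) = a * mxdot L M + mxdot L N.
Proof. by rewrite !(mxdotC L) mxdot_linl. Qed.

Lemma mxdot_ge0 M : 0 <= mxdot M M.
Proof. by apply: sumr_ge0 => i _; apply: sumr_ge0 => j _; rewrite -expr2 sqr_ge0. Qed.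

Lemma sqr_le_mxdot M i j : M i j ^+ 2 <= mxdot M M.
Proof.
rewrite /mxdot (bigD1 i)//= (bigD1 j)//= -expr2 -addrA lerDl addr_ge0//.
  by apply: sumr_ge0 => k _; rewrite -expr2 sqr_ge0.
by apply: sumr_ge0 => k _; apply: sumr_ge0 => l _; rewrite -expr2 sqr_ge0.
Qed.

Lemma mxdot_eq0 M : mxdot M M = 0 -> M = 0.
Proof.
move=> M0; apply/matrixP => i j; rewrite mxE; apply/eqP.
by rewrite -sqrf_eq0 eq_le sqr_ge0 andbT -M0 sqr_le_mxdot.
Qed.

Lemma mxdot_delta M i j : mxdot (delta_mx i j) M = M i j.
Proof.
rewrite /mxdot (bigD1 i)//= [X in _ + X]big1 ?addr0; last first.
  by move=> k /negbTE ki; apply: big1 => l _; rewrite mxE ki mul0r.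
rewrite (bigD1 j)//= big1 ?addr0; first by rewrite mxE !eqxx mul1r.
by move=> l /negbTE lj; rewrite mxE lj andbF mul0r.
Qed.

Lemma mxdot0l M : mxdot 0 M = 0.
Proof. by apply: big1 => i _; apply: big1 => j _; rewrite mxE mul0r. Qed.

Lemma mxnorm2_sqr M : mxnorm2 M ^+ 2 = mxdot M M.
Proof. by rewrite sqr_sqrtr// mxdot_ge0. Qed.

Lemma mxnorm2_ge0 M : 0 <= mxnorm2 M. Proof. exact: sqrtr_ge0. Qed.

End mxdot_theory.

(** * L2 fields with values in the fixed-point space of an orthogonal projection *)

Section L2_matrix.
Context (R : realType) (d m n : nat) (omega : set 'rV[R]_d).
Hypothesis mo : measurable omega.
Context (P : {linear 'M[R]_(m, n) -> 'M[R]_(m, n)}).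
Hypothesis PP : forall M, P (P M) = P M.
Hypothesis P_sym : forall M N, mxdot (P M) N = mxdot M (P N).
Let U : set 'M[R]_(m, n) := [set M | P M = M].
Local Notation leb := (lebesgue_rV R d).
Implicit Types u v w : 'rV[R]_d -> 'M[R]_(m, n).

Lemma ip_sum (J : finType) (F : J -> 'rV[R]_d -> R) (v : 'rV[R]_d -> R) :
  (forall j, L2 omega (F j)) -> L2 omega v ->
  ip omega (fun x => \sum_j F j x) v = \sum_j ip omega (F j) v.
Proof.
move=> LF Lv.
suff H (r : seq J) : L2 omega (fun x => \sum_(j <- r) F j x) /\
    ip omega (fun x => \sum_(j <- r) F j x) v = \sum_(j <- r) ip omega (F j) v.
  by case: (H (index_enum J)).
elim: r => [|j r [IH1 IH2]].
  split; first by under eq_fun do rewrite big_nil; exact: L2_0.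
  by rewrite big_nil; under eq_fun do rewrite big_nil; exact: ip0l.
have E : (fun x => \sum_(k <- j :: r) F k x) =
    fun x => 1 * F j x + \sum_(k <- r) F k x.
  by apply/funext => x; rewrite big_cons mul1r.
by rewrite E big_cons -IH2 ip_lin// mul1r; split => //; exact: L2_lin.
Qed.

Lemma ip_sumr (J : finType) (F : J -> 'rV[R]_d -> R) (v : 'rV[R]_d -> R) :
  (forall j, L2 omega (F j)) -> L2 omega v ->
  ip omega v (fun x => \sum_j F j x) = \sum_j ip omega v (F j).
Proof.
move=> LF Lv; rewrite ip_sym ip_sum//.
by apply: eq_bigr => j _; rewrite ip_sym.
Qed.

Lemma ip_scale a (u v : 'rV[R]_d -> R) : L2 omega u -> L2 omega v ->
  ip omega (fun x => a * u x) v = a * ip omega u v.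
Proof.
move=> Lu Lv; have := ip_lin mo a Lu (@L2_0 _ _ omega) Lv.
by rewrite ip0l// addr0 => <-; congr ip; apply/funext => x; rewrite addr0.
Qed.

Lemma L2U_comp w i j : L2U omega U w -> L2 omega (fun x => w x i j).
Proof.
move=> [mw wi _]; split; first exact: mw.
apply: (le_integrable mo) wi; first by apply/measurable_EFinP/measurable_funX.
move=> x _; rewrite lee_fin !ger0_norm ?sqr_ge0 ?mxdot_ge0//.
exact: sqr_le_mxdot.
Qed.

Lemma L2U_ae_in w : L2U omega U w -> {ae leb, forall x, omega x -> P (w x) = w x}.
Proof. by case. Qed.

Lemma L2U_of_comp w : (forall i j, L2 omega (fun x => w x i j)) ->
  {ae leb, forall x, omega x -> U (w x)} -> L2U omega U w.
Proof.
move=> Lw Uw; split=> //; first by move=> i j; case: (Lw i j).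
rewrite (_ : (fun x => _) = fun x => (\sum_i \sum_j (w x i j * w x i j)%:E)%E).
  apply: (integrable_sum mo) => i _; apply: (integrable_sum mo) => j _.
  exact: L2_integrable.
by apply/funext => x; rewrite /mxdot -sumEFin; apply: eq_bigr => i _; rewrite -sumEFin.
Qed.

Lemma ipU_comp w v : (forall i j, L2 omega (fun x => w x i j)) ->
  (forall i j, L2 omega (fun x => v x i j)) ->
  ipU omega w v = \sum_i \sum_j ip omega (fun x => w x i j) (fun x => v x i j).
Proof.
move=> Lw Lv.
have I i j : leb.-integrable omega (fun x => (w x i j * v x i j)%:E).
  exact: L2_integrable.
have Isum (J : finType) (F : J -> 'rV[R]_d -> R) :
    (forall j, leb.-integrable omega (fun x => (F j x)%:E)) ->
    leb.-integrable omega (fun x => (\sum_j F j x)%:E) /\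
    \int[leb]_(x in omega) (\sum_j F j x) = \sum_j \int[leb]_(x in omega) F j x.
  move=> iF; split.
    rewrite (_ : (fun x => _) = fun x => (\sum_j (F j x)%:E)%E).
      by apply: (integrable_sum mo).
    by apply/funext => x; rewrite sumEFin.
  rewrite /Rintegral; under eq_integral do rewrite -sumEFin.
  rewrite integral_sum// -sum_fine// => j _.
  exact: integrable_fin_num.
have I1 i := (Isum _ (fun j x => w x i j * v x i j) (I i)).
have [_ E] := Isum _ (fun i x => \sum_j w x i j * v x i j) (fun i => (I1 i).1).
by rewrite /ipU /mxdot E; apply: eq_bigr => i _; case: (I1 i).
Qed.

Lemma L2U_lin a u v : L2U omega U u -> L2U omega U v ->
  L2U omega U (fun x => a *: u x + v x).
Proof.
move=> Lu Lv; apply: L2U_of_comp.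
  move=> i j; have := L2_lin mo a (L2U_comp i j Lu) (L2U_comp i j Lv).
  by congr (L2 _ _); apply/funext => x; rewrite !mxE.
apply: filterS2 (L2U_ae_in Lu) (L2U_ae_in Lv) => x hu hv ox.
by rewrite /U /= linearP hu// hv.
Qed.

Lemma L2U_0 : L2U omega U (fun=> 0).
Proof.
apply: L2U_of_comp; last by apply: aeW => x _; rewrite /U /= linear0.
by move=> i j; under eq_fun do rewrite mxE; exact: L2_0.
Qed.

Lemma L2U_sub u v : L2U omega U u -> L2U omega U v -> L2U omega U (fun x => u x - v x).
Proof.
move=> Lu Lv; have := L2U_lin (-1) Lv Lu.
by congr (L2U _ _ _); apply/funext => x; rewrite scaleN1r addrC.
Qed.

Lemma ipU_sym u v : ipU omega u v = ipU omega v u.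
Proof. by apply: eq_Rintegral => x _; rewrite mxdotC. Qed.

Lemma ipU_lin a u v w : L2U omega U u -> L2U omega U v -> L2U omega U w ->
  ipU omega (fun x => a *: u x + v x) w = a * ipU omega u w + ipU omega v w.
Proof.
move=> Lu Lv Lw; rewrite !ipU_comp; try by move=> i j; apply: L2U_comp.
  rewrite mulr_sumr -big_split; apply: eq_bigr => i _.
  rewrite mulr_sumr -big_split; apply: eq_bigr => j _.
  rewrite /= -ip_lin//; try exact: L2U_comp.
  by congr ip; apply/funext => x; rewrite !mxE.
by move=> i j; apply: L2U_comp; exact: L2U_lin.
Qed.

Lemma ipU_ge0 u : 0 <= ipU omega u u.
Proof. by apply: Rintegral_ge0 => x _; exact: mxdot_ge0. Qed.

Lemma ipU_ae u v u' v' : ae_eq leb omega u u' -> ae_eq leb omega v v' ->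
  ipU omega u v = ipU omega u' v'.
Proof.
move=> uu vv; apply: ae_eq_Rintegral => //.
by apply: filterS2 uu vv => x hu hv ox; rewrite hu// hv.
Qed.

Lemma nrmU_ge0 u : 0 <= nrmU omega u. Proof. exact: sqrtr_ge0. Qed.

Lemma nrmU_sqr u : nrmU omega u ^+ 2 = ipU omega u u.
Proof. by rewrite sqr_sqrtr// ipU_ge0. Qed.

Lemma ipU_le_nrmU u v : L2U omega U u -> L2U omega U v ->
  `|ipU omega u v| <= nrmU omega u * nrmU omega v.
Proof.
apply: (@cauchy_schwarz R _ (fun a u v x => a *: u x + v x) (L2U omega U) (ipU omega)).
- exact: L2U_lin.
- by move=> *; exact: ipU_sym.
- exact: ipU_lin.
- by move=> *; exact: ipU_ge0.
Qed.

Lemma nrmU_ae u v : ae_eq leb omega u v -> nrmU omega u = nrmU omega v.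
Proof. by move=> uv; rewrite /nrmU (ipU_ae uv uv). Qed.

Lemma nrmU_eq0 u : L2U omega U u -> nrmU omega u = 0 -> ae_eq leb omega u (fun=> 0).
Proof.
move=> [_ ui _] /eqP; rewrite -(@eqrXn2 _ 2) ?nrmU_ge0// nrmU_sqr expr0n/= => /eqP.
move=> /(Rintegral_eq0 mo ui); move=> /(_ (fun x _ => mxdot_ge0 _)).
by apply: filterS => x /[apply] /mxdot_eq0.
Qed.

Lemma nrmUB_ae u v : L2U omega U u -> L2U omega U v ->
  nrmU omega (fun x => u x - v x) = 0 -> ae_eq leb omega u v.
Proof.
move=> Lu Lv /(nrmU_eq0 (L2U_sub Lu Lv)); apply: filterS => x /[apply]/eqP.
by rewrite subr_eq0 => /eqP.
Qed.

Lemma nrm_comp_le u i j : L2U omega U u ->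
  nrm omega (fun x => u x i j) <= nrmU omega u.
Proof.
move=> Lu; rewrite -ler_sqr ?nnegrE ?nrmU_ge0 ?nrm_ge0// nrm_sqr nrmU_sqr.
have [_ ui _] := Lu.
apply: le_Rintegral => //; first exact: L2_integrable (L2U_comp i j Lu) (L2U_comp i j Lu).
by move=> x _; rewrite -expr2 sqr_le_mxdot.
Qed.

(** Expanding |M - P M|^2 >= 0 gives |M|^2 - |P M|^2, because P is symmetric and idempotent. *)
Lemma mxdot_proj_le M : mxdot (P M) (P M) <= mxdot M M.
Proof.
have := mxdot_ge0 (-1 *: P M + M).
rewrite mxdot_linl !mxdot_linr P_sym PP [mxdot M (P M)]mxdotC P_sym.
lra.
Qed.

(** The entries converge in L2, but their limit [w0] need not take values in U. Its projection does,
    and is no farther away, since the fields u_k are fixed by P a.e. and P does not increase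
    norms. *)
Lemma L2U_complete :
  complete_for (fun u v => nrmU omega (fun x => u x - v x)) (L2U omega U).
Proof.
move=> u Lu cu.
have lim_ij (ij : 'I_m * 'I_n) : exists f, L2 omega f /\
    converges_for (fun u v : 'rV[R]_d -> R => nrm omega (fun x => u x - v x))
        (fun k x => u k x ij.1 ij.2) f.
  case: ij => i j /=.
  have [||f Lf cf] := @L2_complete R d omega mo (fun k x => u k x i j).
  - by move=> k; exact: L2U_comp.
  - move=> e e0; have [N HN] := cu e e0; exists N => k l Nk Nl.
    apply: le_lt_trans (HN k l Nk Nl).
    have := nrm_comp_le i j (L2U_sub (Lu k) (Lu l)).
    by congr (nrm _ _ <= _); apply/funext => x; rewrite !mxE.
  - by exists f.
have [g Hg] := choice lim_ij.
pose w0 x : 'M[R]_(m, n) := \matrix_(i, j) g (i, j) x.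
have Lw0 i j : L2 omega (fun x => w0 x i j).
  by under eq_fun do rewrite mxE; case: (Hg (i, j)).
have LP w : (forall i j, L2 omega (fun x => w x i j)) -> L2U omega U (fun x => P (w x)).
  move=> Lw; apply: L2U_of_comp; last by apply: aeW => x _; exact: PP.
  move=> i j; have E x : P (w x) i j = \sum_k \sum_l P (delta_mx k l) i j * w x k l.
    rewrite {1}(matrix_sum_delta (w x)) linear_sum summxE; apply: eq_bigr => k _.
    rewrite linear_sum summxE; apply: eq_bigr => l _.
    by rewrite linearZ mxE mulrC.
  under eq_fun do rewrite E.
  apply: L2_sum => // k; apply: L2_sum => // l; exact: L2_scale.
exists (fun x => P (w0 x)); first exact: LP.
move=> e e0.
(* With each entry within e / c, the m n squares add up to less than e^2; the summand 1 keeps c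
   positive when there are no entries. *)
pose c : R := (m * n)%:R + 1.
have c0 : 0 < c by rewrite ltr_wpDl.
have [N HN] : exists N, forall k, (N <= k)%N -> forall ij : 'I_m * 'I_n,
    nrm omega (fun x => u k x ij.1 ij.2 - g ij x) < e / c.
  have /choice[N HN] : forall ij : 'I_m * 'I_n, exists N, forall k, (N <= k)%N ->
      nrm omega (fun x => u k x ij.1 ij.2 - g ij x) < e / c.
    by move=> ij; have [_] := Hg ij; apply; rewrite divr_gt0.
  exists (\max_ij N ij)%N => k Nk ij; apply: HN.
  by apply: leq_trans Nk; exact: leq_bigmax.
exists N => k /HN {}HN.
have Luk i j : L2 omega (fun x => (u k x - w0 x) i j).
  have := L2_sub mo (L2U_comp i j (Lu k)) (Lw0 i j).
  by congr (L2 _ _); apply/funext => x; rewrite !mxE.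
have E : ae_eq leb omega (fun x => u k x - P (w0 x)) (fun x => P (u k x - w0 x)).
  by apply: filterS (L2U_ae_in (Lu k)) => x h ox; rewrite linearB /= h.
rewrite (nrmU_ae E) -ltr_sqr ?nnegrE ?nrmU_ge0 ?(ltW e0)// nrmU_sqr.
apply: (@le_lt_trans _ _ (\sum_(i < m) \sum_(j < n) (e / c) ^+ 2)).
  apply: (@le_trans _ _ (ipU omega (fun x => u k x - w0 x) (fun x => u k x - w0 x))).
    have [_ I1 _] := LP _ Luk.
    apply: le_Rintegral => //; last by move=> x _; exact: mxdot_proj_le.
    rewrite (_ : _ \o _ = fun x => (\sum_i \sum_j ((u k x - w0 x) i j * (u k x - w0 x) i j)%:E)%E).
      apply: (integrable_sum mo) => i _; apply: (integrable_sum mo) => j _.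
      exact: L2_integrable.
    by apply/funext => x; rewrite /mxdot /= -sumEFin; apply: eq_bigr => i _; rewrite -sumEFin.
  rewrite ipU_comp//; apply: ler_sum => i _; apply: ler_sum => j _.
  rewrite -nrm_sqr// ler_sqr ?nnegrE ?nrm_ge0 ?divr_ge0 ?ltW//.
  by have := HN (i, j); congr (nrm _ _ < _); apply/funext => x; rewrite !mxE.
rewrite !sumr_const !card_ord -mulrnA -mulr_natr.
have [t t0 ->] : exists2 t, 0 < t & e = t * c.
  by exists (e / c); [rewrite divr_gt0|rewrite divfK// gt_eqF].
rewrite mulfK ?gt_eqF// exprMn ltr_pM2l ?exprn_gt0// mulnC /c.
have : 0 <= (m * n)%:R :> R by [].
by move: (_%:R) => z z0; nra.
Qed.

End L2_matrix.

(** * Distributional operators *)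

Section weak_operators.
Context (R : realType) (d k m n : nat).
Context (P : {linear 'M[R]_(m, n) -> 'M[R]_(m, n)}).
Hypothesis PP : forall M, P (P M) = P M.
Hypothesis P_sym : forall M N, mxdot (P M) N = mxdot M (P N).
Local Notation U := [set M | P M = M].
Context (A : diffop R d k m n).
Hypothesis AU : forall a, U (A a).
Local Notation leb := (lebesgue_rV R d).
Implicit Types (omega : set 'rV[R]_d) (f : 'rV[R]_d -> R).

Lemma test_field_scale omega f (M : 'M[R]_(m, n)) : test_fun omega f -> U M ->
  test_field omega U (fun x => f x *: M).
Proof.
move=> tf UM; split=> [i j|x]; last by rewrite /= linearZ /= UM.
under eq_fun do rewrite mxE mulrC; exact: test_fun_scale.
Qed.

Lemma test_fun_diffop omega f i j : test_fun omega f ->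
  test_fun omega (fun x => diffop_apply A f x i j).
Proof.
move=> tf; rewrite /diffop_apply.
under eq_fun do rewrite summxE.
apply: test_fun_sum => a; under eq_fun do rewrite mxE mulrC.
by apply: test_fun_scale; exact: test_fun_multi_partial.
Qed.

Lemma test_fun_diffop_adj omega F : test_field omega U F ->
  test_fun omega (diffop_adj_apply A F).
Proof.
move=> [tF _]; apply: test_fun_sum => a; apply: test_fun_scale.
apply: test_fun_sum => i; apply: test_fun_sum => j.
by apply: test_fun_scale; exact: test_fun_multi_partial.
Qed.

Section on_open_set.
Context (omega : set 'rV[R]_d).
Hypothesis oo : open omega.
Let mo : measurable omega. Proof. exact: open_measurable_rV. Qed.
Implicit Types (v h : 'rV[R]_d -> R) (w g F : 'rV[R]_d -> 'M[R]_(m, n)).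

Lemma test_field_L2U F : test_field omega U F -> L2U omega U F.
Proof.
move=> [tF UF]; apply: (L2U_of_comp mo); last by apply: aeW => x _; exact: UF.
by move=> i j; exact: test_fun_L2.
Qed.

Lemma diffop_L2U f : test_fun omega f -> L2U omega U (diffop_apply A f).
Proof.
move=> tf; apply: (L2U_of_comp mo).
  by move=> i j; apply: test_fun_L2 => //; exact: test_fun_diffop.
apply: aeW => x _ /=; rewrite /diffop_apply linear_sum; apply: eq_bigr => a _.
by rewrite linearZ /= AU.
Qed.

Lemma ae_eq0_of_test_field g : L2U omega U g ->
  (forall F, test_field omega U F -> ipU omega g F = 0) ->
  ae_eq leb omega g (fun=> 0).
Proof.
move=> Lg g_test.
have comp (ij : 'I_m * 'I_n) : ae_eq leb omega (fun x => g x ij.1 ij.2) (fun=> 0).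
  case: ij => i j /=; apply: ae_eq0_of_test_fun => //; first exact: (L2U_comp mo i j Lg).
  move=> f tf.
  (* The matrix unit E_ij may lie outside U, so the test field is f P E_ij; since P g = g, the
     projection moves over to g and the pairing picks out f g_ij. *)
  have := g_test _ (test_field_scale tf (PP (delta_mx i j))).
  move=> <-; apply: ae_eq_Rintegral => //.
  apply: filterS (L2U_ae_in Lg) => x Pg ox.
  rewrite -[f x *: _]addr0 mxdot_linr -P_sym Pg// mxdotC mxdot_delta.
  by rewrite mxdotC mxdot0l addr0 mulrC.
have : {ae leb, forall x, forall ij : 'I_m * 'I_n, omega x -> g x ij.1 ij.2 = 0}.
  exact: filter_forall.
apply: filterS => x h ox.
by apply/matrixP => i j; rewrite mxE (h (i, j)).
Qed.

Lemma weak_op_unique v g1 g2 : weak_op U A omega v g1 -> weak_op U A omega v g2 ->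
  ae_eq leb omega g1 g2.
Proof.
move=> [L1 H1] [L2 H2].
have : ae_eq leb omega (fun x => -1 *: g2 x + g1 x) (fun=> 0).
  apply: ae_eq0_of_test_field; first exact: (L2U_lin mo).
  move=> F tF; rewrite (ipU_lin mo _ L2 L1 (test_field_L2U tF)).
  by rewrite -H1// -H2// mulN1r addNr.
apply: filterS => x /[apply]; rewrite scaleN1r addrC => /eqP.
by rewrite subr_eq0 => /eqP.
Qed.

Lemma weak_adj_unique w h1 h2 : weak_adj A omega w h1 -> weak_adj A omega w h2 ->
  ae_eq leb omega h1 h2.
Proof.
move=> [L1 H1] [L2 H2].
have : ae_eq leb omega (fun x => -1 * h2 x + h1 x) (fun=> 0).
  apply: ae_eq0_of_test_fun => //; first exact: L2_lin.
  move=> f tf; rewrite (ip_lin mo _ L2 L1 (test_fun_L2 mo tf)).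
  by rewrite -H1// -H2// mulN1r addNr.
apply: filterS => x /[apply]; rewrite mulN1r addrC => /eqP.
by rewrite subr_eq0 => /eqP.
Qed.

Lemma opA_weak v : HA U A omega v -> weak_op U A omega v (opA U A omega v).
Proof.
move=> [_ [g hg]].
exact: (@xgetPex _ (fun=> 0) [set g | weak_op U A omega v g] (ex_intro _ g hg)).
Qed.

Lemma opAs_weak w : HAs U A omega w -> weak_adj A omega w (opAs A omega w).
Proof.
move=> [_ [h hh]].
exact: (@xgetPex _ (fun=> 0) [set h | weak_adj A omega w h] (ex_intro _ h hh)).
Qed.

Lemma HA_L2 v : HA U A omega v -> L2 omega v. Proof. by case. Qed.
Lemma HAs_L2U w : HAs U A omega w -> L2U omega U w. Proof. by case. Qed.
Lemma opA_L2U v : HA U A omega v -> L2U omega U (opA U A omega v).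
Proof. by move=> /opA_weak[]. Qed.
Lemma opAs_L2 w : HAs U A omega w -> L2 omega (opAs A omega w).
Proof. by move=> /opAs_weak[]. Qed.

Lemma weak_op_HA v g : L2 omega v -> weak_op U A omega v g ->
  HA U A omega v /\ ae_eq leb omega (opA U A omega v) g.
Proof.
move=> Lv vg; have Hv : HA U A omega v by split=> //; exists g.
by split=> //; apply: weak_op_unique vg; exact: opA_weak.
Qed.

Lemma weak_adj_HAs w h : L2U omega U w -> weak_adj A omega w h ->
  HAs U A omega w /\ ae_eq leb omega (opAs A omega w) h.
Proof.
move=> Lw wh; have Hw : HAs U A omega w by split=> //; exists h.
by split=> //; apply: weak_adj_unique wh; exact: opAs_weak.
Qed.

Lemma weak_op_lin a u v g1 g2 : L2 omega u -> L2 omega v ->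
  weak_op U A omega u g1 -> weak_op U A omega v g2 ->
  weak_op U A omega (fun x => a * u x + v x) (fun x => a *: g1 x + g2 x).
Proof.
move=> Lu Lv [L1 H1] [L2 H2]; split; first exact: (L2U_lin mo).
move=> F tF; rewrite (ipU_lin mo _ L1 L2 (test_field_L2U tF)).
by rewrite ip_lin// ?H1 ?H2//; exact/test_fun_L2/test_fun_diffop_adj.
Qed.

Lemma weak_adj_lin a (u v : 'rV[R]_d -> 'M[R]_(m, n)) h1 h2 : L2U omega U u -> L2U omega U v ->
  weak_adj A omega u h1 -> weak_adj A omega v h2 ->
  weak_adj A omega (fun x => a *: u x + v x) (fun x => a * h1 x + h2 x).
Proof.
move=> Lu Lv [L1 H1] [L2 H2]; split; first exact: L2_lin.
move=> f tf; rewrite (ipU_lin mo _ Lu Lv (diffop_L2U tf)).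
by rewrite H1// H2// ip_lin//; exact: test_fun_L2.
Qed.

Lemma opA_lin a u v : HA U A omega u -> HA U A omega v ->
  HA U A omega (fun x => a * u x + v x) /\
  ae_eq leb omega (opA U A omega (fun x => a * u x + v x))
    (fun x => a *: opA U A omega u x + opA U A omega v x).
Proof.
move=> Hu Hv; apply: weak_op_HA; first by apply: L2_lin => //; exact: HA_L2.
by apply: weak_op_lin; [exact: HA_L2|exact: HA_L2|exact: opA_weak|exact: opA_weak].
Qed.

Lemma opAs_lin a (u v : 'rV[R]_d -> 'M[R]_(m, n)) : HAs U A omega u -> HAs U A omega v ->
  HAs U A omega (fun x => a *: u x + v x) /\
  ae_eq leb omega (opAs A omega (fun x => a *: u x + v x))
    (fun x => a * opAs A omega u x + opAs A omega v x).
Proof.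
move=> Hu Hv; apply: weak_adj_HAs; first by apply: (L2U_lin mo); exact: HAs_L2U.
by apply: weak_adj_lin; [exact: HAs_L2U|exact: HAs_L2U|exact: opAs_weak|exact: opAs_weak].
Qed.

(** The weak identity sees v only through integrals, so the sets chosen from coincide and the chosen
    representatives are literally equal. *)
Lemma opA_ae u v : ae_eq leb omega u v -> opA U A omega u = opA U A omega v.
Proof.
move=> uv; congr (xget _); apply/funext => g; apply/propext; rewrite /weak_op.
have E h : ip omega u h = ip omega v h by apply: (ip_ae uv); exact: ae_eq_refl.
by split=> -[L H]; split=> // F tF; rewrite -H.
Qed.

Lemma opAs_ae (u v : 'rV[R]_d -> 'M[R]_(m, n)) :
  ae_eq leb omega u v -> opAs A omega u = opAs A omega v.
Proof.
move=> uv; congr (xget _); apply/funext => h; apply/propext; rewrite /weak_adj.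
have E g : ipU omega u g = ipU omega v g by apply: (ipU_ae uv); exact: ae_eq_refl.
by split=> -[L H]; split=> // f tf; rewrite -H.
Qed.

Lemma HAs_ae (u v : 'rV[R]_d -> 'M[R]_(m, n)) :
  HAs U A omega u -> L2U omega U v -> ae_eq leb omega u v -> HAs U A omega v.
Proof.
move=> [Lu [h [Lh uh]]] Lv uv; split=> //; exists h; split=> // f tf.
by rewrite -uh//; apply/esym/(ipU_ae uv); exact: ae_eq_refl.
Qed.

(** Both sides are expanded over entries and multi-indices; integration by parts matches the terms,
    and its sign is the one in the formal adjoint. *)
Lemma ipU_diffop f F : test_fun omega f -> test_field omega U F ->
  ipU omega (diffop_apply A f) F = ip omega f (diffop_adj_apply A F).
Proof.
move=> tf [tF UF].
have Lf := test_fun_L2 mo tf.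
have LF i j := test_fun_L2 mo (tF i j).
have LDf a := test_fun_L2 mo (test_fun_multi_partial a tf).
have LDF a i j := test_fun_L2 mo (test_fun_multi_partial a (tF i j)).
have LS a c u : L2 omega u -> L2 omega (fun x => c a * u x) by move=> /L2_scale; apply.
rewrite ipU_comp//; last by move=> i j; apply: test_fun_L2 => //; exact: test_fun_diffop.
have Ls a i j : L2 omega (fun x => A a i j * multi_partial a (fun y => F y i j) x).
  exact: L2_scale.
have Lsj a i : L2 omega (fun x => \sum_j A a i j * multi_partial a (fun y => F y i j) x).
  by apply: L2_sum.
have Lsi a : L2 omega (fun x => \sum_i \sum_j A a i j * multi_partial a (fun y => F y i j) x).
  by apply: L2_sum.
rewrite /diffop_adj_apply ip_sumr//; last by move=> a; exact: L2_scale.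
transitivity (\sum_i \sum_j \sum_a A a i j * ip omega (multi_partial a f) (fun x => F x i j)).
  apply: eq_bigr => i _; apply: eq_bigr => j _.
  have -> : (fun x => diffop_apply A f x i j) = fun x => \sum_a A a i j * multi_partial a f x.
    by apply/funext => x; rewrite summxE; apply: eq_bigr => a _; rewrite mxE mulrC.
  rewrite ip_sum//; last by move=> a; exact: L2_scale.
  by apply: eq_bigr => a _; rewrite ip_scale.
under eq_bigr do rewrite exchange_big; rewrite exchange_big /=.
apply: eq_bigr => a _; rewrite ip_sym ip_scale// ip_sum// mulr_sumr.
apply: eq_bigr => i _; rewrite ip_sum// mulr_sumr.
apply: eq_bigr => j _; rewrite ip_scale// mulrCA; congr (_ * _).
(* Integration by parts is known on the whole space; since f has support in omega, the integrals
   over omega and over R^d agree. *)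
have tfT : test_fun setT f by exact: test_fun_sub tf.
rewrite (ip_test_fun_setT _ (test_fun_multi_partial a tf)).
rewrite ip_multi_partial//; last by case: (tF i j).
by congr (_ * _); rewrite [RHS]ip_sym (ip_test_fun_setT _ tf).
Qed.

Lemma weak_op_test_fun f : test_fun omega f -> weak_op U A omega f (diffop_apply A f).
Proof. by move=> tf; split; [exact: diffop_L2U|move=> F tF; rewrite ipU_diffop]. Qed.

Lemma weak_adj_test_field F : test_field omega U F ->
  weak_adj A omega F (diffop_adj_apply A F).
Proof.
move=> tF; split; first by apply: test_fun_L2 => //; exact: test_fun_diffop_adj.
by move=> f tf; rewrite ipU_sym ipU_diffop// ip_sym.
Qed.

Lemma H0AP v : H0A U A omega v <-> HA U A omega v /\
  forall w, HAs U A omega w -> ipU omega (opA U A omega v) w = ip omega v (opAs A omega w).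
Proof.
split=> -[Hv tr]; split=> //.
  move=> w hw; apply/eqP; rewrite -subr_eq0; apply/eqP.
  exact: (congr1 (fun h : HAs U A omega -> R => h (exist _ w (mem_set hw))) tr).
apply/funext => -[w hw] /=; rewrite /trace_Gamma /= tr ?subrr//.
by rewrite inE in hw.
Qed.

(** The identity defining the weak adjoint of w, tested with f, is exactly the vanishing of the
    trace of f on w. *)
Lemma test_fun_H0A f : test_fun omega f ->
  H0A U A omega f /\ ae_eq leb omega (opA U A omega f) (diffop_apply A f).
Proof.
move=> tf; have [Hf ae] := weak_op_HA (test_fun_L2 mo tf) (weak_op_test_fun tf).
split=> //; apply/H0AP; split=> // w hw; have [_ H] := opAs_weak hw.
by rewrite (ipU_ae ae (ae_eq_refl _ _ w)) ipU_sym H// ip_sym.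
Qed.

Lemma test_field_HAs F : test_field omega U F ->
  HAs U A omega F /\ ae_eq leb omega (opAs A omega F) (diffop_adj_apply A F).
Proof.
by move=> tF; apply: weak_adj_HAs; [exact: test_field_L2U|exact: weak_adj_test_field].
Qed.

Lemma H0A_HA v : H0A U A omega v -> HA U A omega v. Proof. by case. Qed.

Lemma H0A_lin a u v : H0A U A omega u -> H0A U A omega v ->
  H0A U A omega (fun x => a * u x + v x).
Proof.
move=> /H0AP[Hu tu] /H0AP[Hv tv]; have [H ae] := opA_lin a Hu Hv.
apply/H0AP; split=> // w hw.
rewrite (ipU_ae ae (ae_eq_refl _ _ w)).
rewrite (ipU_lin mo _ (opA_L2U Hu) (opA_L2U Hv) (HAs_L2U hw)).
by rewrite ip_lin ?tu ?tv//; [exact: HA_L2|exact: HA_L2|exact: opAs_L2].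
Qed.

End on_open_set.
End weak_operators.

(** * Meshes *)

Section polyhedral_meshes.
Context (R : realType) (d : nat).
Local Notation leb := (lebesgue_rV R d).
Implicit Types (Omega K P : set 'rV[R]_d).

Lemma continuous_mxdot (h : 'rV[R]_d) : continuous (mxdot h : 'rV[R]_d -> R).
Proof.
have -> : mxdot h = fun x : 'rV[R]_d => \sum_j h ord0 j * x ord0 j.
  by apply/funext => x; rewrite /mxdot big_ord1.
elim: (index_enum _) => [|j r IH].
  have -> : (fun x : 'rV[R]_d => \sum_(j <- [::]) h ord0 j * x ord0 j) = cst 0.
    by apply/funext => y; rewrite big_nil.
  exact: cst_continuous.
have -> : (fun x : 'rV[R]_d => \sum_(i <- j :: r) h ord0 i * x ord0 i) =
    fun x => h ord0 j * x ord0 j + \sum_(i <- r) h ord0 i * x ord0 i.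
  by apply/funext => y; rewrite big_cons.
move=> x; exact: (cvgD (cvgM (cvg_cst _) (@coord_continuous _ _ _ ord0 j x)) (IH x)).
Qed.

(** Off the finitely many bounding hyperplanes, which are null because their normals are nonzero,
    all inequalities are strict and so persist in a neighbourhood. *)
Lemma ae_polytope_interior P : convex_polytope P -> {ae leb, forall x, P x -> P° x}.
Proof.
move=> [_ [s [s0 PE]]].
have : {ae leb, forall x, forall k : 'I_(size s), mxdot (tnth (in_tuple s) k).1 x <>
    (tnth (in_tuple s) k).2}.
  apply: filter_forall => k; set h := tnth _ _.
  have h0 : h.1 != 0 by apply: s0; exact: mem_tnth.
  exists [set x | mxdot h.1 x = h.2]; split.
  - exact: measurable_hyperplane.
  - exact: lebesgue_hyperplane.
  - by move=> x /= /contrapT.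
apply: filterS => x hx Px.
have near_k (k : 'I_(size s)) : \forall y \near (x : 'rV[R]_d),
    mxdot (tnth (in_tuple s) k).1 y < (tnth (in_tuple s) k).2.
  set h := tnth _ _; have hk : mxdot h.1 x < h.2.
    rewrite lt_neqAle; apply/andP; split; first by apply/eqP; exact: hx.
    by move: Px; rewrite PE; apply; exact: mem_tnth.
  exact: (@continuous_mxdot h.1 x _ (lt_nbhsl hk)).
have : nbhs (x : 'rV[R]_d) P.
  have FF : Filter (nbhs (x : 'rV[R]_d)) by exact: nbhs_filter.
  have := @filter_forall _ _ _ _ FF near_k.
  apply: filterS => y hy; rewrite PE => h hs.
  by have /tnthP[k ->] : h \in in_tuple s by []; rewrite ltW.
by [].
Qed.

(** Almost every point of the closure is interior to one of the polytopes covering it, hence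
    interior to the closure, which is K. *)
Lemma ae_polyhedral_element K : polyhedral_element K ->
  {ae leb, forall x, closure K x -> K x}.
Proof.
move=> [_ _ _ KE [n [P [polP clK]]]].
have : {ae leb, forall x, forall i : 'I_n, P i x -> (P i)° x}.
  by apply: filter_forall => i; exact: ae_polytope_interior.
apply: filterS => x hx; rewrite {1}clK => -[i _ /hx Pix].
rewrite KE; apply: interiorS Pix; rewrite clK; exact: bigcup_sup.
Qed.

Section mesh.
Context Omega (I : finType) (T : I -> set 'rV[R]_d).
Hypothesis oOmega : open Omega.
Hypothesis meshT : regular_mesh Omega T.

Lemma mesh_open i : open (T i).
Proof. by case: meshT => [h _ _ _]; case: (h i) => -[]. Qed.

Lemma mesh_sub i : T i `<=` Omega.
Proof. by case: meshT => [h _ _ _]; case: (h i). Qed.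

Lemma ae_mesh_cover : {ae leb, forall x, Omega x -> exists i, T i x}.
Proof.
case: meshT => [h _ clO _].
have : {ae leb, forall x, forall i : I, closure (T i) x -> T i x}.
  by apply: filter_forall => i; apply: ae_polyhedral_element; case: (h i).
apply: filterS => x hx ox.
have : closure Omega x by exact: subset_closure.
by rewrite clO => -[i _ /hx]; exists i.
Qed.

Lemma Rintegral_mesh (f : 'rV[R]_d -> R) : leb.-integrable Omega (EFin \o f) ->
  \sum_i \int[leb]_(x in T i) f x = \int[leb]_(x in Omega) f x.
Proof.
move=> fi; case: meshT => [_ trivT _ _].
have mT i : measurable (T i) by apply: open_measurable_rV; exact: mesh_open.
have mO : measurable Omega by exact: open_measurable_rV.
pose D := \big[setU/set0]_(i <- index_enum I) T i.
have DE x : D x <-> exists i, T i x.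
  rewrite /D -bigcup_seq; split=> [[i _ ix]|[i ix]]; exists i => //=.
  exact: mem_index_enum.
have DO : D `<=` Omega by move=> x /DE[i]; exact: mesh_sub.
have mD : measurable D by apply: bigsetU_measurable.
have fD : \int[leb]_(x in Omega) f x = \int[leb]_(x in D) f x.
  transitivity (\int[leb]_(x in Omega) (if x \in D then f x else 0)).
    apply: ae_eq_Rintegral => //; apply: filterS ae_mesh_cover => x hx ox.
    by rewrite mem_set//; apply/DE; exact: hx.
  rewrite (@Rintegral_support _ _ _ leb Omega D)//; last first.
    by move=> x _ Dx; rewrite memNset.
  by apply: eq_Rintegral => x ->.
have iT i : leb.-integrable (T i) (EFin \o f) by exact: integrableS (@mesh_sub i) fi.
have : (\int[leb]_(x in D) (f x)%:E = \sum_i \int[leb]_(x in T i) (f x)%:E)%E.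
  apply: integral_bigsetU_EFin => //; first exact: index_enum_uniq.
    by apply: sub_trivIset trivT.
  exact: measurable_int (integrableS mO mD DO fi).
rewrite fD {2}/Rintegral => ->; rewrite -sum_fine// => i _.
exact: integrable_fin_num.
Qed.

Lemma ip_mesh u v : L2 Omega u -> L2 Omega v -> \sum_i ip (T i) u v = ip Omega u v.
Proof.
move=> Lu Lv; apply: Rintegral_mesh; apply: L2_integrable => //.
exact: open_measurable_rV.
Qed.

Lemma ipU_mesh m n (P : {linear 'M[R]_(m, n) -> 'M[R]_(m, n)}) (w g : 'rV[R]_d -> 'M[R]_(m, n)) :
  L2U Omega [set M | P M = M] w -> L2U Omega [set M | P M = M] g ->
  \sum_i ipU (T i) w g = ipU Omega w g.
Proof.
move=> Lw Lg; apply: Rintegral_mesh.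
have mO : measurable Omega by exact: open_measurable_rV.
rewrite (_ : EFin \o _ = fun x => (\sum_i \sum_j (w x i j * g x i j)%:E)%E).
  apply: (integrable_sum mO) => i _; apply: (integrable_sum mO) => j _.
  exact: (L2_integrable mO (L2U_comp mO i j Lw) (L2U_comp mO i j Lg)).
by apply/funext => x; rewrite /mxdot /= -sumEFin; apply: eq_bigr => i _; rewrite -sumEFin.
Qed.

End mesh.
End polyhedral_meshes.

(** * Restriction of weak operators to a smaller open set *)

Section restriction.
Context (R : realType) (d k m n : nat).
Context (P : {linear 'M[R]_(m, n) -> 'M[R]_(m, n)}).
Local Notation U := [set M | P M = M].
Context (A : diffop R d k m n).
Context (omega E : set 'rV[R]_d).
Hypotheses (oo : open omega) (oE : open E) (Eo : E `<=` omega).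

Lemma L2U_subset w : L2U omega U w -> L2U E U w.
Proof.
move=> [mw wi Uw]; split.
- by move=> i j; apply: measurable_funS (mw i j) => //; exact: open_measurable_rV.
- by apply: integrableS wi => //; exact: open_measurable_rV.
- by apply: filterS Uw => x + /Eo.
Qed.

Lemma test_field_sub F : test_field E U F -> test_field omega U F.
Proof. by move=> [tF UF]; split=> // i j; exact: test_fun_sub (tF i j). Qed.

Lemma ip_restrict v f : test_fun E f -> ip E v f = ip omega v f.
Proof.
move=> [_ [K [_ KE fK]]]; apply/esym/Rintegral_support => // x _ Ex.
by rewrite fK ?mulr0// => /KE.
Qed.

Lemma ipU_restrict (w F : 'rV[R]_d -> 'M[R]_(m, n)) :
  (forall i j, test_fun E (fun x => F x i j)) -> ipU E w F = ipU omega w F.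
Proof.
move=> tF; apply/esym/Rintegral_support => // x _ Ex.
apply: big1 => i _; apply: big1 => j _; have [_ [K [_ KE fK]]] := tF i j.
by rewrite fK ?mulr0// => /KE.
Qed.

(** A test field on E is a test field on omega, and both pairings live on its support, which lies in
    E. *)
Lemma weak_op_restrict v g : weak_op U A omega v g -> weak_op U A E v g.
Proof.
move=> [Lg H]; split; first exact: L2U_subset.
move=> F tF; rewrite ip_restrict; last exact: test_fun_diffop_adj tF.
by rewrite H ?ipU_restrict//; [case: tF|exact: test_field_sub].
Qed.

Lemma weak_adj_restrict w h : weak_adj A omega w h -> weak_adj A E w h.
Proof.
move=> [Lh H]; split.
  by apply: L2_subset Eo Lh; exact: open_measurable_rV.
move=> f tf; rewrite ipU_restrict; last by move=> i j; exact: test_fun_diffop.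
by rewrite H ?ip_restrict//; exact: test_fun_sub tf.
Qed.

End restriction.

(** * The strong problem *)

(** Carries completeness over to the energy seminorms induced by C. *)
Lemma complete_for_equivalent (R : realType) (V : Type) (S : set V)
    (dist dist' : V -> V -> R) (a c : R) : 0 < a -> 0 < c ->
  (forall u v, S u -> S v -> dist u v <= a * dist' u v) ->
  (forall u v, S u -> S v -> dist' u v <= c * dist u v) ->
  complete_for dist S -> complete_for dist' S.
Proof.
move=> a0 c0 le_a le_c dcompl u Su cu; have [|x Sx ux] := dcompl u Su.
  move=> e e0; have [N HN] := cu (e / a) (divr_gt0 e0 a0).
  exists N => i j Ni Nj; apply: le_lt_trans (le_a _ _ (Su i) (Su j)) _.
  by rewrite -ltr_pdivlMl// mulrC HN.
exists x => // e e0; have [N HN] := ux (e / c) (divr_gt0 e0 c0).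
exists N => i Ni; apply: le_lt_trans (le_c _ _ (Su i) Sx) _.
by rewrite -ltr_pdivlMl// mulrC HN.
Qed.

(** The Riesz representation measures distances through -u + v, the completeness statements through
    u - v. *)
Lemma nrmU_subC (R : realType) (d m n : nat) (omega : set 'rV[R]_d)
    (u v : 'rV[R]_d -> 'M[R]_(m, n)) :
  nrmU omega (fun x => -1 *: u x + v x) = nrmU omega (fun x => u x - v x).
Proof.
congr Num.sqrt; apply: eq_Rintegral => x _.
apply: eq_bigr => i _; apply: eq_bigr => j _; rewrite !mxE; ring.
Qed.

(** * Multiplication by the tensor field and its pointwise inverse *)

Section tensor_fields.
Context (R : realType) (d m n : nat).
Context (P : {linear 'M[R]_(m, n) -> 'M[R]_(m, n)}).
Hypothesis PP : forall M, P (P M) = P M.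
Hypothesis P_sym : forall M N, mxdot (P M) N = mxdot M (P N).
Local Notation U := [set M | P M = M].
Local Notation leb := (lebesgue_rV R d).
Context (Omega : set 'rV[R]_d).
Hypothesis mO : measurable Omega.
Context (C : 'rV[R]_d -> {linear 'M[R]_(m, n) -> 'M[R]_(m, n)}).
Hypothesis Cspd : spd_tensor_field U Omega C.
Implicit Types (g h w : 'rV[R]_d -> 'M[R]_(m, n)).
Local Notation Cmul g := (fun x => C x (g x)).

(** Measurability of C is given for fixed matrix arguments; expanding g in matrix units reduces to
    those by linearity. *)
Lemma measurable_tensor_mul g i j : (forall i j, measurable_fun Omega (fun x => g x i j)) ->
  measurable_fun Omega (fun x => C x (g x) i j).
Proof.
move=> mg; have [mC _ _ _] := Cspd.
have E x : C x (g x) i j = \sum_k \sum_l g x k l * C x (delta_mx k l) i j.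
  rewrite {1}(matrix_sum_delta (g x)) linear_sum summxE; apply: eq_bigr => k _.
  rewrite linear_sum summxE; apply: eq_bigr => l _.
  by rewrite linearZ mxE.
under eq_fun do rewrite E.
by apply: measurable_sum => k; apply: measurable_sum => l; exact: measurable_funM.
Qed.

Lemma tensor_mul_bounded : exists2 K, 0 < K & forall g, L2U Omega U g ->
  L2U Omega U (Cmul g) /\ nrmU Omega (Cmul g) <= K * nrmU Omega g.
Proof.
have [mC [c1 C1] _ _] := Cspd.
(* Positive whatever the sign of c1. *)
exists (`|c1| + 1); first by rewrite ltr_wpDl.
move=> g Lg; set K := `|c1| + 1.
have K0 : 0 < K by rewrite ltr_wpDl.
have [mg gi Ug] := Lg.
have mCg i j := measurable_tensor_mul i j mg.
have bd : {ae leb, forall x, Omega x ->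
    P (C x (g x)) = C x (g x) /\ mxdot (C x (g x)) (C x (g x)) <= K ^+ 2 * mxdot (g x) (g x)}.
  apply: filterS2 C1 Ug => x c1x Ugx ox; have [UC le] := c1x ox _ (Ugx ox).
  split=> //; rewrite -!mxnorm2_sqr -exprMn ler_sqr ?nnegrE ?mulr_ge0 ?mxnorm2_ge0 ?(ltW K0)//.
  apply: (le_trans le); rewrite ler_wpM2r ?mxnorm2_ge0// (le_trans (ler_norm _))//.
  by rewrite lerDl.
have mdot (v : 'rV[R]_d -> 'M[R]_(m, n)) : (forall i j, measurable_fun Omega (fun x => v x i j)) ->
    measurable_fun Omega (fun x => mxdot (v x) (v x)).
  move=> mv; apply: measurable_sum => i; apply: measurable_sum => j.
  exact: measurable_funM.
have le_int : (\int[leb]_(x in Omega) (mxdot (C x (g x)) (C x (g x)))%:E <=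
    \int[leb]_(x in Omega) (K ^+ 2 * mxdot (g x) (g x))%:E)%E.
  apply: ae_ge0_le_integral => //.
  - by move=> x _; rewrite lee_fin mxdot_ge0.
  - by apply/measurable_EFinP; exact: mdot.
  - by move=> x _; rewrite lee_fin mulr_ge0 ?sqr_ge0 ?mxdot_ge0.
  - by apply/measurable_EFinP; apply: measurable_funM => //; exact: mdot.
  - by apply: filterS bd => x h ox; rewrite lee_fin; case: (h ox).
have Ki : leb.-integrable Omega (fun x => (K ^+ 2 * mxdot (g x) (g x))%:E).
  exact: (integrableZl mO (K ^+ 2) gi).
have Ci : leb.-integrable Omega (fun x => (mxdot (C x (g x)) (C x (g x)))%:E).
  apply/integrableP; split; first by apply/measurable_EFinP; exact: mdot.
  under eq_integral do rewrite gee0_abs ?lee_fin ?mxdot_ge0//.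
  by apply: (le_lt_trans le_int); have := integrable_lty mO Ki.
split.
  by split=> //; apply: filterS bd => x h ox; case: (h ox).
rewrite -ler_sqr ?nnegrE ?mulr_ge0 ?nrmU_ge0 ?(ltW K0)// exprMn !nrmU_sqr /ipU.
rewrite -RintegralZl// /Rintegral; apply: fine_le => //.
- exact: integrable_fin_num.
- exact: integrable_fin_num.
Qed.

Lemma tensor_mul_L2U g : L2U Omega U g -> L2U Omega U (Cmul g).
Proof. by have [K _ H] := tensor_mul_bounded => /H[]. Qed.

Lemma ipU_tensor_sym g h : L2U Omega U g -> L2U Omega U h ->
  ipU Omega (Cmul g) h = ipU Omega (Cmul h) g.
Proof.
move=> [_ _ Ug] [_ _ Uh]; have [_ _ Csym _] := Cspd.
apply: ae_eq_Rintegral => //; apply: filterS3 Csym Ug Uh => x sx gx hx ox.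
by rewrite (sx ox _ _ (gx ox) (hx ox)) mxdotC.
Qed.

Lemma ipU_tensor_coercive : exists2 c, 0 < c & forall g, L2U Omega U g ->
  c * nrmU Omega g ^+ 2 <= ipU Omega (Cmul g) g.
Proof.
have [_ _ _ [c0 c00 C0]] := Cspd; exists c0 => // g Lg.
have LC := tensor_mul_L2U Lg; have [_ gi Ug] := Lg.
rewrite nrmU_sqr /ipU -RintegralZl//.
have iE (u v : 'rV[R]_d -> 'M[R]_(m, n)) : L2U Omega U u -> L2U Omega U v ->
    leb.-integrable Omega (fun x => (mxdot (u x) (v x))%:E).
  move=> Lu Lv.
  rewrite (_ : (fun x => _) = fun x => (\sum_i \sum_j (u x i j * v x i j)%:E)%E).
    apply: (integrable_sum mO) => i _; apply: (integrable_sum mO) => j _.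
    exact: (L2_integrable mO (L2U_comp mO i j Lu) (L2U_comp mO i j Lv)).
  by apply/funext => x; rewrite /mxdot /= -sumEFin; apply: eq_bigr => i _; rewrite -sumEFin.
have iC := iE _ _ LC Lg.
rewrite -subr_ge0 -RintegralB//; last exact: (integrableZl mO c0 gi).
(* Coercivity makes the integrand nonnegative only a.e.; the maximum with 0 agrees with it a.e. and
   is nonnegative everywhere. *)
rewrite (@ae_eq_Rintegral _ _ _ leb Omega _
  (fun x => Num.max 0 (mxdot (C x (g x)) (g x) - c0 * mxdot (g x) (g x))))//; last first.
  apply: filterS2 C0 Ug => x cx gx ox; rewrite max_r// subr_ge0.
  by apply: cx => //; exact: gx.
by apply: Rintegral_ge0 => x _; rewrite le_max lexx.
Qed.

(** At almost every point g(x) is an admissible preimage, so the choice is not the default value.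
    Positive definiteness, applied to the difference of the chosen preimage and g(x), forces the two
    to agree. *)
Lemma tensor_inv_ae g w : L2U Omega U g -> ae_eq leb Omega (Cmul g) w ->
  ae_eq leb Omega (fun x => tensor_inv U C x (w x)) g.
Proof.
move=> [_ _ Ug] Cgw; have [_ _ _ [c0 c00 C0]] := Cspd.
apply: filterS3 C0 Ug Cgw => x c0x Ugx Cx ox.
have [UM CM] : [set M | U M /\ C x M = w x] (tensor_inv U C x (w x)).
  by apply: xgetPex; exists (g x); split; [exact: Ugx|exact: Cx].
set M := tensor_inv U C x (w x) in UM CM *.
have UD : P (-1 *: g x + M) = -1 *: g x + M by rewrite linearP UM Ugx.
have CD0 : C x (-1 *: g x + M) = 0.
  by rewrite linearP /= CM -(Cx ox) scaleN1r addNr.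
have := c0x ox _ UD; rewrite CD0 mxdot0l => h.
have : mxdot (-1 *: g x + M) (-1 *: g x + M) = 0.
  by apply/eqP; rewrite eq_le mxdot_ge0 andbT -(pmulr_rle0 _ c00).
by move=> /mxdot_eq0; rewrite scaleN1r addrC => /eqP; rewrite subr_eq0 => /eqP.
Qed.

(* Riesz representation for the inner product [(C g, h)] produces a measurable [C^-1 w]. *)
Lemma tensor_surjective w : L2U Omega U w ->
  exists2 g, L2U Omega U g & ae_eq leb Omega (Cmul g) w.
Proof.
move=> Lw; have [c c0 Cc] := ipU_tensor_coercive; have [K K0 CK] := tensor_mul_bounded.
pose lin (a : R) (u v : 'rV[R]_d -> 'M[R]_(m, n)) := fun x => a *: u x + v x.
pose b g h := ipU Omega (Cmul g) h.
have S_lin a u v : L2U Omega U u -> L2U Omega U v -> L2U Omega U (lin a u v).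
  exact: (L2U_lin mO).
have b_sym u v : L2U Omega U u -> L2U Omega U v -> b u v = b v u by exact: ipU_tensor_sym.
have b_lin a u v h : L2U Omega U u -> L2U Omega U v -> L2U Omega U h ->
    b (lin a u v) h = a * b u h + b v h.
  move=> Lu Lv Lh; rewrite /b -(ipU_lin mO a (tensor_mul_L2U Lu) (tensor_mul_L2U Lv) Lh).
  by congr ipU; apply/funext => x; rewrite /lin linearP.
have b_ge0 u : L2U Omega U u -> 0 <= b u u.
  by move=> Lu; apply: le_trans (Cc _ Lu); rewrite mulr_ge0 ?sqr_ge0 ?ltW.
have low u : L2U Omega U u -> nrmU Omega u <= (Num.sqrt c)^-1 * snorm b u.
  move=> Lu; rewrite ler_pdivlMl ?sqrtr_gt0//.
  rewrite -ler_sqr ?nnegrE ?mulr_ge0 ?sqrtr_ge0//.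
  by rewrite (snorm_sqr b_ge0 Lu) exprMn sqr_sqrtr ?(ltW c0)// Cc.
have up u : L2U Omega U u -> snorm b u <= Num.sqrt K * nrmU Omega u.
  move=> Lu; rewrite -ler_sqr ?nnegrE ?mulr_ge0 ?sqrtr_ge0//.
  rewrite (snorm_sqr b_ge0 Lu) exprMn sqr_sqrtr ?(ltW K0)// expr2 mulrA.
  have [LC le] := CK _ Lu.
  apply: (le_trans (ler_norm _)); apply: (le_trans (ipU_le_nrmU mO LC Lu)).
  by rewrite ler_wpM2r ?nrmU_ge0.
have [] := @riesz_representation R _ lin (L2U Omega U) b S_lin b_sym b_lin b_ge0
  (ipU Omega w) (nrmU Omega w * (Num.sqrt c)^-1) (fun=> 0) (@L2U_0 _ _ _ _ _ mO P).
- move=> a u v Lu Lv; rewrite ipU_sym (ipU_lin mO _ Lu Lv Lw).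
  by rewrite ipU_sym [ipU _ v _]ipU_sym.
- move=> v Lv; apply: (le_trans (ipU_le_nrmU mO Lw Lv)).
  by rewrite -mulrA ler_wpM2l ?nrmU_ge0 ?low.
- apply: (complete_for_equivalent (a := (Num.sqrt c)^-1) (c := Num.sqrt K))
    (L2U_complete mO PP P_sym).
  + by rewrite invr_gt0 sqrtr_gt0.
  + by rewrite sqrtr_gt0.
  + by move=> u v Lu Lv; rewrite -nrmU_subC; apply: low; exact: S_lin.
  + by move=> u v Lu Lv; rewrite -nrmU_subC; apply: up; exact: S_lin.
move=> g Lg gw; exists g => //; have LC := tensor_mul_L2U Lg.
apply: (nrmUB_ae mO LC Lw); apply/eqP; rewrite -sqrf_eq0 nrmU_sqr.
have LD := L2U_lin mO (-1) Lw LC.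
rewrite (_ : (fun x => _) = fun x => -1 *: w x + C x (g x)); last first.
  by apply/funext => x; rewrite scaleN1r addrC.
by rewrite (ipU_lin mO _ Lw LC LD) -[ipU _ (Cmul g) _]/(b g _) gw// mulN1r addNr.
Qed.

End tensor_fields.

(** * Passing to the limit in L2 pairings *)

Section limits.
Context (R : realType) (d m n : nat).
Context (P : {linear 'M[R]_(m, n) -> 'M[R]_(m, n)}).
Local Notation U := [set M | P M = M].
Context (omega : set 'rV[R]_d).
Hypothesis mo : measurable omega.

Lemma converges_ip (u_ : nat -> 'rV[R]_d -> R) u p :
  (forall i, L2 omega (u_ i)) -> L2 omega u -> L2 omega p ->
  converges_for (fun u v : 'rV[R]_d -> R => nrm omega (fun x => u x - v x)) u_ u ->
  forall e, 0 < e -> exists N, forall i, (N <= i)%N -> `|ip omega (u_ i) p - ip omega u p| < e.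
Proof.
move=> Lu_ Lu Lp cu e e0.
have p1 : 0 < nrm omega p + 1 by rewrite ltr_wpDl ?nrm_ge0.
have [N HN] := cu _ (divr_gt0 e0 p1); exists N => i Ni.
have -> : ip omega (u_ i) p - ip omega u p = ip omega (fun x => u_ i x - u x) p.
  rewrite (_ : (fun x => u_ i x - u x) = fun x => -1 * u x + u_ i x).
    by rewrite ip_lin// mulN1r addrC.
  by apply/funext => x; rewrite mulN1r addrC.
apply: le_lt_trans (ip_le_nrm mo (L2_sub mo (Lu_ i) Lu) Lp) _.
apply: (@le_lt_trans _ _ (nrm omega (fun x => u_ i x - u x) * (nrm omega p + 1))).
  by rewrite ler_wpM2l ?nrm_ge0// lerDl.
by rewrite -ltr_pdivlMr// HN.
Qed.

Lemma converges_ipU (g_ : nat -> 'rV[R]_d -> 'M[R]_(m, n)) g q :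
  (forall i, L2U omega U (g_ i)) -> L2U omega U g -> L2U omega U q ->
  converges_for (fun g h : 'rV[R]_d -> 'M[R]_(m, n) => nrmU omega (fun x => g x - h x)) g_ g ->
  forall e, 0 < e -> exists N, forall i, (N <= i)%N ->
    `|ipU omega (g_ i) q - ipU omega g q| < e.
Proof.
move=> Lg_ Lg Lq cg e e0.
have q1 : 0 < nrmU omega q + 1 by rewrite ltr_wpDl ?nrmU_ge0.
have [N HN] := cg _ (divr_gt0 e0 q1); exists N => i Ni.
have -> : ipU omega (g_ i) q - ipU omega g q = ipU omega (fun x => g_ i x - g x) q.
  rewrite (_ : (fun x => g_ i x - g x) = fun x => -1 *: g x + g_ i x).
    by rewrite (ipU_lin mo _ Lg (Lg_ i) Lq) mulN1r addrC.
  by apply/funext => x; rewrite scaleN1r addrC.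
apply: le_lt_trans (ipU_le_nrmU mo (L2U_sub mo (Lg_ i) Lg) Lq) _.
apply: (@le_lt_trans _ _ (nrmU omega (fun x => g_ i x - g x) * (nrmU omega q + 1))).
  by rewrite ler_wpM2l ?nrmU_ge0// lerDl.
by rewrite -ltr_pdivlMr// HN.
Qed.

Lemma ip_ipU_limit (u_ : nat -> 'rV[R]_d -> R) u p
    (g_ : nat -> 'rV[R]_d -> 'M[R]_(m, n)) g q :
  (forall i, L2 omega (u_ i)) -> L2 omega u -> L2 omega p ->
  (forall i, L2U omega U (g_ i)) -> L2U omega U g -> L2U omega U q ->
  converges_for (fun u v : 'rV[R]_d -> R => nrm omega (fun x => u x - v x)) u_ u ->
  converges_for (fun g h : 'rV[R]_d -> 'M[R]_(m, n) => nrmU omega (fun x => g x - h x)) g_ g ->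
  (forall i, ip omega (u_ i) p = ipU omega (g_ i) q) ->
  ip omega u p = ipU omega g q.
Proof.
move=> Lu_ Lu Lp Lg_ Lg Lq cu cg E; apply/eqP; rewrite -subr_eq0 -normr_le0.
apply/ler_addgt0Pl => e e0; rewrite addr0.
have e2 : 0 < e / 2 by rewrite divr_gt0.
have [N1 H1] := converges_ip Lu_ Lu Lp cu e2.
have [N2 H2] := converges_ipU Lg_ Lg Lq cg e2.
have := H1 _ (leq_maxl N1 N2); have := H2 _ (leq_maxr N1 N2); rewrite E.
move: (ip omega u p) (ipU omega g q) (ipU omega (g_ _) q) => a b c h2 h1.
have -> : a - b = (c - b) - (c - a) by ring.
apply: le_trans (ler_normB _ _) _; apply: ltW.
by rewrite [ltRHS](splitr e); exact: ltrD.
Qed.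

End limits.

(** * Energy solution and a priori bound *)

Section strong_problem.
Context (R : realType) (d k m n : nat).
Context (P : {linear 'M[R]_(m, n) -> 'M[R]_(m, n)}).
Hypothesis PP : forall M, P (P M) = P M.
Hypothesis P_sym : forall M N, mxdot (P M) N = mxdot M (P N).
Local Notation U := [set M | P M = M].
Context (A : diffop R d k m n).
Hypothesis AU : forall a, U (A a).
Local Notation leb := (lebesgue_rV R d).
Context (Omega : set 'rV[R]_d).
Hypothesis oO : open Omega.
Let mO : measurable Omega. Proof. exact: open_measurable_rV. Qed.
Context (C : 'rV[R]_d -> {linear 'M[R]_(m, n) -> 'M[R]_(m, n)}).
Hypothesis Cspd : spd_tensor_field U Omega C.
Context (C_PF : R).
Hypothesis C_PF_gt0 : 0 < C_PF.
Hypothesis poincare : forall v, H0A U A Omega v ->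
  nrm Omega v <= C_PF * nrmU Omega (opA U A Omega v).
Implicit Types (u v f : 'rV[R]_d -> R) (g w : 'rV[R]_d -> 'M[R]_(m, n)).
Local Notation Av v := (opA U A Omega v).
Local Notation Asw w := (opAs A Omega w).
Local Notation H0 := (H0A U A Omega).
Local Notation lin := (fun (a : R) (u v : 'rV[R]_d -> R) => (fun x => a * u x + v x)).

Lemma nrmU_opA_sub u v : HA U A Omega u -> HA U A Omega v ->
  nrmU Omega (Av (lin (-1) u v)) = nrmU Omega (fun x => Av u x - Av v x).
Proof.
move=> Hu Hv; rewrite -nrmU_subC.
exact: (nrmU_ae (opA_lin PP P_sym oO (-1) Hu Hv).2).
Qed.

Lemma nrm_subC u v : nrm Omega (lin (-1) u v) = nrm Omega (fun x => u x - v x).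
Proof. by congr Num.sqrt; apply: eq_Rintegral => x _; ring. Qed.

(** By the Poincare inequality, u_i is Cauchy in L2 as soon as A u_i is. The weak identity for A and
    the vanishing of the trace are both equalities of L2 pairings, so they pass to the limit pair
    (u, g). *)
Lemma H0A_complete :
  complete_for (fun u v => nrmU Omega (fun x => Av u x - Av v x)) H0.
Proof.
move=> u_ Hu_ cu.
have HAu i : HA U A Omega (u_ i) by exact: H0A_HA.
have Lu i : L2 Omega (u_ i) by exact: HA_L2.
have LAu i : L2U Omega U (Av (u_ i)) by exact: opA_L2U.
have [g Lg cg] := L2U_complete mO PP P_sym LAu cu.
have [|u Lim_u cvu] := L2_complete mO Lu.
  move=> e e0; have [N HN] := cu _ (divr_gt0 e0 C_PF_gt0).
  exists N => i j Ni Nj; rewrite -nrm_subC.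
  apply: le_lt_trans (poincare (H0A_lin PP P_sym oO (-1) (Hu_ i) (Hu_ j))) _.
  by rewrite nrmU_opA_sub// -ltr_pdivlMl// mulrC HN.
have lim p q : L2 Omega p -> L2U Omega U q ->
    (forall i, ip Omega (u_ i) p = ipU Omega (Av (u_ i)) q) ->
    ip Omega u p = ipU Omega g q.
  by move=> Lp Lq; exact: (ip_ipU_limit mO Lu Lim_u Lp LAu Lg Lq cvu cg).
have [Hu ae] : HA U A Omega u /\ ae_eq leb Omega (Av u) g.
  apply: (weak_op_HA PP P_sym oO Lim_u); split=> // F tF.
  apply: lim; [exact: (test_fun_L2 mO (test_fun_diffop_adj A tF))|exact: test_field_L2U|].
  by move=> i; have [_ ->] := opA_weak (HAu i).
exists u.
  apply/H0AP; split=> // w hw; rewrite (ipU_ae ae (ae_eq_refl _ _ w)).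
  apply: esym; apply: lim; [exact: (opAs_L2 hw)|exact: (HAs_L2U hw)|].
  by move=> i; have /H0AP[_ H] := Hu_ i; rewrite H.
move=> e e0; have [N HN] := cg e e0; exists N => i Ni.
rewrite (@nrmU_ae _ _ _ _ _ _ (fun x => Av (u_ i) x - g x)) ?HN//.
by apply: filterS ae => x h ox; rewrite h.
Qed.

Lemma energy_solution f : L2 Omega f ->
  exists2 u, H0 u & forall v, H0 v -> ipU Omega (fun x => C x (Av u x)) (Av v) = ip Omega f v.
Proof.
move=> Lf; have [c c0 Cc] := ipU_tensor_coercive mO Cspd.
have [K K0 CK] := tensor_mul_bounded mO Cspd.
pose b u v := ipU Omega (fun x => C x (Av u x)) (Av v).
have LA v : H0 v -> L2U Omega U (Av v) by move=> /H0A_HA; exact: opA_L2U.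
have LCA v : H0 v -> L2U Omega U (fun x => C x (Av v x)).
  by move=> /LA; exact: (tensor_mul_L2U mO Cspd).
have L2H v : H0 v -> L2 Omega v by move=> /H0A_HA; exact: HA_L2.
have S_lin a u v : H0 u -> H0 v -> H0 (lin a u v) by exact: H0A_lin.
have b_sym u v : H0 u -> H0 v -> b u v = b v u.
  by move=> Hu Hv; apply: (ipU_tensor_sym Cspd); exact: LA.
have b_lin a u v (z : 'rV[R]_d -> R) : H0 u -> H0 v -> H0 z ->
    b (lin a u v) z = a * b u z + b v z.
  move=> Hu Hv Hz; rewrite /b -(ipU_lin mO a (LCA _ Hu) (LCA _ Hv) (LA _ Hz)).
  apply: ipU_ae; last exact: ae_eq_refl.
  have [_] := opA_lin PP P_sym oO a (H0A_HA Hu) (H0A_HA Hv).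
  by apply: filterS => x h ox; rewrite h// linearP.
have b_ge0 u : H0 u -> 0 <= b u u.
  by move=> Hu; apply: le_trans (Cc _ (LA _ Hu)); rewrite mulr_ge0 ?sqr_ge0 ?ltW.
have low u : H0 u -> nrmU Omega (Av u) <= (Num.sqrt c)^-1 * snorm b u.
  move=> Hu; rewrite ler_pdivlMl ?sqrtr_gt0//.
  rewrite -ler_sqr ?nnegrE ?mulr_ge0 ?sqrtr_ge0//.
  by rewrite (snorm_sqr b_ge0 Hu) exprMn sqr_sqrtr ?(ltW c0)// Cc//; exact: LA.
have up u : H0 u -> snorm b u <= Num.sqrt K * nrmU Omega (Av u).
  move=> Hu; rewrite -ler_sqr ?nnegrE ?mulr_ge0 ?sqrtr_ge0//.
  rewrite (snorm_sqr b_ge0 Hu) exprMn sqr_sqrtr ?(ltW K0)// expr2 mulrA.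
  have [LC le] := CK _ (LA _ Hu).
  apply: (le_trans (ler_norm _)); apply: (le_trans (ipU_le_nrmU mO LC (LA _ Hu))).
  by rewrite ler_wpM2r ?nrmU_ge0.
have H00 : H0 (fun=> 0).
  exact: (test_fun_H0A PP P_sym AU oO (@test_fun_0 R d Omega)).1.
have [] := @riesz_representation R _ (fun a u v => lin a u v) H0 b S_lin b_sym b_lin b_ge0
  (ip Omega f) (nrm Omega f * (C_PF * (Num.sqrt c)^-1)) (fun=> 0) H00.
- move=> a u v Hu Hv; rewrite ip_sym (ip_lin mO _ (L2H _ Hu) (L2H _ Hv) Lf).
  by rewrite ip_sym [ip _ v _]ip_sym.
(* The Poincare inequality and coercivity bound |(f, v)| by ||f|| C_PF / sqrt(c) times the energy
   seminorm of v. *)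
- move=> v Hv; apply: (le_trans (ip_le_nrm mO Lf (L2H _ Hv))).
  rewrite -mulrA ler_wpM2l ?nrm_ge0//; apply: (le_trans (poincare Hv)).
  by rewrite -mulrA ler_wpM2l ?(ltW C_PF_gt0) ?low.
- apply: (complete_for_equivalent (a := (Num.sqrt c)^-1) (c := Num.sqrt K)) H0A_complete.
  + by rewrite invr_gt0 sqrtr_gt0.
  + by rewrite sqrtr_gt0.
  + move=> u v Hu Hv; rewrite -nrmU_opA_sub; [|exact: H0A_HA..].
    by apply: low; exact: S_lin.
  + move=> u v Hu Hv; rewrite -nrmU_opA_sub; [|exact: H0A_HA..].
    by apply: up; exact: S_lin.
by move=> u Hu uE; exists u.
Qed.

Definition strong_solution f u w :=
  [/\ H0 u, HAs U A Omega w, ae_eq leb Omega w (fun x => C x (Av u x)) &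
      ae_eq leb Omega (Asw w) f].

(** The energy identity, tested with smooth compactly supported functions only, is the
    distributional equation for the flux C A u. *)
Lemma strong_solution_exists f : L2 Omega f -> exists u w, strong_solution f u w.
Proof.
move=> Lf; have [u Hu uE] := energy_solution Lf.
have LA : L2U Omega U (Av u) by apply: opA_L2U; exact: H0A_HA.
have LC := tensor_mul_L2U mO Cspd LA.
exists u, (fun x => C x (Av u x)).
have CAf : weak_adj A Omega (fun x => C x (Av u x)) f.
  split=> // h th; have [Hh ae] := test_fun_H0A PP P_sym AU oO th.
  by rewrite -(uE _ Hh); apply: ipU_ae; [exact: ae_eq_refl|exact: ae_eq_sym].
by have [Hw wf] := weak_adj_HAs oO LC CAf; split=> //; exact: ae_eq_refl.
Qed.

Lemma strong_solution_sub f1 u1 w1 f2 u2 w2 :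
  strong_solution f1 u1 w1 -> strong_solution f2 u2 w2 ->
  strong_solution (fun x => f1 x - f2 x) (fun x => u1 x - u2 x) (fun x => w1 x - w2 x).
Proof.
move=> [Hu1 Hw1 wu1 wf1] [Hu2 Hw2 wu2 wf2].
have -> : (fun x => u1 x - u2 x) = lin (-1) u2 u1.
  by apply/funext => x; rewrite mulN1r addrC.
have -> : (fun x => w1 x - w2 x) = fun x => -1 *: w2 x + w1 x.
  by apply/funext => x; rewrite scaleN1r addrC.
have [Hu uae] := opA_lin PP P_sym oO (-1) (H0A_HA Hu2) (H0A_HA Hu1).
have [Hw wae] := opAs_lin AU oO (-1) Hw2 Hw1.
split=> //; first exact: H0A_lin.
- apply: filterS3 uae wu1 wu2 => x h1 h2 h3 ox.
  by rewrite h1// h2// h3// linearP.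
- apply: filterS3 wae wf1 wf2 => x h1 h2 h3 ox.
  by rewrite h1// h2// h3// mulN1r addrC.
Qed.

(** With a = ||A u||: c a^2 <= (w, A u) = (f, u) <= ||f|| C_PF a, hence a <= (C_PF / c) ||f||. All
    other norms are controlled by a and ||f||. *)
Lemma strong_solution_bound : exists2 c, 0 < c & forall f u w, L2 Omega f ->
  strong_solution f u w ->
  nrm Omega u + nrmU Omega w + nrmA U A Omega u + nrmAs A Omega w <= c * nrm Omega f.
Proof.
have [c c0 Cc] := ipU_tensor_coercive mO Cspd.
have [K K0 CK] := tensor_mul_bounded mO Cspd.
(* ||u|| <= C_PF a and ||w|| <= K a each occur twice, once inside a graph norm; these norms add a
   further a and ||f||. *)
exists ((2 * C_PF + 2 * K + 1) * (C_PF / c) + 1).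
  by rewrite ltr_wpDl// mulr_ge0 ?divr_ge0 ?addr_ge0 ?mulr_ge0 ?ltW.
move=> f u w Lf [Hu Hw wu wf].
have HAu := H0A_HA Hu; have Lu := HA_L2 HAu; have LA := opA_L2U HAu.
have [LC bC] := CK _ LA; have pu := poincare Hu.
set a := nrmU Omega (Av u) in bC pu *.
have a0 : 0 <= a by exact: nrmU_ge0.
have aE : a <= C_PF / c * nrm Omega f.
  have : c * a ^+ 2 <= nrm Omega f * (C_PF * a).
    apply: (le_trans (Cc _ LA)).
    have /H0AP[_ /(_ _ Hw) E] := Hu.
    have -> : ipU Omega (fun x => C x (Av u x)) (Av u) = ip Omega f u.
      rewrite (ipU_ae (ae_eq_sym wu) (ae_eq_refl _ _ (Av u))) ipU_sym E ip_sym.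
      by apply: (ip_ae wf); exact: ae_eq_refl.
    apply: (le_trans (ler_norm _)); apply: (le_trans (ip_le_nrm mO Lf Lu)).
    by rewrite ler_wpM2l ?nrm_ge0.
  (* One factor a is cancelled below; for a = 0 the claim is immediate. *)
  have [a0'|an0] := eqVneq a 0.
    move=> _; rewrite a0'; apply: mulr_ge0; last exact: nrm_ge0.
    by apply: divr_ge0; exact: ltW.
  have ap : 0 < a by rewrite lt0r an0.
  rewrite expr2 !mulrA (ler_pM2r ap) => h.
  by rewrite mulrAC ler_pdivlMr// mulrC [leRHS]mulrC.
have f0 : 0 <= nrm Omega f by exact: nrm_ge0.
have sqrtD (x y : R) : 0 <= x -> 0 <= y -> Num.sqrt (x ^+ 2 + y ^+ 2) <= x + y.
  move=> x0 y0; rewrite -[X in _ <= X](ger0_norm (addr_ge0 x0 y0)) -sqrtr_sqr ler_sqrt ?sqr_ge0//.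
  by have := mulr_ge0 x0 y0; nra.
have bA : nrmA U A Omega u <= nrm Omega u + a.
  by apply: sqrtD; [exact: nrm_ge0|exact: nrmU_ge0].
have bAs : nrmAs A Omega w <= nrmU Omega w + nrm Omega f.
  rewrite -(nrm_ae wf); apply: sqrtD; [exact: nrmU_ge0|exact: nrm_ge0].
rewrite (nrmU_ae wu) in bAs *.
have : 2 * (nrm Omega u) + 2 * nrmU Omega (fun x => C x (Av u x)) + a + nrm Omega f <=
    (2 * C_PF + 2 * K + 1) * a + nrm Omega f by lra.
have : (2 * C_PF + 2 * K + 1) * a <= (2 * C_PF + 2 * K + 1) * (C_PF / c * nrm Omega f).
  by rewrite ler_wpM2l// !addr_ge0 ?mulr_ge0 ?ltW.
move=> h2 h1; rewrite mulrDl mul1r -mulrA.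
by apply: le_trans (lerD h2 (lexx _)); apply: le_trans h1; lra.
Qed.

End strong_problem.

(** * The ultraweak problem *)

Section mesh_problem.
Context (R : realType) (d k m n : nat).
Context (P : {linear 'M[R]_(m, n) -> 'M[R]_(m, n)}).
Hypothesis PP : forall M, P (P M) = P M.
Hypothesis P_sym : forall M N, mxdot (P M) N = mxdot M (P N).
Local Notation U := [set M | P M = M].
Context (A : diffop R d k m n).
Hypothesis AU : forall a, U (A a).
Local Notation leb := (lebesgue_rV R d).
Context (Omega : set 'rV[R]_d).
Hypothesis oO : open Omega.
Let mO : measurable Omega. Proof. exact: open_measurable_rV. Qed.
Context (C : 'rV[R]_d -> {linear 'M[R]_(m, n) -> 'M[R]_(m, n)}).
Hypothesis Cspd : spd_tensor_field U Omega C.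
Context (I : finType) (T : I -> set 'rV[R]_d).
Hypothesis meshT : regular_mesh Omega T.
Context (Ht : set ('rV[R]_d -> R)) (Hts : set ('rV[R]_d -> 'M[R]_(m, n))).
Hypothesis Ht_mesh : Ht `<=` HA_mesh U A Omega T.
Hypothesis H0_Ht : H0A U A Omega `<=` Ht.
Hypothesis Hts_mesh : Hts `<=` HAs_mesh U A Omega T.
Hypothesis HAs_Hts : HAs U A Omega `<=` Hts.
Implicit Types (u v f : 'rV[R]_d -> R) (g w : 'rV[R]_d -> 'M[R]_(m, n)).
Local Notation Av v := (opA U A Omega v).
Local Notation Asw w := (opAs A Omega w).
Local Notation trA := (trace_A U A Omega T (Hts := Hts)).
Local Notation trAs := (trace_As U A Omega T (Ht := Ht)).

Let oT i : open (T i). Proof. exact: (@mesh_open _ _ _ _ _ meshT i). Qed.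
Let mT i : measurable (T i). Proof. exact: open_measurable_rV. Qed.
Let TO i : T i `<=` Omega. Proof. by move=> x; exact: (mesh_sub meshT). Qed.

(** On each element the local representative of the adjoint agrees a.e. with the restriction of the
    global one, by uniqueness of weak adjoints; the element integrals then add up to the integral
    over Omega. *)
Lemma ipAs_mesh_HAs v w : L2 Omega v -> HAs U A Omega w ->
  ipAs_mesh A T v w = ip Omega v (Asw w).
Proof.
move=> Lv Hw; rewrite -(ip_mesh oO meshT Lv (opAs_L2 Hw)); apply: eq_bigr => i _.
apply: ip_ae; first exact: ae_eq_refl.
have wadj := weak_adj_restrict oO (@oT i) (@TO i) (opAs_weak Hw).
by have [] := weak_adj_HAs (@oT i) (L2U_subset oO (@oT i) (@TO i) (HAs_L2U Hw)) wadj.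
Qed.

Lemma ipA_mesh_HA w v : L2U Omega U w -> HA U A Omega v ->
  ipA_mesh U A T w v = ipU Omega w (Av v).
Proof.
move=> Lw Hv; rewrite -(ipU_mesh oO meshT Lw (opA_L2U Hv)); apply: eq_bigr => i _.
apply: ipU_ae; first exact: ae_eq_refl.
have vop := weak_op_restrict oO (@oT i) (@TO i) (opA_weak Hv).
have Lv : L2 (T i) v := L2_subset mO (mT i) (@TO i) (HA_L2 Hv).
by have [] := weak_op_HA PP P_sym (@oT i) Lv vop.
Qed.

Lemma Hts_L2U (dw : Hts) : L2U Omega U (val dw).
Proof. by have [] := Hts_mesh (set_mem (valP dw)). Qed.

Lemma Hts_opAs_L2 (dw : Hts) i : L2 (T i) (opAs A (T i) (val dw)).
Proof.
have [L H] := Hts_mesh (set_mem (valP dw)).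
by apply: (@opAs_L2 _ _ _ _ _ P); split; [exact: (L2U_subset oO (@oT i) (@TO i) L)|exact: H].
Qed.

Lemma Ht_L2 (du : Ht) : L2 Omega (val du).
Proof. by have [] := Ht_mesh (set_mem (valP du)). Qed.

Lemma Ht_opA_L2U (du : Ht) i : L2U (T i) U (opA U A (T i) (val du)).
Proof.
have [L H] := Ht_mesh (set_mem (valP du)).
by apply: opA_L2U; split; [exact: (L2_subset mO (mT i) (@TO i) L)|exact: H].
Qed.

Let combE (a x y z t : R) : a * x + y - (a * z + t) = a * (x - z) + (y - t).
Proof. by rewrite mulrBr opprD addrACA. Qed.

(** Makes the difference of two trace functionals the trace of the difference, so that the stability
    estimate reduces to the a priori bound. *)
Lemma trace_A_lin a u v : HA U A Omega u -> HA U A Omega v ->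
  trA (fun x => a * u x + v x) = fun dw => a * trA u dw + trA v dw.
Proof.
move=> Hu Hv; apply/funext => dw; rewrite /trace_A /ipAs_mesh.
rewrite (ipU_ae (opA_lin PP P_sym oO a Hu Hv).2 (ae_eq_refl _ _ (val dw))).
rewrite (ipU_lin mO a (opA_L2U Hu) (opA_L2U Hv) (Hts_L2U dw)).
have -> : \sum_i ip (T i) (fun x => a * u x + v x) (opAs A (T i) (val dw)) =
    a * (\sum_i ip (T i) u (opAs A (T i) (val dw))) + \sum_i ip (T i) v (opAs A (T i) (val dw)).
  rewrite mulr_sumr -big_split; apply: eq_bigr => i _.
  by apply: (ip_lin (mT i) a _ _ (Hts_opAs_L2 dw i));
    [exact: L2_subset (HA_L2 Hu)|exact: L2_subset (HA_L2 Hv)].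
by rewrite combE.
Qed.

Lemma trace_As_lin a (g w : 'rV[R]_d -> 'M[R]_(m, n)) : HAs U A Omega g -> HAs U A Omega w ->
  trAs (fun x => a *: g x + w x) = fun du => a * trAs g du + trAs w du.
Proof.
move=> Hg Hw; apply/funext => du; rewrite /trace_As /ipA_mesh.
rewrite (ip_ae (opAs_lin AU oO a Hg Hw).2 (ae_eq_refl _ _ (val du))).
rewrite (ip_lin mO a (opAs_L2 Hg) (opAs_L2 Hw) (Ht_L2 du)).
have -> : \sum_i ipU (T i) (fun x => a *: g x + w x) (opA U A (T i) (val du)) =
    a * (\sum_i ipU (T i) g (opA U A (T i) (val du))) + \sum_i ipU (T i) w (opA U A (T i) (val du)).
  rewrite mulr_sumr -big_split; apply: eq_bigr => i _.
  exact: (ipU_lin (mT i) a (L2U_subset oO (@oT i) (@TO i) (HAs_L2U Hg))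
    (L2U_subset oO (@oT i) (@TO i) (HAs_L2U Hw)) (Ht_opA_L2U du i)).
exact: combE.
Qed.

(** Although u is unique only a.e., the functional phi is unique as a function. *)
Lemma trace_A_ae u v : ae_eq leb Omega u v -> trA u = trA v.
Proof.
move=> uv; apply/funext => dw; rewrite /trace_A /ipAs_mesh (opA_ae _ _ uv); congr (_ - _).
apply: eq_bigr => i _; apply: ip_ae; last exact: ae_eq_refl.
exact: ae_eq_subset uv.
Qed.

Lemma trace_As_ae (g w : 'rV[R]_d -> 'M[R]_(m, n)) : ae_eq leb Omega g w -> trAs g = trAs w.
Proof.
move=> gw; apply/funext => du; rewrite /trace_As /ipA_mesh (opAs_ae _ gw); congr (_ - _).
apply: eq_bigr => i _; apply: ipU_ae; last exact: ae_eq_refl.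
exact: ae_eq_subset gw.
Qed.

Lemma trace_A_H0A v (dw : Hts) : H0A U A Omega v -> HAs U A Omega (val dw) -> trA v dw = 0.
Proof.
move=> /H0AP[Hv H] Hw; rewrite /trace_A (ipAs_mesh_HAs (HA_L2 Hv) Hw).
by rewrite (H _ Hw) subrr.
Qed.

Lemma trace_As_H0A w (du : Ht) : HAs U A Omega w -> H0A U A Omega (val du) -> trAs w du = 0.
Proof.
move=> Hw /H0AP[Hv H]; rewrite /trace_As (ipA_mesh_HA (HAs_L2U Hw) Hv).
by rewrite ipU_sym (H _ Hw) ip_sym subrr.
Qed.

Lemma nrmA_skel_le v : HA U A Omega v ->
  nrmA_skel U A Omega T (trA v) <= nrmA U A Omega v.
Proof.
move=> Hv; apply: ge_inf; last by exists v.
by exists 0 => _ [u _ <-]; exact: sqrtr_ge0.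
Qed.

Lemma nrmAs_skel_le w : HAs U A Omega w ->
  nrmAs_skel U A Omega T (trAs w) <= nrmAs A Omega w.
Proof.
move=> Hw; apply: ge_inf; last by exists w.
by exists 0 => _ [g _ <-]; exact: sqrtr_ge0.
Qed.

Lemma ultraweak_solutionP f u w phi psi : L2 Omega f ->
  ultraweak_solution U A Omega T C f u w phi psi <->
  [/\ strong_solution P A Omega C f u w, phi = trA u & psi = trAs w].
Proof.
move=> Lf; split.
- move=> [Lu Lw [u0 Hu0 <-] [w0 Hw0 <-] [eq1 eq2]].
  (* The square-integrable g replaces the pointwise inverse of C at w in every integral. *)
  have [g Lg gw] := tensor_surjective PP P_sym mO Cspd Lw.
  have inv_g := tensor_inv_ae Cspd Lg gw.
  have E1 dw : HAs U A Omega dw -> ipU Omega g dw = ip Omega u (Asw dw).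
    move=> Hdw; pose dw' : Hts := exist _ dw (mem_set (HAs_Hts Hdw)).
    have E : ipU Omega (fun x => tensor_inv U C x (w x)) dw - ipAs_mesh A T u dw
      - trA u0 dw' = 0 by exact: (eq1 dw').
    move: E; rewrite (@trace_A_H0A u0 dw' Hu0 Hdw) subr0 (ipAs_mesh_HAs Lu Hdw).
    rewrite (ipU_ae inv_g (ae_eq_refl _ _ dw)).
    by move=> /eqP; rewrite subr_eq0 => /eqP.
  have [Hu Aug] : HA U A Omega u /\ ae_eq leb Omega (Av u) g.
    apply: (weak_op_HA PP P_sym oO Lu); split=> // F tF.
    have [HF FA] := test_field_HAs A oO tF.
    by rewrite E1//; apply: ip_ae; [exact: ae_eq_refl|exact: ae_eq_sym].
  have Hu' : H0A U A Omega u.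
    apply/H0AP; split=> // dw Hdw.
    by rewrite (ipU_ae Aug (ae_eq_refl _ _ dw)) E1.
  have E2 du : H0A U A Omega du -> ipU Omega w (Av du) = ip Omega f du.
    move=> Hdu; pose du' : Ht := exist _ du (mem_set (H0_Ht Hdu)).
    have E : - ipA_mesh U A T w du - trAs w0 du' = - ip Omega f du by exact: (eq2 du').
    move: E; rewrite (@trace_As_H0A w0 du' Hw0 Hdu) subr0 (ipA_mesh_HA Lw (H0A_HA Hdu)).
    exact: oppr_inj.
  have [Hw wf] : HAs U A Omega w /\ ae_eq leb Omega (Asw w) f.
    apply: (weak_adj_HAs oO Lw); split=> // h th.
    have [Hh ae] := test_fun_H0A PP P_sym AU oO th.
    by rewrite -E2//; apply: ipU_ae; [exact: ae_eq_refl|exact: ae_eq_sym].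
  split.
  + split=> //; apply: filterS2 Aug gw => x h1 h2 ox; by rewrite h1// h2.
  + apply/funext => dw; have := eq1 dw.
    have -> : ipU Omega (fun x => tensor_inv U C x (w x)) (val dw) = ipU Omega (Av u) (val dw).
      apply: (ipU_ae _ (ae_eq_refl _ _ (val dw))).
      by apply: filterS2 Aug inv_g => x h1 h2 ox; rewrite h1// h2.
    by move=> /eqP; rewrite subr_eq0 => /eqP <-.
  + apply/funext => du; have E : - ipA_mesh U A T w (val du) - trAs w0 du = - ip Omega f (val du).
      exact: (eq2 du).
    have -> : trAs w du = ip Omega f (val du) - ipA_mesh U A T w (val du).
      by rewrite /trace_As (ip_ae wf (ae_eq_refl _ _ (val du))).
    by rewrite -[ip _ _ _]opprK -E opprB opprK addrK.
- move=> [[Hu Hw wu wf] -> ->].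
  have HAu := H0A_HA Hu.
  have inv_u := tensor_inv_ae Cspd (opA_L2U HAu) (ae_eq_sym wu).
  split.
  + exact: (HA_L2 HAu).
  + exact: (HAs_L2U Hw).
  + by exists u.
  + by exists w.
  + split=> [dw|du].
      (* Once C^-1 w is replaced by A u, the first two terms are by definition the trace of u. *)
      rewrite (ipU_ae inv_u (ae_eq_refl _ _ (val dw))).
      by rewrite subrr.
    rewrite /trace_As (ip_ae wf (ae_eq_refl _ _ (val du))).
    by rewrite opprB addrA addNr add0r.
Qed.

End mesh_problem.

Lemma mxdot_tr (R : realType) m n (M N : 'M[R]_(m, n)) : mxdot M^T N^T = mxdot M N.
Proof.
rewrite /mxdot exchange_big; apply: eq_bigr => i _; apply: eq_bigr => j _.
by rewrite !mxE.
Qed.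

(* Describing U as the fixed points of an orthogonal projection [P] covers the
   four cases at once. *)
Lemma value_space_projection (R : realType) d kind :
  exists P : {linear 'M[R]_(value_rows d kind, value_cols d kind) ->
                     'M[R]_(value_rows d kind, value_cols d kind)},
  [/\ value_space R d kind = [set M | P M = M], forall M, P (P M) = P M &
      forall M N, mxdot (P M) N = mxdot M (P N)].
Proof.
case: kind; try by exists idfun; split => //; apply/seteqP; split.
(* Symmetrization, the average of M and its transpose; in the other cases U is the whole space and
   the identity serves. *)
exists (2^-1 \*: (idfun \+ @trmx R d d)); split => [|M|M N] /=.
- apply/seteqP; split => M /=; first by move=> ->; apply/matrixP => i j; rewrite !mxE; field.
  by move=> <-; rewrite linearZ/= linearD/= trmxK addrC.
- by apply/matrixP => i j; rewrite !mxE; field.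
- have E (K L : 'M[R]_d) : mxdot (2^-1 *: (K + K^T)) L = 2^-1 * (mxdot K L + mxdot K^T L).
    have := mxdot_linl 2^-1 (K + K^T) 0 L; rewrite mxdot0l !addr0 => ->.
    by have := mxdot_linl 1 K K^T L; rewrite scale1r mul1r => ->.
  by rewrite [RHS]mxdotC !E [mxdot N M]mxdotC [mxdot N^T M]mxdotC -[mxdot M^T N]mxdot_tr trmxK.
Qed.

Theorem theorem6 (R : realType) (d : nat) (d_gt0 : (0 < d)%N)
    (Omega : set 'rV[R]_d) (domOmega : bounded_lipschitz_domain Omega)
    (kind : value_kind) (k : nat)
    (A : diffop R d k (value_rows d kind) (value_cols d kind))
    (U := value_space R d kind) (AU : forall a, U (A a))
    (C : 'rV[R]_d -> {linear 'M[R]_(value_rows d kind, value_cols d kind) ->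
                             'M[R]_(value_rows d kind, value_cols d kind)})
    (Cspd : spd_tensor_field U Omega C)
    (C_PF c_is : R) (C_PF_gt0 : 0 < C_PF) (c_is_gt0 : 0 < c_is)
    (poincare : forall v, H0A U A Omega v ->
       nrm Omega v <= C_PF * nrmU Omega (opA U A Omega v))
    (infsup : forall v, L2 Omega v ->
       ((c_is * nrm Omega v)%:E <=
        ereal_sup [set (ip Omega (opAs A Omega w) v)%:E
                  | w in [set w | HAs U A Omega w /\ nrmAs A Omega w = 1%R]])%E) :
  exists2 Cst : R, 0 < Cst &
  forall (I : finType) (T : I -> set 'rV[R]_d), regular_mesh Omega T ->
  forall (Ht : set ('rV[R]_d -> R))
         (Hts : set ('rV[R]_d -> 'M[R]_(value_rows d kind, value_cols d kind))),
  closed_subspace_of (V := R^o) (nrmA_mesh U A Omega T) (HA_mesh U A Omega T) Ht ->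
  H0A U A Omega `<=` Ht ->
  closed_subspace_of (nrmAs_mesh A Omega T) (HAs_mesh U A Omega T) Hts ->
  HAs U A Omega `<=` Hts ->
  let sol := ultraweak_solution U A Omega T (Ht := Ht) (Hts := Hts) C in
  let leb := lebesgue_rV R d in
  [/\ forall f, L2 Omega f ->
        exists u w phi psi, sol f u w phi psi /\
          forall u' w' phi' psi', sol f u' w' phi' psi' ->
            [/\ ae_eq leb Omega u' u, ae_eq leb Omega w' w, phi' = phi & psi' = psi],
      forall f1 f2, L2 Omega f1 -> L2 Omega f2 ->
        forall u1 w1 phi1 psi1 u2 w2 phi2 psi2,
        sol f1 u1 w1 phi1 psi1 -> sol f2 u2 w2 phi2 psi2 ->
        nrm Omega (fun x => u1 x - u2 x) + nrmU Omega (fun x => w1 x - w2 x)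
        + nrmA_skel U A Omega T (fun dw => phi1 dw - phi2 dw)
        + nrmAs_skel U A Omega T (fun du => psi1 du - psi2 du)
        <= Cst * nrm Omega (fun x => f1 x - f2 x) &
      forall f, L2 Omega f -> forall u w phi psi, sol f u w phi psi ->
        nrm Omega u + nrmU Omega w
        + nrmA_skel U A Omega T phi + nrmAs_skel U A Omega T psi
          <= Cst * nrm Omega f /\
        [/\ H0A U A Omega u,
            HAs U A Omega w /\ ae_eq leb Omega w (fun x => C x (opA U A Omega u x)),
            phi = trace_A U A Omega T (Hts := Hts) u,
            psi = trace_As U A Omega T (Ht := Ht) w &
            HAs U A Omega (fun x => C x (opA U A Omega u x)) /\
            ae_eq leb Omega (opAs A Omega (fun x => C x (opA U A Omega u x))) f]].
Proof.
have [P [UE PP P_sym]] := value_space_projection R d kind.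
have oO : open Omega by case: domOmega.
have mO : measurable Omega by exact: open_measurable_rV.
rewrite {}/U in AU Cspd poincare infsup *.
rewrite UE in AU Cspd poincare infsup *.
(* The constant is fixed here, before any mesh or broken space is introduced. *)
have [Cst Cst0 bound] := strong_solution_bound oO Cspd C_PF_gt0 poincare.
exists Cst; first exact: Cst0.
move=> I T meshT Ht Hts [Ht_mesh _ _ _] H0_Ht [Hts_mesh _ _ _] HAs_Hts.
pose sol := ultraweak_solution [set M | P M = M] A Omega T (Ht := Ht) (Hts := Hts) C.
have solP := ultraweak_solutionP PP P_sym AU oO Cspd meshT H0_Ht HAs_Hts.
have bound0 f u w : L2 Omega f -> strong_solution P A Omega C f u w ->
    nrm Omega u + nrmU Omega w
    + nrmA_skel [set M | P M = M] A Omega T (trace_A [set M | P M = M] A Omega T (Hts := Hts) u)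
    + nrmAs_skel [set M | P M = M] A Omega T (trace_As [set M | P M = M] A Omega T (Ht := Ht) w)
    <= Cst * nrm Omega f.
  move=> Lf S; have [Hu Hw _ _] := S; apply: le_trans (bound f u w Lf S).
  apply: lerD; last exact: (nrmAs_skel_le T Ht Hw).
  by apply: lerD; [exact: lexx|exact: (nrmA_skel_le T Hts (H0A_HA Hu))].
have stable f1 f2 : L2 Omega f1 -> L2 Omega f2 ->
  forall u1 w1 phi1 psi1 u2 w2 phi2 psi2,
    sol f1 u1 w1 phi1 psi1 -> sol f2 u2 w2 phi2 psi2 ->
    nrm Omega (fun x => u1 x - u2 x) + nrmU Omega (fun x => w1 x - w2 x)
    + nrmA_skel [set M | P M = M] A Omega T (fun dw => phi1 dw - phi2 dw)
    + nrmAs_skel [set M | P M = M] A Omega T (fun du => psi1 du - psi2 du)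
    <= Cst * nrm Omega (fun x => f1 x - f2 x).
  move=> L1 L2f u1 w1 phi1 psi1 u2 w2 phi2 psi2.
  move=> /(solP _ _ _ _ _ L1)[S1 -> ->] /(solP _ _ _ _ _ L2f)[S2 -> ->].
  have [Hu1 Hw1 _ _] := S1; have [Hu2 Hw2 _ _] := S2.
  have := bound0 _ _ _ (L2_sub mO L1 L2f) (strong_solution_sub PP P_sym AU oO S1 S2).
  have -> : trace_A [set M | P M = M] A Omega T (Hts := Hts) (fun x => u1 x - u2 x) =
      fun dw => trace_A [set M | P M = M] A Omega T u1 dw - trace_A [set M | P M = M] A Omega T u2 dw.
    have -> : (fun x => u1 x - u2 x) = fun x => -1 * u2 x + u1 x.
      by apply/funext => x; rewrite mulN1r addrC.
    rewrite (trace_A_lin PP P_sym oO meshT Hts_mesh (-1) (H0A_HA Hu2) (H0A_HA Hu1)).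
    by apply/funext => dw; rewrite mulN1r addrC.
  have -> // : trace_As [set M | P M = M] A Omega T (Ht := Ht) (fun x => w1 x - w2 x) =
      fun du => trace_As [set M | P M = M] A Omega T w1 du - trace_As [set M | P M = M] A Omega T w2 du.
  have -> : (fun x => w1 x - w2 x) = fun x => -1 *: w2 x + w1 x.
    by apply/funext => x; rewrite scaleN1r addrC.
  rewrite (trace_As_lin AU oO meshT Ht_mesh (-1) Hw2 Hw1).
  by apply/funext => du; rewrite mulN1r addrC.
split=> //.
- move=> f Lf; have [u [w S]] := strong_solution_exists PP P_sym AU oO Cspd C_PF_gt0 poincare Lf.
  pose phi := trace_A [set M | P M = M] A Omega T (Hts := Hts) u.
  pose psi := trace_As [set M | P M = M] A Omega T (Ht := Ht) w.
  have sol_uw : sol f u w phi psi.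
    by apply/(solP _ _ _ _ _ Lf); split.
  exists u, w, phi, psi; split => //.
  move=> u' w' phi' psi' /(solP _ _ _ _ _ Lf)[S' -> ->].
  have [Hu Hw _ _] := S; have [Hu' Hw' _ _] := S'.
  (* The difference of two solutions solves the strong problem with datum f - f = 0, so the sum of
     its norms is at most 0. *)
  have := bound _ _ _ (L2_sub mO Lf Lf) (strong_solution_sub PP P_sym AU oO S' S).
  have -> : nrm Omega (fun x => f x - f x) = 0.
    rewrite /nrm /ip (_ : (fun x => _) = cst 0) ?/Rintegral ?integral0 ?sqrtr0//.
    by apply/funext => x; rewrite subrr mul0r.
  rewrite mulr0 => le0.
  have [uu ww] : nrm Omega (fun x => u' x - u x) = 0 /\ nrmU Omega (fun x => w' x - w x) = 0.
    have := nrm_ge0 Omega (fun x => u' x - u x); have := nrmU_ge0 Omega (fun x => w' x - w x).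
    have nA : 0 <= nrmA [set M | P M = M] A Omega (fun x => u' x - u x) := sqrtr_ge0 _.
    have nAs : 0 <= nrmAs A Omega (fun x => w' x - w x) := sqrtr_ge0 _.
    move: nA nAs le0; set a := nrmA _ _ _ _; set b := nrmAs _ _ _.
    set p := nrm _ _; set q := nrmU _ _; clearbody a b p q.
    by move=> *; split; lra.
  have aeu := nrmB_ae mO (HA_L2 (H0A_HA Hu')) (HA_L2 (H0A_HA Hu)) uu.
  have aew := nrmUB_ae mO (HAs_L2U Hw') (HAs_L2U Hw) ww.
  split; [exact: aeu|exact: aew|exact: (trace_A_ae P A meshT Hts aeu)|].
  exact: (trace_As_ae P A meshT Ht aew).
- move=> f Lf u w phi psi /(solP _ _ _ _ _ Lf)[S -> ->]; split; first exact: bound0.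
  have [Hu Hw wu wf] := S.
  split=> //; split.
    (* C A u is only a.e. equal to w; membership in the domain of the adjoint carries over along
       that equality. *)
    exact: (HAs_ae Hw (tensor_mul_L2U mO Cspd (opA_L2U (H0A_HA Hu))) wu).
  by rewrite -(opAs_ae A wu).
Qed.
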